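(* Let $G$ be a graph that contains no kites, with maximum degree $\Delta(G)$. (1) Suppose $G$ is embedded in the projective plane. If $\Delta(G)\geq 9$, then $\chi'_l(G)=\Delta(G)$ and $\chi''_l(G)=\Delta(G)+1$. If $\Delta(G)\geq 6$, then $\chi'_l(G)\leq \Delta(G)+1$. If $\Delta(G)\geq 7$, then $\chi''_l(G)\leq \Delta(G)+2$. (2) Suppose $G$ is embedded in the torus or in the Klein bottle. If $\Delta(G)\geq 9$, then $\chi'_l(G)=\Delta(G)$ and $\chi''_l(G)=\Delta(G)+1$. If $\Delta(G)\geq 7$, then $\chi'_l(G)\leq \Delta(G)+1$ and $\chi''_l(G)\leq \Delta(G)+2$.
   Context: All graphs are finite and without loops or multiple edges. A kite is a subgraph formed by two (distinct) 3-cycles that share an edge; ''contains no kites'' means that no two distinct 3-cycles of $G$ share an edge. The list edge chromatic number $\chi'_l(G)$ is the least integer $k$ such that, for every assignment $L$ of a list $L(e)$ of colors to each edge $e\in E(G)$ with $|L(e)|\geq k$ for all $e$, one can choose for each edge $e$ a color from $L(e)$ so that any two distinct edges sharing an endpoint receive different colors. A proper total-coloring of $G$ assigns a color to each $x\in V(G)\cup E(G)$ so that adjacent vertices receive different colors, distinct edges sharing an endpoint receive different colors, and each edge receives a color different from the colors of its two endpoints. The list total chromatic number $\chi''_l(G)$ is the least integer $k$ such that, for every assignment $L$ of a list $L(x)$ of colors to each $x\in V(G)\cup E(G)$ with $|L(x)|\geq k$ for all $x$, there is a proper total-coloring of $G$ in which each $x$ receives a color from $L(x)$. *)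

(* Defs.v *)
From HB Require Import structures.
From Stdlib Require Import Relation_Operators Operators_Properties.
From mathcomp Require Import all_boot all_order all_algebra finmap.
From mathcomp Require Import all_classical all_reals all_analysis.

Set Implicit Arguments.
Unset Strict Implicit.
Unset Printing Implicit Defensive.

Import Order.TTheory GRing.Theory Num.Theory.
Import numFieldNormedType.Exports.

Local Open Scope classical_set_scope.
Local Open Scope ring_scope.

Record sgraph := SGraph {
  vertex :> finType;
  adj : rel vertex;
  adj_sym : symmetric adj;
  adj_irrefl : irreflexive adj
}.

Section Graphs.
Variable G : sgraph.

Definition edge_set : {set {set G}} :=
  [set [set p.1; p.2]%SET | p : G * G & adj p.1 p.2]%SET.

Definition edge : Type := {A : {set G} | A \in edge_set}.

Definition max_degree : nat := (\max_(x : G) #|[set y | adj x y]%SET|)%N.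

(* A 3-cycle of a simple graph is determined by its set of vertices. *)
Definition is_3cycle (T : {set G}) : Prop :=
  #|T| = 3%N /\ {in T &, forall x y, x != y -> adj x y}.

Definition has_kite : Prop :=
  exists (T1 T2 : {set G}) (A : edge),
    [/\ is_3cycle T1, is_3cycle T2, T1 != T2, val A \subset T1
      & val A \subset T2].

Definition edge_conflict : rel edge :=
  fun A B => (A != B) && [exists x : G, (x \in val A) && (x \in val B)].

Definition total_conflict : rel (G + edge)%type := fun a b =>
  match a, b with
  | inl x, inl y => adj x y
  | inl x, inr A | inr A, inl x => x \in val A
  | inr A, inr B => edge_conflict A B
  end.

Lemma edge_conflict_irrefl : irreflexive edge_conflict.
Proof. by move=> A; rewrite /edge_conflict eqxx. Qed.

Lemma total_conflict_irrefl : irreflexive total_conflict.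
Proof. by case=> [x|A] /=; rewrite ?adj_irrefl ?edge_conflict_irrefl. Qed.

End Graphs.

Section ListColoring.
Variables (I : finType) (r : rel I).

Definition choosable (k : nat) : Prop :=
  forall (C : choiceType) (L : I -> {fset C}),
    (forall i, (k <= #|` L i|)%N) ->
    exists c : I -> C,
      (forall i, c i \in L i) /\ (forall i j, r i j -> c i != c j).

Lemma choosable_card : irreflexive r -> choosable #|I|.
Proof.
move=> r_irr C L sizeL.
suff /(_ (enum I) (enum_uniq _)) [c cL c_inj] : forall s : seq I, uniq s ->
    exists2 c : I -> C, (forall i, c i \in L i) & {in s &, injective c}.
  exists c; split=> // i j rij; apply/eqP => /c_inj ij.
  by move: rij; rewrite ij ?mem_enum // r_irr.
elim=> [_|x s IHs /=].
  have L0 i : exists y, y \in L i.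
    apply/fset0Pn; rewrite -cardfs_gt0; apply: leq_trans (sizeL i).
    by apply/card_gt0P; exists i.
  by exists (fun i => xchoose (L0 i)) => // i; exact: xchooseP.
case/andP=> xs us; have [c cL c_inj] := IHs us.
have [y yL yc] : exists2 y, y \in L x & y \notin [seq c i | i <- s].
  apply: contrapT => noy.
  have /fsubset_leq_card : (L x `<=` [fset z in [seq c i | i <- s]])%fset.
    apply/fsubsetP => z zL; rewrite inE; apply: contrapT => /negP zc.
    by apply: noy; exists z.
  have ltsI : (size s < #|I|)%N.
    by have /card_uniqP /= <- : uniq (x :: s); rewrite ?max_card //= xs us.
  move=> /(leq_trans (sizeL x)) /(leq_trans ltsI).
  by rewrite card_fseq ltnNge (leq_trans (size_undup _)) // size_map.
exists (fun i => if i == x then y else c i) => [i|i j].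
  by case: eqP => [->|].
have cy k : k \in s -> c k <> y by move=> ks E; case/negP: yc; rewrite -E map_f.
rewrite !inE; case: (i =P x) => [-> _|_ /= is_]; case: (j =P x) => [->|_ /= js] //.
- by move=> /esym /cy; case.
- by move=> _ /cy; case.
- exact: c_inj.
Qed.

Lemma ex_choosable : irreflexive r -> exists k, `[< choosable k >].
Proof. by move=> r_irr; exists #|I|; apply/asboolP; exact: choosable_card. Qed.

Definition list_chromatic_number (r_irr : irreflexive r) : nat :=
  ex_minn (ex_choosable r_irr).

End ListColoring.

Definition list_edge_chromatic_number (G : sgraph) : nat :=
  list_chromatic_number (@edge_conflict_irrefl G).

Definition list_total_chromatic_number (G : sgraph) : nat :=
  list_chromatic_number (@total_conflict_irrefl G).

Section Surfaces.
Variables (R : realType) (a b : bool).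

Definition unit_square : set (R * R) := `[0, 1] `*` `[0, 1].

(* Identification of opposite sides of the square: the left side with the
   right one, reversing the direction when a holds, and the bottom side with
   the top one, reversing the direction when b holds. With both reversed,
   antipodal boundary points are identified. *)
Inductive side_glue : R * R -> R * R -> Prop :=
| glue_left_right t : side_glue (0, t) (1, if a then 1 - t else t)
| glue_bottom_top t : side_glue (t, 0) (if b then 1 - t else t, 1).

Definition glue_rel : rel unit_square := fun p q =>
  `[< clos_refl_sym_trans unit_square
        (fun p q => side_glue (val p) (val q)) p q >].

Lemma glue_rel_refl : reflexive glue_rel.
Proof. by move=> p; apply/asboolP; exact: rst_refl. Qed.

Lemma glue_rel_sym : symmetric glue_rel.
Proof. by move=> p q; apply/asboolP/asboolP; exact: rst_sym. Qed.

Lemma glue_rel_trans : transitive glue_rel.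
Proof.
by move=> q p s /asboolP pq /asboolP qs; apply/asboolP; exact: rst_trans pq qs.
Qed.

Definition glue_equiv : equiv_rel unit_square :=
  EquivRel glue_rel glue_rel_refl glue_rel_sym glue_rel_trans.

Definition glued_square : topologicalType :=
  quotient_topology {eq_quot glue_equiv}%qT.

End Surfaces.

Arguments unit_square : clear implicits.
Arguments glue_rel : clear implicits.
Arguments glue_equiv : clear implicits.

Definition projective_plane (R : realType) := glued_square R true true.
Definition torus (R : realType) := glued_square R false false.
Definition klein_bottle (R : realType) := glued_square R true false.

Record embedding (R : realType) (G : sgraph) (S : topologicalType) := Embedding {
  point_of : G -> S;
  arc_of : edge G -> R -> S;
  point_inj : injective point_of;
  arc_continuous : forall A : edge G, {within `[0, 1], continuous (arc_of A)};
  arc_inj : forall A : edge G, {in `[0, 1] &, injective (arc_of A)};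
  arc_ends : forall A : edge G, exists x y : G,
    [/\ val A = [set x; y]%SET, arc_of A 0 = point_of x
      & arc_of A 1 = point_of y];
  arc_point : forall (A : edge G) (t : R) (x : G),
    t \in `]0, 1[ -> arc_of A t <> point_of x;
  arc_arc : forall (A B : edge G) (s t : R),
    A != B -> s \in `]0, 1[ -> t \in `]0, 1[ -> arc_of A s <> arc_of B t
}.

Definition embeddable (R : realType) (G : sgraph) (S : topologicalType) : Prop :=
  inhabited (embedding R G S).

(* Main.v *)
Require Import Defs.
From HB Require Import structures.
From Stdlib Require Import Relation_Operators Operators_Properties.
From mathcomp Require Import all_boot all_order all_algebra finmap.
From mathcomp Require Import zify ring lra.

Set Implicit Arguments.
Unset Strict Implicit.
Unset Printing Implicit Defensive.

(** The bounds on list colourings of the edges and on total list colourings have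
    the same proof, as edge colourings are total colourings in which the
    vertices have long lists of private colours. Fix lists such that an edge
    keeps at least m colours once the colour of one end is removed and a vertex
    has at least l colours. If there is no colouring, choose an
    inclusion-minimal set F of edges that cannot be coloured together with all
    vertices.

    Minimality restricts F through one principle, [extend_coloring]: remove a
    bipartite set F0 of edges between a set U of vertices of small degree and
    its complement, colour the rest, colour F0 from what remains of its lists,
    and colour U last. With one edge as F0 this bounds degree sums of adjacent
    vertices from below ([min_degree_sum]). With the list edge colouring
    theorems for bipartite graphs, which follow from Galvin's argument with
    stable matchings and from Hall's theorem, it excludes 2-regular
    ([no_two_regular]) and 3-alternating ([no_three_alternating]) subgraphs. So
    the number of vertices of smallest degree is bounded by that of vertices of
    large degree ([low_degree_forest], [three_masters]).

    On the other hand let S be the set of vertices that F covers and t the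
    number of triangles in F. Euler's formula for the surface gives
    2 |F| + 4 chi <= 4 |S| + t, with chi = 1 for the projective plane and
    chi = 0 for the torus and the Klein bottle. Without kites the triangles are
    edge-disjoint, so a vertex of degree d lies on at most d / 2 of them.
    Charging every triangle to its vertices of degree at least 5 turns the
    inequality into one between the numbers of vertices of each degree, and it
    contradicts the restrictions above ([discharge_tight], [discharge_loose],
    [discharge_six]).

    Euler's inequality is proved for a topological embedding without
    triangulations or the Jordan curve theorem ([embedded_euler]). The surface
    is a glued square, divided into a grid of N times N cells. For large N the
    cells near the arcs that leave a vertex, together with a part of the cells
    near the middle of these arcs, form connected sets of cells, disjoint for
    distinct vertices, and every edge of G gives a pair of neighbouring cells.
    Hence G is a minor of the cell adjacency graph ([ex_crossing],
    [fibre_connected]). For that graph the corners of the grid are faces, and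
    their boundaries span a subspace of codimension at most 2 - chi in the
    cycle space over the field with two elements ([codim_around]). The
    codimension does not grow when cells are contracted and edges deleted
    ([minor_euler]), so the cycle space of F is spanned up to that codimension
    by even edge sets that together contain each edge at most twice. Such sets
    have at least three edges, and four unless they are triangles
    ([face_count]). *)

(** * Hall's theorem *)

Section Hall.
Variables (I T : finType) (t0 : T).

Lemma card_bigcup_setD (N : I -> {set T}) (S : {set I}) (B : {set T}) :
  #|\bigcup_(i in S) N i| <= #|\bigcup_(i in S) (N i :\: B)| + #|B|.
Proof.
apply: leq_trans (leq_card_setU _ _); apply/subset_leq_card/subsetP => x.
case/bigcupP=> i iS xi; rewrite inE; case: (boolP (x \in B)) => xB.
  by rewrite orbT.
by rewrite orbF; apply/bigcupP; exists i; rewrite // inE xB.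
Qed.

(** Halmos and Vaughan's induction: a proper nonempty tight subfamily is
    matched on its own and the others avoid its neighbourhood; if no subfamily
    is tight, an arbitrary first choice can be fixed. *)
Theorem hall (N : I -> {set T}) (J : {set I}) :
  (forall S : {set I}, S \subset J -> #|S| <= #|\bigcup_(i in S) N i|) ->
  exists f : I -> T,
    {in J &, injective f} /\ {in J, forall i, f i \in N i}.
Proof.
move: {2}#|J| (leqnn #|J|) N => n; elim: n J => [|n IHn] J.
  rewrite leqn0 cards_eq0 => /eqP -> M H.
  by exists (fun _ => t0); split=> i; rewrite inE.
move=> leJ M H.
have [->|[i iJ]] := set_0Vmem J.
  by exists (fun _ => t0); split=> j; rewrite inE.
case: (boolP [exists S : {set I},
    [&& S \proper J, S != set0 & #|\bigcup_(i in S) M i| <= #|S|]]).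
  case/existsP=> S /and3P[SJ S0 SM].
  have SsJ := proper_sub SJ.
  set B := \bigcup_(i in S) M i in SM.
  have [f [finj fM]] : exists f : I -> T,
      {in S &, injective f} /\ {in S, forall i, f i \in M i}.
    apply: IHn; first by have := proper_card SJ; lia.
    by move=> S' S'S; apply: H; exact: subset_trans SsJ.
  have [g [ginj gM]] : exists g : I -> T, {in J :\: S &, injective g} /\
      {in J :\: S, forall i, g i \in M i :\: B}.
    apply: IHn.
      have := cardsD J S; have := subset_leq_card SsJ.
      by rewrite (setIidPr SsJ); move: S0; rewrite -card_gt0; lia.
    move=> S' S'J; have S'S : [disjoint S' & S].
      rewrite disjoint_subset; apply/subsetP => x /(subsetP S'J).
      by rewrite !inE => /andP[].
    have /H : S' :|: S \subset J.
      by rewrite subUset SsJ andbT (subset_trans S'J) // subsetDl.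
    rewrite cardsU (disjoint_setI0 S'S) cards0 subn0 bigcup_setU => le1.
    have UE : \bigcup_(k in S') M k :|: B
        \subset (\bigcup_(k in S') (M k :\: B)) :|: B.
      apply/subsetP => x; rewrite !inE; case: (boolP (x \in B)) => xB.
        by rewrite !orbT.
      rewrite !orbF => /bigcupP[k kS' xk].
      by apply/bigcupP; exists k; rewrite // inE xB.
    have := subset_leq_card UE; have [+ _] := leq_card_setU (\bigcup_(k in S') (M k :\: B)) B.
    by rewrite -/B in le1; lia.
  exists (fun k => if k \in S then f k else g k); split=> [k l kJ lJ|k kJ].
    case: ifPn => kS; case: ifPn => lS; first exact: finj.
    - move=> E; have := gM l; rewrite -E !inE lS lJ => /(_ isT) /andP[/negP[]].
      by apply/bigcupP; exists k => //; exact: fM.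
    - move=> E; have := gM k; rewrite E !inE kS kJ => /(_ isT) /andP[/negP[]].
      by apply/bigcupP; exists l => //; exact: fM.
    - by apply: ginj; rewrite inE ?kS ?lS.
  case: ifPn => kS; first exact: fM.
  by have := gM k; rewrite !inE kS kJ => /(_ isT) /andP[].
rewrite negb_exists => /forallP tight.
have [t tM] : exists t, t \in M i.
  by apply/card_gt0P; have := H [set i]; rewrite sub1set cards1 big_set1; apply.
have [f [finj fM]] : exists f : I -> T,
    {in J :\ i &, injective f} /\ {in J :\ i, forall k, f k \in M k :\ t}.
  apply: IHn; first by have := cardsD1 i J; rewrite iJ; lia.
  move=> S SJ; have [->|S0] := eqVneq S set0; first by rewrite cards0.
  have /and3P := tight S; rewrite S0.
  have iS : i \notin S by apply/negP => /(subsetP SJ); rewrite !inE eqxx.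
  have -> : S \proper J.
    apply/properP; split; first exact: subset_trans SJ (subD1set _ _).
    by exists i.
  have : #|\bigcup_(k in S) M k| <= #|\bigcup_(k in S) (M k :\ t)|.+1.
    by have := card_bigcup_setD M S [set t]; rewrite cards1 addn1.
  by case: (leqP #|\bigcup_(k in S) M k| #|S|) => [? ? []|? ? _] //; lia.
exists (fun k => if k == i then t else f k); split=> [k l kJ lJ|k kJ].
  case: eqP => [->|/eqP ki]; case: eqP => [->|/eqP li] //.
  - by move=> E; have := fM l; rewrite -E !inE eqxx li lJ => /(_ isT).
  - by move=> E; have := fM k; rewrite E !inE eqxx ki kJ => /(_ isT).
  - by apply: finj; rewrite !inE ?ki ?li.
case: eqP => [->//|/eqP ki]; have := fM k; rewrite !inE ki kJ.
by move=> /(_ isT)/andP[].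
Qed.
End Hall.

(** * Stable matchings and Galvin's theorem *)

Section Galvin.
Variables (E : finType) (U W : eqType) (a : E -> U) (b : E -> W).
Variables (pa pb : E -> nat).
Hypotheses (pa_inj : injective pa) (pb_inj : injective pb).

(** An edge e of a bipartite graph has the ends a e and b e, of different
    types, so only ends on the same side can coincide. *)
Definition meets e f := (a e == a f) || (b e == b f).

(** Smaller values of pa and pb mean higher preference. *)
Definition dominates f e :=
  (a f == a e) && (pa f < pa e) || (b f == b e) && (pb f < pb e).

(** Every vertex on the a-side proposes its best edge. If two proposals
    collide, the worse one can be deleted from S: whatever stable matching
    remains, either the better proposal belongs to it or is itself dominated
    at the b-side, so that the deleted edge is dominated as well. *)
Lemma stable_matching (S : {set E}) :
  exists M : {set E},
    [/\ M \subset S, {in M &, forall e f, meets e f -> e = f}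
      & forall e, e \in S -> e \notin M -> exists2 f, f \in M & dominates f e].
Proof.
move: {2}#|S| (leqnn #|S|) => n; elim: n S => [|n IHn] S leS.
  exists set0; split=> [|e f|e eS]; rewrite ?sub0set ?inE //.
  by move: leS; rewrite leqn0 cards_eq0 => /eqP S0; rewrite S0 inE in eS.
pose top e := (e \in S) && [forall f in S, (a f == a e) ==> (pa e <= pa f)].
have topS e : top e -> e \in S by case/andP.
have topP e f : top e -> f \in S -> a f = a e -> pa e <= pa f.
  by case/andP=> _ /forall_inP H /H /implyP + afe; rewrite afe eqxx; apply.
case: (boolP [exists e, exists f,
    [&& top e, top f, b e == b f & pb f < pb e]]).
  case/existsP=> e /existsP[f /and4P[te tf /eqP bef lt_fe]].
  have fe : f != e by apply: contraTneq lt_fe => ->; rewrite ltnn.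
  have [M [MS Mind Mdom]] : exists M : {set E},
    [/\ M \subset S :\ e, {in M &, forall e f, meets e f -> e = f}
      & forall x, x \in S :\ e -> x \notin M ->
          exists2 f, f \in M & dominates f x].
    by apply: IHn; have := cardsD1 e S; rewrite topS //; lia.
  exists M; split=> // [|x xS xM].
    exact: subset_trans MS (subD1set _ _).
  case: (eqVneq x e) => [->|xe]; last by apply: Mdom; rewrite // !inE xe.
  case: (boolP (f \in M)) => fM.
    by exists f; rewrite // /dominates bef eqxx lt_fe orbT.
  have [||g gM gf] := Mdom f; rewrite ?inE ?fe ?topS //.
  exists g => //; move: gf; rewrite /dominates => /orP[/andP[/eqP agf]|].
    have gS : g \in S by move/(subsetP MS): gM; rewrite inE => /andP[].
    by rewrite ltnNge (topP f g).
  case/andP=> /eqP bgf lt_gf; rewrite bgf bef eqxx (ltn_trans lt_gf) //.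
  by rewrite orbT.
rewrite negb_exists => /forallP nocoll.
exists [set e | top e]; split.
- by apply/subsetP => e; rewrite inE => /topS.
- move=> e f; rewrite !inE => te tf /orP[/eqP aef|/eqP bef].
    by apply: pa_inj; apply/eqP; rewrite eqn_leq (topP e f) ?(topP f e) ?topS.
  have := nocoll e; rewrite negb_exists => /forallP /(_ f).
  have := nocoll f; rewrite negb_exists => /forallP /(_ e).
  rewrite te tf bef eqxx /= -!leqNgt => le1 le2.
  by apply: pb_inj; apply/eqP; rewrite eqn_leq le1 le2.
move=> e eS eN; have Pe : (e \in S) && (a e == a e) by rewrite eS eqxx.
have [f0 /andP[f0S /eqP af0] minf] : exists2 f0,
    (f0 \in S) && (a f0 == a e)
    & forall g, (g \in S) && (a g == a e) -> pa f0 <= pa g.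
  case: (@arg_minnP _ e (fun f => (f \in S) && (a f == a e)) pa Pe).
  by move=> g; exists g.
have tf0 : top f0.
  rewrite /top f0S; apply/forall_inP => g gS; apply/implyP => /eqP agf.
  by apply: minf; rewrite gS agf af0 eqxx.
case: (eqVneq f0 e) => [E0|f0e]; first by rewrite inE -E0 tf0 in eN.
exists f0; first by rewrite inE.
rewrite /dominates af0 eqxx ltn_neqAle minf ?Pe ?andbT //=.
by rewrite (inj_eq pa_inj) f0e.
Qed.

(** A stable matching among the edges whose lists contain x receives the
    colour x. Every other edge with x in its list loses one colour and at
    least one dominating edge, so the hypothesis is inherited by the remaining
    edges. *)
Lemma galvin (C : choiceType) (c0 : C) (F : {set E}) (L : E -> {fset C}) :
  {in F, forall e, #|[set f in F | dominates f e]| < #|` L e|} ->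
  exists c : E -> C, {in F, forall e, c e \in L e} /\
    {in F &, forall e f, meets e f -> c e = c f -> e = f}.
Proof.
move: {2}#|F| (leqnn #|F|) L => n; elim: n F => [|n IHn] F leF L HF.
  exists (fun=> c0); split=> e; move: leF;
  by rewrite leqn0 cards_eq0 => /eqP ->; rewrite inE.
have [F0|[e0 e0F]] := set_0Vmem F.
  by exists (fun=> c0); split=> e; rewrite F0 inE.
have [x xL] : exists x, x \in L e0.
  by apply/fset0Pn; rewrite -cardfs_gt0; apply: leq_ltn_trans (HF _ e0F).
have [M [MS Mind Mdom]] := stable_matching [set e in F | x \in L e].
have [c [cL c_inj]] : exists c : E -> C,
    {in F :\: M, forall e, c e \in (L e `\ x)%fset} /\
    {in F :\: M &, forall e f, meets e f -> c e = c f -> e = f}.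
  apply: IHn => [|e].
    have [f fM] : exists f, f \in M.
      case: (boolP (e0 \in M)) => [|e0M]; first by exists e0.
      by have [|f fM _] := Mdom e0 _ e0M; [rewrite inE e0F | exists f].
    have fF : f \in F by move/(subsetP MS): fM; rewrite inE => /andP[].
    have : F :\: M \subset F :\ f.
      by apply: setDS; rewrite sub1set.
    by move/subset_leq_card; have := cardsD1 f F; rewrite fF; lia.
  rewrite inE => /andP[eM eF]; have := HF e eF.
  rewrite [X in _ < X -> _](cardfsD1 x).
  have sub1 : [set f in F :\: M | dominates f e]
              \subset [set f in F | dominates f e].
    by apply/subsetP => f; rewrite !inE -!andbA => /and3P[_ -> ->].
  case: (boolP (x \in L e)) => xLe; last by have := subset_leq_card sub1; lia.
  have [|f fM fe] := Mdom e _ eM; first by rewrite inE eF.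
  have fF : f \in F by move/(subsetP MS): fM; rewrite inE => /andP[].
  have : #|[set f in F :\: M | dominates f e]| < #|[set f in F | dominates f e]|.
    apply: proper_card; apply/properP; split=> //.
    by exists f; rewrite !inE ?fF ?fM.
  by rewrite add1n; lia.
exists (fun e => if e \in M then x else c e); split=> [e eF|e f eF fF ef].
  case: ifPn => eM; first by move/(subsetP MS): eM; rewrite inE => /andP[].
  by have := cL e; rewrite !inE eM eF => /(_ isT)/andP[].
case: ifPn => eM; case: ifPn => fM E0.
- exact: Mind.
- by have := cL f; rewrite -E0 !inE fM fF eqxx => /(_ isT).
- by have := cL e; rewrite E0 !inE eM eF eqxx => /(_ isT).
- by apply: c_inj; rewrite // inE ?eM ?fM.
Qed.

End Galvin.

(** * List edge colourings of bipartite graphs *)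

Section Bipartite.
Variables (E V : finType) (a b : E -> V).
Implicit Types F S : {set E}.

Lemma card_fibers F (g : E -> V) (S : {set V}) :
  {in F, forall e, g e \in S} -> #|F| = \sum_(v in S) #|[set e in F | g e == v]|.
Proof.
move=> gS; rewrite -sum1_card (partition_big g (mem S)) //=.
apply: eq_bigr => v _; rewrite -sum1_card; apply: eq_bigl => e.
by rewrite inE.
Qed.

Definition list_colorable (C : choiceType) F (L : E -> {fset C}) :=
  exists c : E -> C, {in F, forall e, c e \in L e} /\
    {in F &, forall e f, meets a b e f -> c e = c f -> e = f}.

(** Galvin's theorem with preferences given by levels: the a-side prefers low
    levels and the b-side prefers high levels. The bounds say that an edge is
    dominated by at most lev e edges at the end a e, and by fewer than |L e| -
    lev e edges at the end b e. *)
Lemma galvin_levels (C : choiceType) (c0 : C) F (L : E -> {fset C})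
    (lev : E -> nat) :
  {in F, forall e,
     #|[set f in F | (a f == a e) && (lev f <= lev e)]| <= (lev e).+1} ->
  {in F, forall e, #|[set f in F | b f == b e]| + lev e <=
     #|` L e| + #|[set f in F | (b f == b e) && (lev f < lev e)]|} ->
  list_colorable F L.
Proof.
move=> Ha Hb.
pose K := #|E|; pose M := \max_e lev e.
pose rk (e : E) : nat := enum_rank e.
have rkK e : rk e < K by exact: ltn_ord.
have levM e : lev e <= M by exact: leq_bigmax.
(* Ties between edges of the same level are broken by their rank. *)
pose pa e := lev e * K + rk e; pose pb e := (M - lev e) * K + rk e.
have rk_inj e f : rk e = rk f -> e = f.
  by move=> /val_inj /enum_rank_inj.
have key (x y r s : nat) : r < K -> s < K -> x * K + r < y * K + s -> x <= y.
  move=> rK sK H; rewrite leqNgt; apply/negP => lt_yx.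
  have := leq_mul lt_yx (leqnn K); rewrite mulSn; lia.
have key2 (x y r s : nat) : r < K -> s < K -> x * K + r = y * K + s -> r = s.
  move=> rK sK /(congr1 (modn^~ K)).
  by rewrite !modnMDl !modn_small.
have pa_inj : injective pa.
  by move=> e f /(key2 _ _ _ _ (rkK e) (rkK f)) /rk_inj.
have pb_inj : injective pb.
  by move=> e f /(key2 _ _ _ _ (rkK e) (rkK f)) /rk_inj.
apply: (galvin pa_inj pb_inj c0) => e eF.
pose A := [set f in F | (a f == a e) && (lev f <= lev e)].
pose B := [set f in F | b f == b e].
pose B' := [set f in F | (b f == b e) && (lev f < lev e)].
have eA : e \in A by rewrite !inE eF eqxx leqnn.
have eB : e \in B :\: B' by rewrite !inE eF eqxx ltnn.
have sub : [set f in F | dominates a b pa pb f e]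
    \subset (A :\ e) :|: ((B :\: B') :\ e).
  apply/subsetP => f; rewrite !inE => /andP[fF].
  rewrite /dominates fF /=; case/orP => /andP[-> lt_p] /=.
    have fe : f != e by apply: contraTneq lt_p => ->; rewrite ltnn.
    by rewrite fe /= (key _ _ _ _ (rkK f) (rkK e) lt_p).
  have fe : f != e by apply: contraTneq lt_p => ->; rewrite ltnn.
  rewrite fe /= -leqNgt andbT.
  have := key _ _ _ _ (rkK f) (rkK e) lt_p; have := levM e; have := levM f.
  by move=> ? ? ?; apply/orP; right; lia.
have := subset_leq_card sub; have [+ _] := leq_card_setU (A :\ e) ((B :\: B') :\ e).
have := Ha e eF; rewrite -/A (cardsD1 e A) eA.
have := Hb e eF; rewrite -/B -/B'.
have : B' \subset B by apply/subsetP => f; rewrite !inE => /and3P[-> ->].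
move=> /setIidPr BB; have := cardsD B B'; rewrite BB => cBB.
have := cardsD1 e (B :\: B'); rewrite eB cBB.
have : 0 < #|B :\: B'| by apply/card_gt0P; exists e.
rewrite cBB; lia.
Qed.

(** Each w in B has at least j edges and each a-vertex at most j, so counting
    the edges that end in a subset of B gives Hall's condition. *)
Lemma hall_degree (e0 : E) F (B : {set V}) j : 0 < j ->
  {in B, forall w, j <= #|[set e in F | b e == w]|} ->
  {in F, forall e, #|[set f in F | a f == a e]| <= j} ->
  exists m : V -> E, {in B, forall w, m w \in F /\ b (m w) = w} /\
    {in B &, injective (a \o m)}.
Proof.
move=> j0 degB degA.
pose N w := [set a e | e in F & b e == w].
have [|f [f_inj fN]] := @hall V V (a e0) N B.
  move=> S SB; rewrite -(leq_pmul2l j0).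
  pose X := [set e in F | b e \in S].
  apply: (@leq_trans #|X|).
    rewrite (@card_fibers _ b S); last by move=> e; rewrite inE => /andP[].
    rewrite mulnC -sum_nat_const; apply: leq_sum => w wS.
    apply: leq_trans (degB w (subsetP SB w wS)) _.
    apply/subset_leq_card/subsetP => e; rewrite !inE => /andP[-> /eqP bw].
    by rewrite bw wS eqxx.
  rewrite (@card_fibers _ a (\bigcup_(i in S) N i)); last first.
    move=> e; rewrite inE => /andP[eF eS]; apply/bigcupP; exists (b e) => //.
    by apply/imsetP; exists e => //; rewrite inE eF eqxx.
  rewrite mulnC -sum_nat_const; apply: leq_sum => u.
  case/bigcupP => w wS /imsetP[e]; rewrite inE => /andP[eF _] ->.
  apply: leq_trans (degA e eF).
  by apply/subset_leq_card/subsetP => g; rewrite !inE => /andP[/andP[-> _] ->].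
pose m w := odflt e0 [pick e in F | (b e == w) && (a e == f w)].
have mP w : w \in B -> [/\ m w \in F, b (m w) = w & a (m w) = f w].
  move=> wB; rewrite /m; case: pickP => [e /and3P[? /eqP ? /eqP ?]|no] //=.
  have /imsetP[e] := fN w wB; rewrite inE => /andP[eF be] ae.
  by have := no e; rewrite eF be ae eqxx.
exists m; split=> [w /mP[]//|w w' wB wB' /=].
by have [_ _ ->] := mP _ wB; have [_ _ ->] := mP _ wB'; exact: f_inj.
Qed.

(** By Hall's theorem some matching covers the b-side. Its edges get level 0
    and the others level 1. *)
Lemma two_regular_colorable (C : choiceType) (c0 : C) F (L : E -> {fset C}) :
  {in F, forall e, #|[set f in F | a f == a e]| <= 2} ->
  {in F, forall e, #|[set f in F | b f == b e]| = 2} ->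
  {in F, forall e, 2 <= #|` L e|} ->
  list_colorable F L.
Proof.
move=> dA dB sL.
have [->|[e0 e0F]] := set_0Vmem F.
  by exists (fun=> c0); split=> e; rewrite inE.
have [|m [mF m_inj]] := @hall_degree e0 F [set b e | e in F] 2 isT _ dA.
  by move=> w /imsetP[e eF ->]; rewrite dB.
pose M := [set m w | w in [set b e | e in F]].
have MP e : e \in M -> e \in F /\ e = m (b e).
  case/imsetP=> w wB ->; have [mwF bmw] := mF w wB.
  by rewrite mwF bmw.
apply: (@galvin_levels C c0 F L (fun e => (e \notin M : nat))) => e eF /=.
  case: (boolP (e \in M)) => eM /=; last first.
    apply: leq_trans (dA e eF).
    by apply/subset_leq_card/subsetP => f; rewrite !inE => /and3P[-> ->].
  apply: (@leq_trans #|[set e]|); last by rewrite cards1.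
  apply/subset_leq_card/subsetP => f; rewrite !inE => /and3P[fF /eqP afe].
  case: (boolP (f \in M)) => //= /MP[_ fm] _; have [_ em] := MP e eM.
  by apply/eqP; rewrite fm em; congr (m _); apply: m_inj;
    rewrite ?imset_f //= -fm -em.
rewrite dB //; case: (boolP (e \in M)) => eM /=.
  by have := sL e eF; lia.
suff : 0 < #|[set f in F | (b f == b e) && ((f \notin M) < 1)]|.
  by have := sL e eF; lia.
apply/card_gt0P; exists (m (b e)).
have [mbF bm] := mF (b e) (imset_f _ eF).
by rewrite inE mbF bm eqxx imset_f // imset_f.
Qed.

(** Lowers the b-degrees no more than necessary; an upper bound on them is
    what [hall_degree] asks for after the two sides are exchanged. *)
Lemma trim F (k : V -> nat) :
  exists2 F' : {set E}, F' \subset F &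
    forall w, #|[set e in F' | b e == w]| = minn (k w) #|[set e in F | b e == w]|.
Proof.
pose st w : seq E := enum [set e in F | b e == w].
exists [set e in F | e \in (take (k (b e)) (st (b e)) : seq E)].
  by apply/subsetP => e; rewrite inE => /andP[].
move=> w; have -> : [set e in [set e in F | e \in (take (k (b e)) (st (b e)) : seq E)]
                      | b e == w] = [set:: take (k w) (st w)].
  apply/setP=> e; rewrite !inE; apply/andP/idP => [[/andP[_ +] /eqP <-]//|H].
  by have := mem_take H; rewrite mem_enum inE => /andP[eF /eqP bew]; rewrite eF bew H.
rewrite cardsE; have /card_uniqP -> : uniq (take (k w) (st w)).
  by rewrite take_uniq // enum_uniq.
by rewrite size_take_min -cardE.
Qed.

End Bipartite.

(** Three levels are used. After trimming the b-degrees to 3 - s, a matching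
    that covers the a-vertices of degree 3 is removed; in the rest F2 the
    a-degrees are at most 2 while the b-degrees are at least 2 - s. A matching
    M0 in F2 covers the b-vertices without slack. Level 0 on M0, 1 on the rest
    of F2 and 2 outside F2 meet the bounds of [galvin_levels]: an a-vertex has
    at most i + 1 edges of level at most i, and the slack s makes up for the
    missing lower edges at a b-vertex. *)
Lemma three_alternating_colorable (E V : finType) (a b : E -> V)
    (C : choiceType) (c0 : C) (F : {set E}) (L : E -> {fset C}) (s : V -> nat) :
  {in F, forall e, #|[set f in F | a f == a e]| <= 3} ->
  {in F, forall e, s (b e) <= 1} ->
  {in F, forall e, 3 <= #|[set f in F | b f == b e]| + s (b e)} ->
  {in F, forall e, #|[set f in F | b f == b e]| + s (b e) <= #|` L e|} ->
  list_colorable a b F L.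
Proof.
move=> dA s1 dB sL.
have [->|[e0 e0F]] := set_0Vmem F.
  by exists (fun=> c0); split=> e; rewrite inE.
have [F1 F1F dF1] := trim b F (fun w => 3 - s w).
pose U3 := [set u | 3 <= #|[set e in F1 | a e == u]|].
have [||m1 [m1F m1_inj]] := @hall_degree E V b a e0 F1 U3 3 isT.
- by move=> u; rewrite inE.
- by move=> e eF1; rewrite dF1; lia.
pose M1 := [set m1 u | u in U3]; pose F2 := F1 :\: M1.
have F2F : F2 \subset F := subset_trans (subsetDl _ _) F1F.
have dA1 u : #|[set e in F1 | a e == u]| <= 3.
  have [->|[e]] := set_0Vmem [set e in F1 | a e == u]; first by rewrite cards0.
  rewrite inE => /andP[eF1 /eqP <-].
  apply: leq_trans (dA e (subsetP F1F e eF1)); apply/subset_leq_card/subsetP => f.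
  by rewrite !inE => /andP[/(subsetP F1F) -> ->].
have dA2 u : #|[set e in F2 | a e == u]| <= 2.
  have sub : [set e in F2 | a e == u] \subset [set e in F1 | a e == u].
    by apply/subsetP => e; rewrite !inE => /andP[/andP[_ ->] ->].
  have := dA1 u; case: (boolP (u \in U3)) => [uU _|]; last first.
    rewrite inE -ltnNge ltnS => le _.
    exact: leq_trans (subset_leq_card sub) le.
  have [mF am] := m1F u uU; rewrite -ltnS; apply: leq_trans (dA1 u).
  apply: proper_card; apply/properP; split=> //; exists (m1 u).
    by rewrite inE mF am eqxx.
  by rewrite !inE imset_f.
have dB2 e : e \in F -> 2 - s (b e) <= #|[set f in F2 | b f == b e]|.
  move=> eF; have := dF1 (b e).
  have leM : #|[set f in M1 | b f == b e]| <= 1.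
    apply/card_le1_eqP => f g; rewrite !inE.
    case/andP=> /imsetP[u uU ->] /eqP bu /andP[/imsetP[v vU ->] /eqP bv].
    by congr m1; apply: m1_inj; rewrite //= bu bv.
  have sub : [set f in F1 | b f == b e]
     \subset [set f in F2 | b f == b e] :|: [set f in M1 | b f == b e].
    by apply/subsetP => f; rewrite !inE => /andP[-> ->]; case: imsetP.
  have := subset_leq_card sub.
  have [+ _] := leq_card_setU [set f in F2 | b f == b e] [set f in M1 | b f == b e].
  have := dB e eF; have := s1 e eF; lia.
pose W0 := [set w in [set b e | e in F] | s w == 0].
have [||m0 [m0F m0_inj]] := @hall_degree E V a b e0 F2 W0 2 isT.
- move=> w; rewrite inE => /andP[/imsetP[e eF ->] /eqP s0].
  by have := dB2 e eF; rewrite s0.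
- by move=> e _; exact: dA2.
pose M0 := [set m0 w | w in W0].
have M0F2 : M0 \subset F2.
  by apply/subsetP => e /imsetP[w wW ->]; have [] := m0F w wW.
(* The levels 0, 1, 2 bound the number of edges of at most that level at an
   a-vertex by 1, 2, 3. *)
pose lev e := if e \in M0 then 0 else if e \in F2 then 1 else 2.
have lev0 e : (lev e < 1) = (e \in M0).
  by rewrite /lev; case: (e \in M0) => //; case: ifP.
have lev1 e : (lev e < 2) = (e \in F2).
  rewrite /lev; case: (boolP (e \in M0)) => [eM|_]; last by case: ifP.
  by rewrite (subsetP M0F2).
apply: (@galvin_levels E V a b C c0 F L lev) => e eF /=.
  have lev2 : lev e <= 2 by rewrite /lev; case: ifP => // _; case: ifP.
  case: (ltngtP (lev e) 1) => [e1|e1|e1].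
  - have -> : lev e = 0 by lia.
    apply/card_le1_eqP => f g; rewrite !inE -!(@ltnS (lev _) 0) !lev0.
    case/andP=> fF /andP[/eqP af /imsetP[u uW fE]].
    case/andP=> gF /andP[/eqP ag /imsetP[v vW gE]].
    by rewrite fE gE; congr m0; apply: m0_inj; rewrite //= -fE -gE af ag.
  - have -> : lev e = 2 by lia.
    apply: leq_trans (dA e eF); apply/subset_leq_card/subsetP => f.
    by rewrite !inE => /and3P[-> ->].
  - rewrite e1; apply: leq_trans (dA2 (a e)).
    apply/subset_leq_card/subsetP => f; rewrite !inE.
    by rewrite -(@ltnS (lev f) 1) lev1 !inE => /and3P[_ -> ->].
suff : lev e <= s (b e) + #|[set f in F | (b f == b e) && (lev f < lev e)]|.
  by have := sL e eF; lia.
have := s1 e eF; have := dB2 e eF.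
set n2 := #|_| => ln2 ls.
rewrite {1}/lev; case: ifPn => // eM; case: ifPn => eF2.
  have -> : lev e = 1 by rewrite /lev (negPf eM) eF2.
  case: (posnP (s (b e))) => [s0|]; last by lia.
  suff : 0 < #|[set f in F | (b f == b e) && (lev f < 1)]| by lia.
  have beW : b e \in W0 by rewrite inE imset_f // s0.
  have [mF bm] := m0F _ beW; apply/card_gt0P; exists (m0 (b e)).
  by rewrite inE (subsetP F2F) // bm eqxx lev0 imset_f.
have -> : lev e = 2 by rewrite /lev (negPf eM) (negPf eF2).
suff : n2 <= #|[set f in F | (b f == b e) && (lev f < 2)]| by lia.
apply/subset_leq_card/subsetP => f; rewrite !inE lev1 => /andP[fF2 ->].
by rewrite (subsetP F2F) ?inE.
Qed.

(** * Extending partial total colourings *)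

Lemma fset_avoid (C : choiceType) (A : {fset C}) (s : seq C) :
  size s < #|` A| -> exists2 x, x \in A & x \notin s.
Proof.
move=> lt_s; have : (A `\` [fset x in s])%fset != fset0.
  rewrite -cardfs_gt0 cardfsD subn_gt0; apply: leq_ltn_trans lt_s.
  apply: leq_trans (fsubset_leq_card (fsubsetIr _ _)) _.
  by rewrite card_fseq size_undup.
by case/fset0Pn=> x; rewrite !inE => /andP[xs xA]; exists x.
Qed.

Lemma card_remove_seq (C : choiceType) (A : {fset C}) (s : seq C) :
  #|` A| <= #|` A `\` [fset x in s]|%fset + size s.
Proof.
have := fsubset_leq_card (fsubsetIr A [fset x in s]%fset).
have : #|` [fset x in s]%fset| <= size s by rewrite card_fseq size_undup.
by rewrite cardfsD; lia.
Qed.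

Section Reduction.
Variables (V E : finType) (ends : E -> {set V}).
Hypothesis card_ends : forall e, #|ends e| = 2.
Implicit Types F : {set E}.

Definition dg F v := #|[set e in F | v \in ends e]|.

Lemma ends_mem e : exists u v, u != v /\ ends e = [set u; v].
Proof.
by have /eqP/cards2P[u [v [uv E0]]] := card_ends e; exists u, v.
Qed.

Lemma ends_eq e u v : u \in ends e -> v \in ends e -> u != v ->
  ends e = [set u; v].
Proof.
move=> ue ve uv; apply/esym/eqP; rewrite eqEcard card_ends cards2 uv.
by rewrite andbT subUset !sub1set ue.
Qed.

Lemma dgS F F' v : F \subset F' -> dg F v <= dg F' v.
Proof.
move=> FF'; apply/subset_leq_card/subsetP => e; rewrite !inE.
by case/andP=> /(subsetP FF') -> ->.
Qed.

Lemma dgD F F' v : F' \subset F -> dg (F :\: F') v = dg F v - dg F' v.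
Proof.
move=> F'F; rewrite /dg.
have sub : [set e in F' | v \in ends e] \subset [set e in F | v \in ends e].
  by apply/subsetP => e; rewrite !inE => /andP[/(subsetP F'F) -> ->].
have := cardsD [set e in F | v \in ends e] [set e in F' | v \in ends e].
rewrite (setIidPr sub) => <-; apply: eq_card => e.
by rewrite !inE; case: (e \in F'); case: (e \in F); case: (v \in ends e).
Qed.

Variables (C : choiceType) (Lv : V -> {fset C}) (Le : E -> {fset C}).

(** All vertices are coloured, but only the edges in F: ends of an edge
    outside F may get the same colour. *)
Definition total_colorable F := exists (cv : V -> C) (ce : E -> C),
  [/\ forall v, cv v \in Lv v, {in F, forall e, ce e \in Le e},
      {in F, forall e, {in ends e, forall v, ce e != cv v}},
      {in F, forall e, {in ends e &, forall u v, u != v -> cv u != cv v}}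
    & {in F &, forall e f v, v \in ends e -> v \in ends f ->
        ce e = ce f -> e = f}].

Variables (m l : nat).
Hypothesis Le_size :
  forall e v x, v \in ends e -> x \in Lv v -> m <= #|` Le e `\ x|%fset.
Hypothesis Lv_size : forall v, l <= #|` Lv v|.

(** Start from a colouring without F0 and forget the colours of U. An edge e
    of F0 has to avoid the colour of its end b e, which is kept, and the
    colours of the edges outside F0 at its two ends; H colours F0 from what
    remains. A vertex u of U then has at most 2 dg F u forbidden colours, one
    for each edge at u and one for the other end of that edge, and as U is
    independent its vertices do not interact. *)
Lemma extend_coloring F F0 (a b : E -> V) (U : {set V}) :
  F0 \subset F -> {in F0, forall e, ends e = [set a e; b e]} ->
  {in F0, forall e, a e \in U} -> {in F0, forall e, b e \notin U} ->
  {in F, forall e, ~~ (ends e \subset U)} ->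
  {in U, forall u, 2 * dg F u < l} ->
  total_colorable (F :\: F0) ->
  (forall L : E -> {fset C},
     {in F0, forall e, m + dg F0 (a e) + dg F0 (b e) <=
                       #|` L e| + dg F (a e) + dg F (b e)} ->
     list_colorable a b F0 L) ->
  total_colorable F.
Proof.
move=> F0F endsE aU bU indU smallU [cv [ce [cvL ceL ce_cv cv_cv ce_ce]]] H.
pose adj e := enum [set f in F :\: F0 | (a e \in ends f)] ++
              enum [set f in F :\: F0 | (b e \in ends f)].
pose L e := ((Le e `\ cv (b e)) `\` [fset x in [seq ce f | f <- adj e]])%fset.
have be_ends e : e \in F0 -> b e \in ends e.
  by move=> /endsE ->; rewrite !inE eqxx orbT.
have ae_ends e : e \in F0 -> a e \in ends e.
  by move=> /endsE ->; rewrite !inE eqxx.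
have [|c [cL c_inj]] := H L.
  move=> e eF0; have := Le_size (be_ends e eF0) (cvL (b e)).
  have := card_remove_seq (Le e `\ cv (b e))%fset [seq ce f | f <- adj e].
  rewrite -/(L e) size_map size_cat -!cardE -/(dg _ (a e)) -/(dg _ (b e)).
  rewrite !dgD //; have := dgS (a e) F0F; have := dgS (b e) F0F; lia.
pose ce' e := if e \in F0 then c e else ce e.
have cLe e : e \in F0 -> c e \in Le e.
  by move/cL; rewrite !inE => /and3P[].
have ce'L : {in F, forall e, ce' e \in Le e}.
  move=> e eF; rewrite /ce'; case: ifPn => eF0; first exact: cLe.
  by apply: ceL; rewrite inE eF0.
have mixed e f v : e \in F0 -> f \in F -> f \notin F0 -> v \in ends e ->
    v \in ends f -> c e <> ce f.
  move=> eF0 fF fF0 ve vf E0; have := cL e eF0; rewrite !inE => /andP[+ _].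
  case/negP; apply/mapP; exists f => //; rewrite mem_cat !mem_enum !inE fF fF0 /=.
  by move: ve; rewrite endsE // !inE => /orP[]/eqP <-; rewrite vf ?orbT.
have ce'_inj : {in F &, forall e f v, v \in ends e -> v \in ends f ->
        ce' e = ce' f -> e = f}.
  move=> e f eF fF v ve vf; rewrite /ce'.
  case: ifPn => eF0; case: ifPn => fF0 E0.
  - apply: c_inj => //; move: ve vf; rewrite !endsE // !inE /meets.
    case/orP=> /eqP ->; case/orP=> /eqP E1; rewrite ?E1 ?eqxx ?orbT //.
      by have := bU f fF0; rewrite -E1 aU.
    by have := bU e eF0; rewrite E1 aU.
  - by case: (mixed e f v).
  - by case: (mixed f e v).
  - by apply: (ce_ce e f _ _ v); rewrite // inE ?eF0 ?fF0.
(* The other end of e; the default does not occur for u in ends e. *)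
pose oth u e := odflt u [pick w in ends e :\ u].
have othE e u v : u \in ends e -> v \in ends e -> u != v -> oth u e = v.
  move=> ue ve uv; rewrite /oth; case: pickP => [w|/(_ v)] /=.
    by rewrite (ends_eq ue ve uv) !inE => /andP[/negPf ->] /eqP.
  by rewrite (ends_eq ue ve uv) !inE eq_sym uv eqxx orbT.
pose bad u := [seq cv (oth u e) | e <- enum [set e in F | u \in ends e]] ++
              [seq ce' e | e <- enum [set e in F | u \in ends e]].
have [cv' cv'P] : exists cv' : V -> C, forall v, cv' v \in Lv v /\
    (if v \in U then cv' v \notin bad v else cv' v == cv v).
  apply: (@fin_all_exists V (fun=> C) (fun v x => x \in Lv v /\
    (if v \in U then x \notin bad v else x == cv v))) => v.
  case: (boolP (v \in U)) => [vU|_]; last by exists (cv v); rewrite cvL eqxx.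
  have [|x xL xb] := @fset_avoid _ (Lv v) (bad v); last by exists x.
  rewrite size_cat !size_map -!cardE -/(dg F v).
  by apply: leq_trans (Lv_size v); have := smallU v vU; lia.
have cv'U v : v \notin U -> cv' v = cv v.
  by have [_] := cv'P v; case: ifP => // _ /eqP.
have cv'N u e v : u \in U -> e \in F -> u \in ends e -> v \in ends e ->
    u != v -> cv' u != cv' v.
  move=> uU eF ue ve uv; have vU : v \notin U.
    apply: contra (indU e eF) => vU; rewrite (ends_eq ue ve uv).
    by rewrite subUset !sub1set uU.
  rewrite (cv'U v) //; apply/eqP => E0; have [_] := cv'P u; rewrite uU.
  rewrite mem_cat negb_or => /andP[/negP[]]; apply/mapP; exists e.
    by rewrite mem_enum inE eF.
  by rewrite E0 (othE e u v).
exists cv', ce'; split=> //.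
- by move=> v; have [] := cv'P v.
- move=> e eF v ve; case: (boolP (v \in U)) => vU.
    apply/eqP => E0; have [_] := cv'P v; rewrite vU mem_cat negb_or => /andP[_ /negP[]].
    by rewrite -E0; apply: map_f; rewrite mem_enum inE eF.
  rewrite cv'U // /ce'; case: ifPn => eF0; last by apply: ce_cv; rewrite ?inE ?eF0.
  have := ve; rewrite endsE // !inE => /orP[]/eqP E0.
    by rewrite E0 aU in vU.
  by have := cL e eF0; rewrite E0 !inE => /and3P[].
- move=> e eF u v ue ve uv; case: (boolP (u \in U)) => uU; first exact: (cv'N u e).
  case: (boolP (v \in U)) => vU.
    by rewrite eq_sym; apply: (cv'N v e); rewrite // eq_sym.
  rewrite !cv'U //; have eFF0 : e \in F :\: F0.
    rewrite inE eF andbT; apply/negP => eF0.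
    have := aU e eF0; have := ae_ends e eF0.
    by rewrite (ends_eq ue ve uv) !inE => /orP[]/eqP ->; apply/negP.
  exact: cv_cv eFF0 u v ue ve uv.
Qed.

(** * Minimal uncolourable edge sets *)

Lemma orient (U : {set V}) : exists a b : E -> V, forall e,
  [/\ ends e = [set a e; b e], a e != b e
    & forall v, v \in ends e -> v \in U -> a e \in U].
Proof.
have [ab abP] : exists ab : E -> V * V, forall e,
    [/\ ends e = [set (ab e).1; (ab e).2], (ab e).1 != (ab e).2
      & forall v, v \in ends e -> v \in U -> (ab e).1 \in U].
  apply: (@fin_all_exists E (fun=> (V * V)%type) (fun e p =>
    [/\ ends e = [set p.1; p.2], p.1 != p.2
      & forall v, v \in ends e -> v \in U -> p.1 \in U])) => e.
  have [u [v [uv E0]]] := ends_mem e.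
  case: (boolP (v \in U)) => vU.
    by exists (v, u); split=> //=; rewrite 1?eq_sym // E0 setUC.
  exists (u, v); split=> //= x; rewrite E0 !inE => /orP[]/eqP -> //.
  by rewrite (negPf vU).
by exists (fun e => (ab e).1), (fun e => (ab e).2).
Qed.

Definition support F := [set v | 0 < dg F v].

Lemma in_support F v : v \in support F -> exists2 e, e \in F & v \in ends e.
Proof.
by rewrite inE => /card_gt0P[e]; rewrite inE => /andP[? ?]; exists e.
Qed.

Lemma mem_support F e v : e \in F -> v \in ends e -> v \in support F.
Proof. by move=> eF ve; rewrite inE; apply/card_gt0P; exists e; rewrite inE eF. Qed.

Lemma support2 F e : e \in F -> 2 <= #|support F|.
Proof.
move=> eF; rewrite -(card_ends e); apply/subset_leq_card/subsetP => v.
exact: mem_support.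
Qed.

Lemma handshake F : \sum_(v in support F) dg F v = 2 * #|F|.
Proof.
rewrite (eq_bigr (fun v => \sum_(e in F) (v \in ends e))); last first.
  move=> v _; rewrite /dg -sum1_card big_mkcond /= [RHS]big_mkcond /=.
  by apply: eq_bigr => e _; rewrite inE; case: (e \in F); case: (v \in ends e).
rewrite exchange_big /= mulnC -sum_nat_const; apply: eq_bigr => e eF.
rewrite -(card_ends e) -sum1_card big_mkcond [RHS]big_mkcond /=.
apply: eq_bigr => v _; case: ifPn => // vS; case: ifPn => // ve.
by rewrite (mem_support eF) in vS.
Qed.

Lemma dg_setD1 F e v : e \in F -> dg F v = (v \in ends e) + dg (F :\ e) v.
Proof.
move=> eF; rewrite dgD ?sub1set //.
have := dgS v (_ : [set e] \subset F); rewrite sub1set => /(_ eF).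
suff -> : dg [set e] v = (v \in ends e) by lia.
rewrite /dg; case: (boolP (v \in ends e)) => ve.
  by rewrite -[RHS](cards1 e); apply: eq_card => f; rewrite !inE andb_idr // => /eqP->.
by apply/eqP; rewrite cards_eq0; apply/eqP/setP => f; rewrite !inE;
  apply: contraNF ve => /andP[/eqP->].
Qed.

(** A minimal nonempty edge set with at least as many edges as vertices has no
    vertex of degree 1 and not more edges than vertices, for otherwise an edge
    could be deleted. By the handshake identity all degrees are then 2. *)
Lemma ex_two_regular F : F != set0 -> #|support F| <= #|F| ->
  exists F0 : {set E}, [/\ F0 \subset F, F0 != set0
    & {in support F0, forall v, dg F0 v = 2}].
Proof.
move=> Fn0 leF.
have PF : (F != set0) && (#|support F| <= #|F|) by rewrite Fn0.
have [F0 /minsetP[/andP[F0n0 le0] min0] F0F] :=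
  @minset_exists E (fun F => (F != set0) && (#|support F| <= #|F|)) F PF.
exists F0; split=> //.
have nosmall e (S : {set V}) : e \in F0 -> support (F0 :\ e) \subset S ->
    S \subset support F0 -> #|S| < #|F0| -> False.
  move=> eF0 sub subS lt; suff /min0 : (F0 :\ e != set0) &&
      (#|support (F0 :\ e)| <= #|F0 :\ e|).
    by move=> /(_ (subD1set _ _)) /setP/(_ e); rewrite !inE eqxx eF0.
  have := cardsD1 e F0; rewrite eF0 => cF0.
  have := subset_leq_card sub => leS.
  have := support2 eF0 => s2.
  rewrite -card_gt0; apply/andP; split; lia.
have card_eq : #|F0| = #|support F0|.
  apply/eqP; rewrite eqn_leq le0 andbT leqNgt; apply/negP => lt.
  have [e eF0] := set0Pn _ F0n0.
  apply: (nosmall e (support F0)) => //; apply/subsetP => v; rewrite !inE.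
  by move/leq_trans; apply; exact: dgS (subD1set _ _).
have ge2 : {in support F0, forall v, 2 <= dg F0 v}.
  move=> v vS; have [e eF0 ve] := in_support vS; rewrite leqNgt; apply/negP => lt2.
  apply: (nosmall e (support F0 :\ v)) => //; last 2 first.
  - exact: subD1set.
  - by have := cardsD1 v (support F0); rewrite vS; lia.
  apply/subsetP => w wS; have := wS; rewrite !inE => w0.
  rewrite (leq_trans w0 (dgS w (subD1set F0 e))) andbT.
  apply: contraTneq w0 => ->.
  by have := dg_setD1 v eF0; rewrite ve; lia.
have := handshake F0; rewrite card_eq.
rewrite (eq_bigr (fun v => 2 + (dg F0 v - 2))); last by move=> v /ge2 ?; lia.
rewrite big_split /= sum_nat_const mulnC => E0 v vS.
have /eqP : \sum_(i in support F0) (dg F0 i - 2) = 0 by lia.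
rewrite sum_nat_eq0 => /forallP/(_ v); rewrite vS /= => /eqP.
by have := ge2 v vS; lia.
Qed.

Variable F : {set E}.
Hypothesis F_bad : ~ total_colorable F.
Hypothesis F_min : forall F', F' \proper F -> total_colorable F'.
Variable c0 : C.

Lemma min_setD F0 : F0 \subset F -> F0 != set0 -> total_colorable (F :\: F0).
Proof.
move=> F0F /set0Pn[e eF0]; apply: F_min; apply/properP.
split; first exact: subsetDl.
by exists e; [exact: (subsetP F0F) | rewrite !inE eF0].
Qed.

(** Otherwise e can be coloured after all other edges of F, and then its end
    u. *)
Lemma min_degree_sum e u v : e \in F -> u \in ends e -> v \in ends e ->
  u != v -> 2 * dg F u < l -> m + 2 <= dg F u + dg F v.
Proof.
move=> eF ue ve uv ul; rewrite leqNgt; apply/negP => lt_m; apply: F_bad.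
apply: (@extend_coloring F [set e] (fun=> u) (fun=> v) [set u]).
- by rewrite sub1set.
- by move=> f /set1P->; exact: ends_eq.
- by move=> f _; rewrite inE.
- by move=> f _; rewrite inE eq_sym.
- move=> f fF; apply/negP => /subset_leq_card.
  by rewrite card_ends cards1.
- by move=> w /set1P->.
- by apply: min_setD; rewrite ?sub1set //; apply/set0Pn; exists e; rewrite inE.
move=> L HL; have dg1 w : w \in ends e -> dg [set e] w = 1.
  move=> we; rewrite (dg_setD1 w (set11 e)) we /dg -[RHS]addn0; congr addn.
  by apply/eqP; rewrite cards_eq0; apply/eqP/setP => f; rewrite !inE andNb.
have [x xL] : exists x, x \in L e.
  apply/fset0Pn; rewrite -cardfs_gt0.
  by have := HL e (set11 e); rewrite !dg1 //; lia.
exists (fun=> x); split=> [f /set1P -> //|f g /set1P -> /set1P -> //].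
Qed.

Section Alternating.
Variables (U : {set V}) (a b : E -> V) (F0 : {set E}).
Hypotheses (F0F : F0 \subset F) (F0n0 : F0 != set0)
  (endsE : {in F0, forall e, ends e = [set a e; b e]})
  (aU : {in F0, forall e, a e \in U}) (bU : {in F0, forall e, b e \notin U})
  (indU : {in F, forall e, ~~ (ends e \subset U)})
  (smallU : {in U, forall u, 2 * dg F u < l}).

Lemma dg_a e : e \in F0 -> dg F0 (a e) = #|[set f in F0 | a f == a e]|.
Proof.
move=> eF; apply: eq_card => f; rewrite !inE; case: (boolP (f \in F0)) => //= fF.
rewrite endsE // !inE eq_sym orb_idr // => /eqP E0.
by have := bU fF; rewrite -E0 aU.
Qed.

Lemma dg_b e : e \in F0 -> dg F0 (b e) = #|[set f in F0 | b f == b e]|.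
Proof.
move=> eF; apply: eq_card => f; rewrite !inE; case: (boolP (f \in F0)) => //= fF.
rewrite endsE // !inE [in RHS]eq_sym orb_idl // => /eqP E0.
by have := bU eF; rewrite E0 aU.
Qed.

(** Every edge of F0 keeps at least two colours by the bound on its degree
    sum. *)
Lemma no_two_regular :
  {in F0, forall e, dg F0 (a e) = 2} -> {in F0, forall e, dg F0 (b e) = 2} ->
  {in F0, forall e, dg F (a e) + dg F (b e) <= m + 2} -> False.
Proof.
move=> dA dB dAB; apply: F_bad.
apply: (@extend_coloring F F0 a b U) => //; first exact: min_setD.
move=> L HL; apply: two_regular_colorable => // e eF.
- by rewrite -dg_a // dA.
- by rewrite -dg_b // dB.
- by have := HL e eF; have := dAB e eF; rewrite dA // dB //; lia.
Qed.

(** At the ends in U all edges of F belong to F0, so at least dg F0 (b e) + s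
    (b e) colours remain for e. *)
Lemma no_three_alternating (s : V -> nat) :
  {in F0, forall e, dg F0 (a e) = dg F (a e) /\ dg F (a e) <= 3} ->
  {in F0, forall e, s (b e) <= 1 /\ dg F (b e) + s (b e) <= m} ->
  {in F0, forall e, 3 <= dg F0 (b e) + s (b e)} -> False.
Proof.
move=> dA dB dB0; apply: F_bad.
apply: (@extend_coloring F F0 a b U) => //; first exact: min_setD.
move=> L HL; apply: (@three_alternating_colorable E V a b C c0 F0 L s) => e eF.
- by rewrite -dg_a //; have [-> ->] := dA e eF.
- by have [] := dB e eF.
- by rewrite -dg_b // dB0.
- rewrite -dg_b //; have := HL e eF; have [-> _] := dA e eF.
  by have [_] := dB e eF; lia.
Qed.

End Alternating.

(** * Vertices of small degree *)

Definition count_deg (P : pred nat) := \sum_(v in support F) (P (dg F v) : nat).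

Lemma count_degE (P : pred nat) : ~~ P 0 ->
  count_deg P = #|[set v | P (dg F v)]|.
Proof.
move=> P0; rewrite /count_deg -sum1_card big_mkcond [RHS]big_mkcond /=.
apply: eq_bigr => v _; rewrite !inE; case: posnP => [->|]; last by case: (P _).
by rewrite (negPf P0).
Qed.

Lemma count_deg_sum (P : pred nat) : ~~ P 0 ->
  count_deg P = \sum_v (P (dg F v) : nat).
Proof.
move=> P0; rewrite count_degE // -sum1_card big_mkcond /=.
by apply: eq_bigr => v _; rewrite inE; case: (P _).
Qed.

(** Otherwise the edges at U, which are j |U| many and all end in W, contain a
    2-regular subgraph, and the degree sums of its edges are at most m + 2. *)
Lemma low_degree_forest (j : nat) (U W : {set V}) : 0 < j -> U != set0 ->
  {in F, forall e, ~~ (ends e \subset U)} -> [disjoint U & W] ->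
  {in U, forall u, dg F u = j /\ 2 * dg F u < l} ->
  {in W, forall w, dg F w + j <= m + 2} ->
  {in F, forall e u w, u \in ends e -> w \in ends e -> u != w -> u \in U ->
     w \in W} ->
  j * #|U| < #|U| + #|W|.
Proof.
move=> j0 Un0 indU dUW dU dW nbr; rewrite ltnNge; apply/negP => le_UW.
have [a [b abP]] := orient U.
pose F1 := [set e in F | a e \in U].
have F1F : F1 \subset F by apply/subsetP => e; rewrite inE => /andP[].
have F1P e : e \in F1 -> [/\ ends e = [set a e; b e], a e \in U & b e \in W].
  rewrite inE => /andP[eF aeU]; have [E0 ab _] := abP e; split=> //.
  by apply: (nbr e eF (a e)); rewrite // E0 !inE eqxx ?orbT.
have WU w : w \in W -> w \notin U.
  by move=> wW; apply: contraL wW => /(disjointFr dUW) ->.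
have cF1 : #|F1| = j * #|U|.
  rewrite (@card_fibers E V F1 a U); last by move=> e; rewrite inE => /andP[].
  rewrite mulnC -sum_nat_const; apply: eq_bigr => u uU.
  have [<- _] := dU u uU; apply: eq_card => e; rewrite !inE.
  case: (boolP (e \in F)) => //= eF; have [E0 ab aUe] := abP e.
  apply/andP/idP => [[_ /eqP <-]|ue]; first by rewrite E0 !inE eqxx.
  have aeU := aUe _ ue uU; split=> //.
  have [|_ _ beW] := F1P e; first by rewrite inE eF.
  move: ue; rewrite E0 !inE => /orP[/eqP->//|/eqP ube].
  by rewrite -ube in beW; rewrite (negPf (WU _ beW)) in uU.
have F1n0 : F1 != set0.
  rewrite -card_gt0 cF1 muln_gt0 j0 card_gt0; exact: Un0.
have supF1 : #|support F1| <= #|F1|.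
  rewrite cF1; apply: leq_trans le_UW.
  apply: leq_trans (leq_card_setU U W); apply/subset_leq_card/subsetP => v.
  case/in_support=> e /F1P[-> aeU beW]; rewrite !inE => /orP[]/eqP -> .
    by rewrite aeU.
  by rewrite beW orbT.
have [F0 [F0F1 F0n0 reg]] := ex_two_regular F1n0 supF1.
have F0P e : e \in F0 -> [/\ ends e = [set a e; b e], a e \in U & b e \in W].
  by move/(subsetP F0F1)/F1P.
apply: (@no_two_regular U a b F0) => //.
- exact: subset_trans F1F.
- by move=> e /F0P[].
- by move=> e /F0P[].
- by move=> e /F0P[_ _ /WU].
- by move=> u /dU[].
- by move=> e eF0; apply: reg; apply: (mem_support eF0); have [-> _ _] := F0P e eF0;
    rewrite !inE eqxx.
- by move=> e eF0; apply: reg; apply: (mem_support eF0); have [-> _ _] := F0P e eF0;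
    rewrite !inE eqxx orbT.
- by move=> e /F0P[_ /dU[-> _] /dW]; rewrite addnC.
Qed.

(** Call the neighbours of vertices of degree at most 3 masters; they have
    degree at least m - 1, so the master w can serve dg w + 2 - m vertices.
    For a set U' of vertices of degree at most 3 some master has at most that
    many edges to U', as otherwise the edges at U' would form a subgraph
    excluded by [no_three_alternating] with slack m - dg. The vertices that
    this master serves are removed from U', and so on. *)
Lemma three_masters : 6 < l -> 4 < m -> (forall v, dg F v <= m) ->
  #|[set v | 0 < dg F v <= 3]| <= \sum_v (dg F v + 2 - m).
Proof.
move=> l6 m4 dm; set U := [set v | _].
have [a [b abP]] := orient U.
have nbr e u w : e \in F -> u \in ends e -> w \in ends e -> u != w -> u \in U ->
    m <= dg F w + 1.
  move=> eF ue we uw; rewrite inE => /andP[_ u3].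
  by have := min_degree_sum eF ue we uw; lia.
have indU : {in F, forall e, ~~ (ends e \subset U)}.
  move=> e eF; have [E0 ab _] := abP e; apply/negP; rewrite E0 => /subsetP sU.
  have := nbr e (a e) (b e) eF; rewrite E0 !inE !eqxx ?orbT => /(_ isT isT ab).
  have := sU (a e); have := sU (b e).
  rewrite !inE !eqxx ?orbT => /(_ isT) ? /(_ isT) H /(_ H); lia.
pose N (U' : {set V}) := [set b e | e in F & a e \in U'].
suff H n (U' : {set V}) : #|U'| <= n -> U' \subset U ->
    #|U'| <= \sum_(w in N U') (dg F w + 2 - m).
  apply: leq_trans (H _ U (leqnn _) (subxx _)) _.
  by rewrite [leqRHS](bigID (mem (N U))) /= leq_addr.
elim: n U' => [|n IHn] U'; first by rewrite leqn0 => /eqP ->.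
move=> leU' U'U; have [->|[u0 u0U']] := set_0Vmem U'; first by rewrite cards0.
pose F0 := [set e in F | a e \in U'].
have F0P e : e \in F0 -> [/\ e \in F, ends e = [set a e; b e], a e \in U',
    b e \notin U & m <= dg F (b e) + 1].
  rewrite inE => /andP[eF aeU']; have [E0 ab _] := abP e; split=> //.
    apply: contra (indU e eF) => beU; rewrite E0 subUset !sub1set beU andbT.
    exact: (subsetP U'U).
  have aeU := subsetP U'U _ aeU'.
  by apply: (nbr e (a e)) => //; rewrite E0 in_set2 eqxx ?orbT.
have F0at u e : u \in U' -> e \in F -> u \in ends e -> e \in F0 /\ a e = u.
  move=> uU' eF ue; have [E0 ab aUe] := abP e.
  have uU := subsetP U'U u uU'; have aeU := aUe u ue uU.
  have E1 : a e = u.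
    move: ue; rewrite E0 !inE => /orP[/eqP->//|/eqP ube].
    by have := indU e eF; rewrite E0 subUset !sub1set aeU -ube uU.
  by rewrite inE eF E1.
have F0n0 : F0 != set0.
  have := subsetP U'U u0 u0U'; rewrite inE => /andP[/card_gt0P[e]].
  rewrite inE => /andP[eF ue] _; apply/set0Pn; exists e.
  by have [] := F0at u0 e.
have [e eF0 small] : exists2 e, e \in F0 & dg F0 (b e) <= dg F (b e) + 2 - m.
  apply/exists_inP; apply: contraT; rewrite negb_exists_in => /forall_inP big.
  exfalso; apply: (@no_three_alternating U a b F0 _ F0n0 _ _ _ indU _
    (fun v => m - dg F v)).
  - by apply/subsetP => e /F0P[].
  - by move=> e /F0P[].
  - by move=> e /F0P[_ _ /(subsetP U'U)].
  - by move=> e /F0P[].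
  - by move=> u; rewrite inE; lia.
  - move=> e eF0; have [eF _ aeU' _ _] := F0P e eF0; split; last first.
      by have := subsetP U'U _ aeU'; rewrite inE => /andP[].
    apply: eq_card => f; rewrite inE [in RHS]inE.
    apply/andP/andP => [[/F0P[]]|[fF aef]] //.
    by have [] := F0at _ f aeU' fF aef.
  - move=> e /F0P[_ _ _ _]; have := dm (b e); lia.
  - move=> e eF0; have := big e eF0; have [_ _ _ _] := F0P e eF0.
    have := dm (b e); rewrite -ltnNge; lia.
pose w := b e; pose K := [set a f | f in F0 & b f == w].
have cK : #|K| <= dg F w + 2 - m.
  apply: leq_trans small; apply: leq_trans (leq_imset_card _ _) _.
  apply/subset_leq_card/subsetP => f /setIdP[fF0 /eqP bf]; rewrite inE fF0 -/w -bf.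
  by have [_ -> _ _ _] := F0P f fF0; rewrite !inE eqxx orbT.
have IH : #|U' :\: K| <= \sum_(w in N (U' :\: K)) (dg F w + 2 - m).
  apply: IHn; last by apply: subset_trans (subsetDl _ _) U'U.
  have [_ _ aeU' _ _] := F0P e eF0.
  have : U' :\: K \subset U' :\ a e.
    by apply: setDS; rewrite sub1set; apply/imsetP; exists e; rewrite // inE eF0 /=.
  by move/subset_leq_card; have := cardsD1 (a e) U'; rewrite aeU'; lia.
have wN : w \in N U'.
  by apply/imsetP; exists e => //; have [? _ ? _ _] := F0P e eF0; rewrite inE; apply/andP.
have cU' : #|U'| <= #|K| + #|U' :\: K|.
  by have := cardsID K U'; have := subset_leq_card (subsetIr U' K); lia.
rewrite (bigD1 w wN) /=; apply: leq_trans cU' _; apply: leq_add cK _.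
apply: leq_trans IH _; rewrite big_mkcond [leqRHS]big_mkcond /=.
apply: leq_sum => v _; case: ifP => // /imsetP[f /setIdP[fF /setDP[afU' afK]] ->].
have bfN : b f \in N U'.
  by apply/imsetP; exists f; rewrite // inE fF.
case: ifPn => // /negP[]; apply/andP; split; first exact: bfN.
apply: contra afK => /eqP bfw; apply/imsetP.
by exists f; rewrite // !inE fF afU' bfw eqxx.
Qed.

End Reduction.

(** * Edge-disjoint triangles *)

Section Triangles.
Variables (V E : finType) (ends : E -> {set V}).
Hypotheses (card_ends : forall e, #|ends e| = 2) (ends_inj : injective ends).
Implicit Types F X : {set E}.
Local Notation dg := (dg ends).
Local Notation support := (support ends).

(** A set of three edges that is even at every vertex is the edge set of a
    triangle. In this form triangles appear as the smallest faces of an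
    embedding. *)
Definition triangles F : {set {set E}} :=
  [set X : {set E} | [&& X \subset F, #|X| == 3 & [forall v, ~~ odd (dg X v)]]].

Lemma triangle_support F X : X \in triangles F ->
  [/\ X \subset F, {in support X, forall v, dg X v = 2} & #|support X| = 3].
Proof.
rewrite inE => /and3P[XF /eqP X3 /forallP even].
have d2 : {in support X, forall v, dg X v = 2}.
  move=> v; rewrite inE => v0; have := even v.
  have : dg X v <= 3.
    rewrite -X3; apply/subset_leq_card/subsetP => e.
    by rewrite inE => /andP[].
  by case: (dg X v) v0 => [|[|[|[|]]]].
split=> //; have := handshake card_ends X; rewrite (eq_bigr (fun=> 2)) //.
by rewrite sum_nat_const X3; lia.
Qed.

Lemma triangle_edges F X : X \in triangles F ->
  {in support X &, forall x y, x != y -> exists2 e, e \in X & ends e = [set x; y]}.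
Proof.
move=> /[dup] XT /triangle_support[_ _ sX] x y xS yS xy.
have X3 : #|X| = 3 by move: XT; rewrite inE => /and3P[_ /eqP].
pose D := [set B : {set V} | (B \subset support X) && (#|B| == 2)].
have eD : [set ends e | e in X] = D.
  apply/eqP; rewrite eqEcard card_imset // X3 cards_draws sX leqnn andbT.
  apply/subsetP => _ /imsetP[e eX ->]; rewrite inE card_ends eqxx andbT.
  by apply/subsetP => v; exact: mem_support.
have : [set x; y] \in D by rewrite inE cards2 xy subUset !sub1set xS yS.
by rewrite -eD => /imsetP[e eX ->]; exists e.
Qed.

(** Edge-disjoint triangles use disjoint pairs of edges at v. *)
Lemma triangles_at_vertex F v : trivIset (triangles F) ->
  #|[set X in triangles F | v \in support X]| <= (dg F v)./2.
Proof.
move=> triv; rewrite -[X in X <= _](half_double) half_leq // -muln2.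
set T := [set X in _ | _]; pose st X := [set e in X | v \in ends e].
have trivT : trivIset [set st X | X in T].
  apply/trivIsetP => _ _ /imsetP[X + ->] /imsetP[Y + ->] neq.
  move=> /setIdP[XT _] /setIdP[YT _].
  have XY : X != Y by apply: contraNneq neq => ->.
  have /trivIsetP/(_ X Y XT YT XY) := triv; rewrite -!setI_eq0 => /eqP XY0.
  apply/eqP/setP => e; rewrite !inE; apply/negP => /andP[/andP[eX _] /andP[eY _]].
  by have /setP/(_ e) := XY0; rewrite !inE eX eY.
have T2 X : X \in T -> #|st X| = 2.
  by case/setIdP=> /triangle_support[_ d2 _] /d2.
have injT : {in T &, injective st}.
  move=> X Y XT YT E0; apply/eqP/negPn/negP => XY.
  have /setIdP[XTr _] := XT; have /setIdP[YTr _] := YT.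
  have /trivIsetP/(_ X Y XTr YTr XY) := triv.
  have [e] : exists e, e \in st X.
    by apply/card_gt0P; rewrite T2.
  move=> /[dup]; rewrite {2}E0 !inE => /andP[eX _] /andP[eY _].
  by move=> /(disjointFr) /(_ eX); rewrite eY.
have <- : #|cover [set st X | X in T]| = #|T| * 2.
  have /eqP <- := trivT; rewrite big_imset //= -sum_nat_const.
  by apply: eq_bigr => X /T2.
apply/subset_leq_card/bigcupsP => _ /imsetP[X /setIdP[XT _] ->].
apply/subsetP => e; rewrite !inE => /andP[eX ->]; rewrite andbT.
by have [/subsetP XF _ _] := triangle_support XT; exact: XF.
Qed.

(** Every vertex v is counted at most dg v / 2 times. *)
Lemma triangle_weight F (w : nat -> nat) (k : nat) : trivIset (triangles F) ->
  {in triangles F, forall X, k <= \sum_(v in support X) w (dg F v)} ->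
  k * #|triangles F| <= \sum_(v in support F) w (dg F v) * (dg F v)./2.
Proof.
move=> triv kw; rewrite mulnC -sum_nat_const.
apply: (@leq_trans (\sum_(X in triangles F) \sum_(v in support X) w (dg F v))).
  exact: leq_sum.
rewrite (exchange_big_dep (mem (support F))) /=.
  apply: leq_sum => v vF; rewrite sum_nat_cond_const mulnC leq_mul2l.
  by rewrite triangles_at_vertex ?orbT.
move=> X v /triangle_support[XF _ _] /in_support[e eX ve].
by apply: (mem_support _ ve); exact: (subsetP XF).
Qed.

End Triangles.

(** * Discharging *)

Section Discharging.
Variables (V E : finType) (ends : E -> {set V}).
Hypotheses (card_ends : forall e, #|ends e| = 2) (ends_inj : injective ends).
Variables (C : choiceType) (Lv : V -> {fset C}) (Le : E -> {fset C}).
Variables (m l : nat).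
Hypothesis Le_size :
  forall e v x, v \in ends e -> x \in Lv v -> m <= #|` Le e `\ x|%fset.
Hypothesis Lv_size : forall v, l <= #|` Lv v|.
Variables (F : {set E}) (c0 : C) (D chi : nat).
Hypothesis F_bad : ~ total_colorable ends Lv Le F.
Hypothesis F_min : forall F' : {set E}, F' \proper F -> total_colorable ends Lv Le F'.
Hypothesis max_dg : forall v, dg ends F v <= D.
Hypothesis triv : trivIset (triangles ends F).
Hypothesis euler :
  2 * #|F| + 4 * chi <= 4 * #|support ends F| + #|triangles ends F|.
Local Notation dg := (dg ends).
Local Notation S := (support ends F).
Local Notation count_deg := (count_deg ends F).

Let degree_sum := min_degree_sum card_ends Le_size Lv_size F_bad F_min.

Lemma neighbor v : v \in S ->
  exists e w, [/\ e \in F, v \in ends e, w \in ends e & v != w].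
Proof.
case/in_support=> e eF ve; have [x [y [xy E0]]] := ends_mem card_ends e.
move: ve; rewrite E0 !inE => /orP[]/eqP ->.
  by exists e, y; split=> //; rewrite E0 !inE eqxx ?orbT.
by exists e, x; split; rewrite // 1?eq_sym // E0 !inE eqxx ?orbT.
Qed.

Lemma small_degree_ge v : v \in S -> 2 * dg F v < l -> m + 2 <= dg F v + D.
Proof.
move=> /neighbor[e [w [eF ve we vw]]] small.
by have := degree_sum eF ve we vw small; have := max_dg w; lia.
Qed.

(** For this j the neighbours of a vertex of degree j have maximum degree D. *)
Lemma count_forest j : 0 < j -> m + 2 = D + j -> 2 * j < l -> 2 * j < m + 2 ->
  j != D -> count_deg (pred1 j) = 0 \/
  j * count_deg (pred1 j) < count_deg (pred1 j) + count_deg (pred1 D).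
Proof.
move=> j0 mD jl jm jD; have D0 : 0 < D by lia.
rewrite !count_degE /=; [|by lia..].
set U := [set v | _]; set W := [set v | dg F v == D].
have [->|Un0] := eqVneq U set0; first by left; rewrite cards0.
right; apply: (low_degree_forest card_ends Le_size Lv_size F_bad F_min c0) => //.
- move=> e eF; apply/negP => /subsetP sU.
  have [x [y [xy E0]]] := ends_mem card_ends e.
  have xe : x \in ends e by rewrite E0 !inE eqxx.
  have ye : y \in ends e by rewrite E0 !inE eqxx orbT.
  have := sU x xe; have := sU y ye; rewrite !inE => /eqP dy /eqP dx.
  by have := degree_sum eF xe ye xy; rewrite dx dy; lia.
- rewrite -setI_eq0; apply/eqP/setP => v; rewrite !inE.
  by apply/negP => /andP[/eqP -> /eqP E0]; rewrite E0 eqxx in jD.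
- by move=> u; rewrite inE => /eqP ->.
- by move=> w; rewrite inE => /eqP ->; rewrite mD.
move=> e eF u w ue we uw; rewrite !inE => /eqP du.
have := degree_sum eF ue we uw; rewrite du => /(_ jl).
by have := max_dg w; lia.
Qed.

(** A triangle with a vertex of degree at most 4 has two other vertices of
    weight 3, and any other triangle has three vertices of weight 2. *)
Lemma triangle_weight_ge (w : nat -> nat) (t : nat) :
  (forall d, t <= d -> 3 <= w d) -> (forall d, 5 <= d -> 2 <= w d) ->
  (forall e x y, e \in F -> x \in ends e -> y \in ends e -> x != y ->
     dg F x <= 4 -> t <= dg F y) ->
  6 * #|triangles ends F| <= \sum_(v in S) w (dg F v) * (dg F v)./2.
Proof.
move=> w3 w2 light; apply: triangle_weight => // X XT.
have [/subsetP XF _ sX] := triangle_support card_ends XT.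
case: (boolP [exists x in support ends X, dg F x <= 4]).
  case/exists_inP=> x xX dx; rewrite (bigD1 x xX) /=.
  apply: (@leq_trans (\sum_(v in support ends X :\ x) 3)).
    by rewrite sum_nat_const; have := cardsD1 x (support ends X); rewrite xX sX; lia.
  apply: leq_trans (leq_addl _ _).
  rewrite [leqRHS](eq_bigl (fun v => v \in support ends X :\ x)) => [|v]; last first.
    by rewrite in_setD1 andbC.
  apply: leq_sum => v; rewrite in_setD1 => /andP[vx vX].
  rewrite eq_sym in vx.
  have [e eX E0] := triangle_edges card_ends ends_inj XT xX vX vx.
  by apply/w3/(light e x v); rewrite ?XF // E0 !inE eqxx ?orbT.
rewrite negb_exists_in => /forall_inP heavy.
apply: (@leq_trans (\sum_(v in support ends X) 2)).
  by rewrite sum_nat_const sX.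
by apply: leq_sum => v vX; apply: w2; rewrite ltnNge heavy.
Qed.

(** Six times the inequality of Euler, with 12 |F| written as a sum of degrees
    and the triangles charged to their vertices. *)
Lemma charge (w : nat -> nat) :
  6 * #|triangles ends F| <= \sum_(v in S) w (dg F v) * (dg F v)./2 ->
  \sum_(v in S) 6 * dg F v + 24 * chi <=
  \sum_(v in S) (24 + w (dg F v) * (dg F v)./2).
Proof.
move=> tri; rewrite -big_distrr /= (handshake card_ends).
rewrite big_split /= sum_nat_const mulnC; move: tri euler.
set s := \sum_(v in _) _; lia.
Qed.

Lemma F_neq0 : 0 < l -> F != set0.
Proof.
move=> l0; apply/eqP => F0; apply: F_bad; rewrite F0.
have [cv cvL] : exists cv : V -> C, forall v, cv v \in Lv v.
  apply: (@fin_all_exists V (fun=> C) (fun v x => x \in Lv v)) => v.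
  by apply/fset0Pn; rewrite -cardfs_gt0; exact: leq_trans (Lv_size v).
by exists cv, (fun=> c0); split=> // e; rewrite inE.
Qed.

(** A source of strictness in the final inequality when chi = 0. *)
Lemma big_vertex : 9 <= l -> 7 <= m -> 0 < count_deg (leq 5).
Proof.
move=> l9 m7; have [e eF] : exists e, e \in F.
  by apply/set0Pn; apply: F_neq0; lia.
have [x [y [xy E0]]] := ends_mem card_ends e.
have xe : x \in ends e by rewrite E0 !inE eqxx.
have ye : y \in ends e by rewrite E0 !inE eqxx orbT.
rewrite count_degE // card_gt0; apply/set0Pn.
have := degree_sum eF xe ye xy; case: (leqP 5 (dg F x)) => dx.
  by exists x; rewrite inE.
by move=> H; exists y; rewrite inE; lia.
Qed.

(** A vertex of degree d has the charge 24 + w d (d / 2) - 6 d. It is 12 for d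
    = 2, 6 for d = 3, 0 for d = 4, at most -18 for d = D, at most -7 for d = D
    - 1 and at most -1 for other d >= 5. The bound of [three_masters] on the
    number of vertices of degree 2 and 3, and that of [low_degree_forest] on
    those of degree 2, show that the total is negative. *)
Lemma discharge_tight : m = D -> 9 <= D -> 10 <= l -> False.
Proof.
move=> mD D9 l10.
pose w d := if 6 <= d then 3 else if d == 5 then 2 else 0.
have tri : 6 * #|triangles ends F| <= \sum_(v in S) w (dg F v) * (dg F v)./2.
  apply: (@triangle_weight_ge w 6); rewrite //.
  - by move=> d d6; rewrite /w d6.
  - by move=> d d5; rewrite /w; case: ifP => //; case: eqP => //; lia.
  - by move=> e x y eF xe ye xy d4; have := degree_sum eF xe ye xy; lia.
have := charge tri.
have : \sum_(v in S) (24 + w (dg F v) * (dg F v)./2) +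
    (18 * count_deg (pred1 D) + 6 * count_deg (pred1 D.-1) +
     count_deg (fun d => 5 <= d < D)) <=
    \sum_(v in S) 6 * dg F v +
    (12 * count_deg (pred1 2) + 6 * count_deg (pred1 3)).
  rewrite /count_deg !big_distrr -!big_split /=; apply: leq_sum => v vS.
  have dD := max_dg v; have d2 := small_degree_ge vS.
  move: (dg F v) dD d2 => d dD d2; rewrite /w.
  case: (leqP 10 d) => [d10|d10].
    have := odd_double_half d; rewrite (_ : 6 <= d); last by lia.
    have : 18 * (d == D) + 6 * (d == D.-1) <= 18.
      by case: eqP => [->|_]; case: eqP => //; lia.
    by have := leq_b1 (5 <= d < D); lia.
  case: d d10 dD d2 => [|[|[|[|[|[|[|[|[|[|]]]]]]]]]] //= _; lia.
have : count_deg (pred1 2) + count_deg (pred1 3) <=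
    2 * count_deg (pred1 D) + count_deg (pred1 D.-1).
  have l6 : 6 < l by lia. have m4 : 4 < m by lia.
  have dm v : dg F v <= m by rewrite mD.
  have := three_masters card_ends Le_size Lv_size F_bad F_min c0 l6 m4 dm.
  rewrite !count_deg_sum /=; [|by lia..]; rewrite -sum1_card big_mkcond /= => H.
  apply: (@leq_trans (\sum_v (dg F v + 2 - m))).
    apply: leq_trans H; rewrite -big_split /=; apply: leq_sum => v _.
    by rewrite inE; case: (dg F v) => [|[|[|[|]]]].
  rewrite big_distrr -big_split /=; apply: leq_sum => v _.
  have := dm v; case: eqP => [->|?]; first by rewrite mD; lia.
  by case: eqP => [->|?]; lia.
have : 0 < count_deg (pred1 D) + count_deg (fun d => 5 <= d < D).
  apply: leq_trans (big_vertex _ _) _; [by lia.. |].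
  rewrite /count_deg -big_split /=; apply: leq_sum => v _.
  by have := max_dg v; rewrite leq_eqVlt => /orP[->|->]; rewrite ?andbT; lia.
have [] := count_forest (isT : 0 < 2); rewrite ?mD //; lia.
Qed.

(** Now all degrees are at least 3 and only d = 3 has a positive charge,
    namely 6. By [low_degree_forest] the vertices of degree D, with charge at
    most -3, make up for it. *)
Lemma discharge_loose : m = D.+1 -> 7 <= D -> 9 <= l -> False.
Proof.
move=> mD D7 l9.
pose w d := if 6 <= d then 3 else if d == 5 then 2 else 0.
have tri : 6 * #|triangles ends F| <= \sum_(v in S) w (dg F v) * (dg F v)./2.
  apply: (@triangle_weight_ge w 6); rewrite //.
  - by move=> d d6; rewrite /w d6.
  - by move=> d d5; rewrite /w; case: ifP => //; case: eqP => //; lia.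
  - by move=> e x y eF xe ye xy d4; have := degree_sum eF xe ye xy; lia.
have := charge tri.
have : \sum_(v in S) (24 + w (dg F v) * (dg F v)./2) +
    (3 * count_deg (pred1 D) + count_deg (leq 5)) <=
    \sum_(v in S) 6 * dg F v + 6 * count_deg (pred1 3).
  rewrite /count_deg !big_distrr -!big_split /=; apply: leq_sum => v vS.
  have dD := max_dg v; have d3 := small_degree_ge vS.
  move: (dg F v) dD d3 => d dD d3; rewrite /w.
  case: (leqP 8 d) => [d8|d8].
    have := odd_double_half d; rewrite (_ : 6 <= d); last by lia.
    by have := leq_b1 (5 <= d); have := leq_b1 (d == D); lia.
  case: d d8 dD d3 => [|[|[|[|[|[|[|[|]]]]]]]] //= _; lia.
have := big_vertex l9 (_ : 7 <= m); rewrite mD => /(_ (ltnW D7)).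
by have [] := count_forest (isT : 0 < 3); rewrite ?mD //; lia.
Qed.

(** As in [discharge_loose] only d = 3 has a positive charge; here chi makes
    the inequality strict. *)
Lemma discharge_six : m = 7 -> D = 6 -> 13 <= l -> 0 < chi -> False.
Proof.
move=> m7 D6 l13 chi0.
pose w d := if 5 <= d then 3 else 0.
have tri : 6 * #|triangles ends F| <= \sum_(v in S) w (dg F v) * (dg F v)./2.
  apply: (@triangle_weight_ge w 5); rewrite //.
  - by move=> d d5; rewrite /w d5.
  - by move=> d d5; rewrite /w d5.
  - by move=> e x y eF xe ye xy d4; have := degree_sum eF xe ye xy; lia.
have := charge tri.
have : \sum_(v in S) (24 + w (dg F v) * (dg F v)./2) +
    3 * count_deg (pred1 D) <=
    \sum_(v in S) 6 * dg F v + 6 * count_deg (pred1 3).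
  rewrite /count_deg !big_distrr -!big_split /=; apply: leq_sum => v vS.
  have dD := max_dg v; have d3 := small_degree_ge vS.
  move: (dg F v) dD d3 => d dD d3; rewrite /w D6.
  by case: d dD d3 => [|[|[|[|[|[|[|]]]]]]] //=; lia.
by have [] := count_forest (isT : 0 < 3); rewrite ?m7 ?D6 //; lia.
Qed.

End Discharging.

(** * Chains over the field with two elements *)

Import GRing.Theory.
Local Open Scope ring_scope.

Local Notation F2 := ('F_2).
Local Notation chain I := {ffun I -> (F2)^o}.

Lemma F2_addxx (x : F2) : x + x = 0.
Proof. by case: x => [[|[|]]] // ?; apply/val_inj. Qed.

Lemma F2_add_eq0 (x y : F2) : x + y = 0 -> x = y.
Proof. by move=> xy; rewrite -[x]addr0 -(F2_addxx y) addrA xy add0r. Qed.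

Lemma F2_nat (n : nat) : n%:R = (odd n : nat)%:R :> F2.
Proof.
rewrite -{1}(odd_double_half n) natrD -addnn natrD.
by rewrite F2_addxx addr0.
Qed.

Section Chains.
Variables I J : finType.

Definition mx_map (M : I -> J -> F2) (x : chain I) : chain J :=
  [ffun j => \sum_i x i * M i j].

Lemma mx_map_linear M : linear (mx_map M).
Proof.
move=> k x y; apply/ffunP => j; rewrite !ffunE.
rewrite [in RHS]/(_ *: _) /= mulr_sumr -big_split /=; apply: eq_bigr => i _.
by rewrite !ffunE mulrDl mulrA.
Qed.

HB.instance Definition _ M :=
  GRing.isLinear.Build F2 (chain I) (chain J) *:%R (mx_map M) (mx_map_linear M).

Definition lmap M : 'Hom(chain I, chain J) := linfun (mx_map M).

Lemma lmapE M x j : lmap M x j = \sum_i x i * M i j.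
Proof. by rewrite lfunE ffunE. Qed.

Lemma sum_delta (x : I -> F2) (a : I) : \sum_i x i * (i == a)%:R = x a.
Proof.
rewrite (bigD1 a) //= eqxx mulr1 big1 ?addr0 // => i /negPf ->.
by rewrite mulr0.
Qed.

Lemma dim_chain : \dim (fullv : {vspace chain I}) = #|I|.
Proof. by rewrite dimvf /dim /= muln1. Qed.

End Chains.

Lemma chain_addxx (I : finType) (x : chain I) : x + x = 0.
Proof. by apply/ffunP => i; rewrite !ffunE F2_addxx. Qed.

Lemma chain_cancel (I : finType) (x y u v : chain I) :
  x + y + ((u + x) + (v + y)) = u + v.
Proof.
rewrite (addrC u x) (addrC v y) (addrACA x u y v) (addrA (x + y)).
by rewrite (chain_addxx (x + y)) add0r.
Qed.

Definition delta (I : finType) (i : I) : chain I := [ffun j => (j == i)%:R].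

Lemma chain_delta (I : finType) (x : chain I) : x = \sum_i x i *: delta i.
Proof.
apply/ffunP => j; rewrite sum_ffunE /= -[LHS]sum_delta.
by apply: eq_bigr => i _; rewrite !ffunE eq_sym.
Qed.

Lemma kerP (U V : vectType F2) (f : 'Hom(U, V)) x :
  reflect (f x = 0) (x \in lker f).
Proof. by rewrite memv_ker; exact: eqP. Qed.

Lemma memv_capP (U : vectType F2) (S T : {vspace U}) x :
  reflect (x \in S /\ x \in T) (x \in S :&: T)%VS.
Proof. by rewrite memv_cap; exact: andP. Qed.

Definition restr_mx (I : finType) (S : pred I) (i j : I) : F2 :=
  ((i == j) && ~~ S i)%:R.

(** Chains supported in S, as the kernel of the projection that forgets S. *)
Definition on (I : finType) (S : pred I) : {vspace chain I} :=
  lker (lmap (restr_mx S)).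

Lemma onP (I : finType) (S : pred I) (x : chain I) :
  reflect (forall i, ~~ S i -> x i = 0) (x \in on S).
Proof.
have E i : lmap (restr_mx S) x i = x i * (~~ S i)%:R.
  rewrite lmapE (eq_bigr (fun j => (x j * (~~ S j)%:R) * (j == i)%:R)).
    by rewrite sum_delta.
  by move=> j _; rewrite /restr_mx -mulrA -natrM mulnb andbC.
rewrite memv_ker; apply: (iffP eqP) => [/ffunP H i Si|H].
  by have := H i; rewrite E Si mulr1 ffunE.
apply/ffunP => i; rewrite E ffunE; case: (boolP (S i)) => Si; rewrite ?mulr0 //.
by rewrite H ?mul0r.
Qed.

Lemma dim_on_le (I : finType) (S : pred I) : (\dim (on S) <= #|S|)%N.
Proof.
suff sub : (on S <= <<[seq delta i | i <- enum S]>>)%VS.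
  apply: leq_trans (dimvS sub) _; apply: leq_trans (dim_span _) _.
  by rewrite size_map -cardE.
apply/subvP => x /onP xS; rewrite (chain_delta x) memv_suml // => i _.
case: (boolP (S i)) => Si; last by rewrite xS // scale0r mem0v.
by apply/memvZ/memv_span/map_f; rewrite mem_enum.
Qed.

Lemma dim_on (I : finType) (S : pred I) : \dim (on S) = #|S|.
Proof.
apply/eqP; rewrite eqn_leq dim_on_le /=.
have full : (on S + on (predC S) = fullv)%VS.
  apply/eqP; rewrite eqEsubv subvf; apply/subvP => x _.
  have -> : x = [ffun i => if S i then x i else 0] +
                [ffun i => if S i then 0 else x i].
    by apply/ffunP => i; rewrite !ffunE; case: (S i); rewrite ?addr0 ?add0r.
  apply: memv_add; apply/onP => i /=; rewrite ffunE; first by move/negPf ->.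
  by rewrite negbK => ->.
have := (dimv_add_leqif (on S) (on (predC S))).1; rewrite full dim_chain.
have := dim_on_le (predC S); rewrite -(cardC S).
rewrite (_ : #|[predC S]| = #|predC S|) //.
set a := #|_|; set b := #|_|; lia.
Qed.

(** * Cycles and boundaries of a cell decomposition *)

Section Cellulation.
Variables (Cl Eh W : finType) (c1 c2 : Eh -> Cl) (w1 w2 : Eh -> W).

(** Two points are linked if they are the ends of an element of Eh that
    satisfies P. With the maps c1, c2 the elements of Eh are edges between
    cells, and with w1, w2 they are edges between corners: each one is the
    common side of two cells and has two corners as its ends. *)
Definition link (T : finType) (a b : Eh -> T) (P : pred Eh) : rel T :=
  fun x y => [exists h, P h && ((a h == x) && (b h == y) ||
                                (a h == y) && (b h == x))].

Lemma connect_ind (T : finType) (e : rel T) (P : T -> Prop) x y :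
  (forall u v, e u v -> P u -> P v) -> connect e x y -> P x -> P y.
Proof.
move=> IH /connectP[p]; elim: p x => [|z p IHp] x /=; first by move=> _ ->.
by case/andP=> exz pz yE Px; apply: IHp pz yE _; exact: IH Px.
Qed.

Lemma link_sym (T : finType) (a b : Eh -> T) P : connect_sym (link a b P).
Proof.
apply: sym_connect_sym; apply: symmetric_from_pre => x y /existsP[h /andP[Ph H]].
by apply/existsP; exists h; rewrite Ph orbC.
Qed.

(** The cells are the vertices of the adjacency graph and the corners its
    faces: bd sends an edge to its two cells, and around sends a corner to the
    edges on the boundary of the face that corresponds to it. *)
Definition bd : 'Hom(chain Eh, chain Cl) :=
  lmap (fun h c => (c == c1 h)%:R + (c == c2 h)%:R).
Definition around : 'Hom(chain W, chain Eh) :=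
  lmap (fun w h => (w == w1 h)%:R + (w == w2 h)%:R).

Lemma aroundE (x : chain W) h : around x h = x (w1 h) + x (w2 h).
Proof.
rewrite lmapE (eq_bigr (fun w => x w * (w == w1 h)%:R + x w * (w == w2 h)%:R)).
  by rewrite big_split /= !sum_delta.
by move=> w _; rewrite mulrDr.
Qed.

Lemma bd_delta h : bd (delta h) = delta (c1 h) + delta (c2 h).
Proof.
apply/ffunP => c; rewrite lmapE !ffunE -[RHS](sum_delta
  (fun h => (c == c1 h)%:R + (c == c2 h)%:R) h).
by apply: eq_bigr => k _; rewrite ffunE mulrC.
Qed.

Hypothesis cycles : forall w c,
  \sum_h ((w == w1 h)%:R + (w == w2 h)%:R) * ((c == c1 h)%:R + (c == c2 h)%:R)
  = 0 :> F2.
Hypothesis conn : forall c c', connect (link c1 c2 predT) c c'.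
Hypothesis co_conn : forall w w', connect (link w1 w2 predT) w w'.
Variables (cell0 : Cl) (corner0 : W).

Lemma around_cycle : (limg around <= lker bd)%VS.
Proof.
apply/subvP => _ /memv_imgP[x _ ->]; rewrite memv_ker; apply/eqP/ffunP => c.
rewrite lmapE ffunE; under eq_bigr => h _ do rewrite lmapE mulr_suml.
rewrite exchange_big big1 //= => w _.
by under eq_bigr => h _ do rewrite -mulrA; rewrite -mulr_sumr cycles mulr0.
Qed.

(** As the cells are connected, together with one cell the boundaries span all
    chains of cells. *)
Lemma dim_ker_bd : (\dim (lker bd) + #|Cl| <= #|Eh| + 1)%N.
Proof.
have := limg_ker_dim bd fullv; rewrite capfv dim_chain.
suff : (#|Cl| <= \dim (limg bd) + 1)%N by lia.
have full : (limg bd + <[delta cell0]> = fullv)%VS.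
  apply/eqP; rewrite eqEsubv subvf; apply/subvP => x _.
  rewrite (chain_delta x) memv_suml // => c _; apply: memvZ.
  have : delta cell0 + delta c \in limg bd.
    apply: (connect_ind (P := fun c => delta cell0 + delta c \in limg bd))
      (conn cell0 c) _.
      move=> u v /existsP[h /= H] uP.
      have : delta u + delta v \in limg bd.
        have := memv_img bd (memvf (delta h)); rewrite bd_delta.
        by case/orP: H => /andP[/eqP <- /eqP <-]; rewrite // addrC.
      by move/(memvD uP); rewrite addrA -(addrA (delta cell0)) chain_addxx addr0.
    by rewrite chain_addxx mem0v.
  move=> cP; have -> : delta c = (delta cell0 + delta c) + delta cell0.
    by rewrite addrAC chain_addxx add0r.
  by apply: memv_add cP (memv_line _).
have := (dimv_add_leqif (limg bd) <[delta cell0]>).1.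
by rewrite full dim_chain dim_vline; case: eqP => //=; lia.
Qed.

(** As the corners are connected, only constant chains of corners have no
    boundary. *)
Lemma dim_around : (#|W| <= \dim (limg around) + 1)%N.
Proof.
have := limg_ker_dim around fullv; rewrite capfv dim_chain.
suff : (\dim (lker around) <= 1)%N by lia.
have sub : (lker around <= <[[ffun=> 1] : chain W]>)%VS.
  apply/subvP => x; rewrite memv_ker => /eqP x0.
  apply/vlineP; exists (x corner0); apply/ffunP => w; rewrite !ffunE.
  rewrite [RHS]mulr1; apply: (connect_ind (P := fun w => x w = x corner0))
    (co_conn corner0 w) erefl.
  move=> u v /existsP[h /= H] <-.
  have := congr1 (fun f : chain Eh => f h) x0; rewrite aroundE ffunE.
  by move/F2_add_eq0; case/orP: H => /andP[/eqP -> /eqP ->].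
by apply: leq_trans (dimvS sub) _; rewrite dim_vline; case: eqP.
Qed.

Lemma codim_around : (\dim (lker bd) + #|Cl| + #|W| <=
  \dim (limg around) + #|Eh| + 2)%N.
Proof. by have := dim_ker_bd; have := dim_around; lia. Qed.

End Cellulation.

(** * Counting faces *)

Definition ind (E : finType) (X : {set E}) : chain E := [ffun e => (e \in X)%:R].

Section FaceCount.
Variables (V E W : finType) (ends : E -> {set V}).
Hypotheses (card_ends : forall e, #|ends e| = 2%N) (ends_inj : injective ends).
Variables (F : {set E}) (face : W -> {set E}).
Hypothesis face_sub : forall i, face i \subset F.
Hypothesis face_even : forall i v, ~~ odd (dg ends (face i) v).
Hypothesis face_two : forall e,
  #|[set i | e \in face i]| = 0%N \/ #|[set i | e \in face i]| = 2%N.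

(** An even set that contains e has further edges at both ends of e, and they
    are distinct since ends_inj excludes parallel edges. *)
Lemma even_set_ge3 (X : {set E}) : X != set0 ->
  (forall v, ~~ odd (dg ends X v)) -> (3 <= #|X|)%N.
Proof.
case/set0Pn=> e eX even.
have other f v : f \in X -> v \in ends f ->
    exists g, [/\ g \in X, g != f & v \in ends g].
  move=> fX vf; have : (1 < #|[set g in X | v \in ends g]|)%N.
    have := even v; have : (0 < dg ends X v)%N.
      by apply/card_gt0P; exists f; rewrite inE fX.
    by rewrite /dg; case: #|_| => [|[|]].
  rewrite (cardsD1 f) inE fX vf => /card_gt0P[g].
  by rewrite !inE => /and3P[gf gX vg]; exists g.
have [u [v [uv E0]]] := ends_mem card_ends e.
have ue : u \in ends e by rewrite E0 !inE eqxx.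
have ve : v \in ends e by rewrite E0 !inE eqxx orbT.
have [f [fX fe uf]] := other e u eX ue.
have vf : v \notin ends f.
  apply: contra fe => vf; apply/eqP/ends_inj.
  by rewrite E0 (ends_eq card_ends uf vf uv).
have [g [gX ge vg]] := other e v eX ve.
have gf : g != f by apply: contraNneq vf => <-.
rewrite (cardsD1 e) eX (cardsD1 f) !inE fe fX (cardsD1 g) !inE gf ge gX.
by [].
Qed.

Let faces : {set {set E}} := [set face i | i in [set i | face i != set0]].
Let mult (X : {set E}) := #|[set i | face i == X]|.

Lemma facesP X : X \in faces -> exists2 i, X = face i & X != set0.
Proof. by case/imsetP=> i; rewrite inE => fi ->; exists i. Qed.

Lemma mult_bounds X : X \in faces -> (0 < mult X <= 2)%N.
Proof.
case/facesP=> i Xi /set0Pn[e eX]; apply/andP; split.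
  by apply/card_gt0P; exists i; rewrite inE Xi.
have sub : [set j | face j == X] \subset [set j | e \in face j].
  by apply/subsetP => j; rewrite !inE => /eqP ->.
by have := subset_leq_card sub; have [->|->] := face_two e; rewrite /mult; lia.
Qed.

Lemma sum_faces : (\sum_(X in faces) mult X * #|X| <= 2 * #|F|)%N.
Proof.
apply: (@leq_trans (\sum_i #|face i|)).
  rewrite [leqRHS](bigID (fun i => face i != set0)) /=.
  apply: leq_trans (leq_addr _ _).
  rewrite (partition_big face (mem faces)) /=; last first.
    by move=> i fi; apply/imsetP; exists i; rewrite ?inE.
  apply: leq_sum => X /facesP[i _ X0].
  rewrite (eq_bigl (fun j => j \in [set j | face j == X])) => [|j].
    rewrite (eq_bigr (fun=> #|X|)) => [|j]; last by rewrite inE => /eqP ->.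
    by rewrite sum_nat_const.
  by rewrite inE andb_idl // => /eqP ->.
apply: (@leq_trans (\sum_(e in F) #|[set i | e \in face i]|)).
  under eq_bigr => i _ do rewrite -sum1_card.
  rewrite (exchange_big_dep (mem F)) /=; last first.
    by move=> i e _; apply/subsetP; exact: face_sub.
  apply: leq_sum => e _; rewrite -sum1_card.
  by rewrite (eq_bigl (fun i => i \in [set i | e \in face i])) // => i; rewrite inE.
rewrite mulnC -sum_nat_const; apply: leq_sum => e _.
by have [->|->] := face_two e.
Qed.

Let span_faces := (<<[seq ind (face i) | i <- enum W]>>)%VS.

Lemma span_facesE : (span_faces <= <<[seq ind X | X <- enum faces]>>)%VS.
Proof.
apply/span_subvP => _ /mapP[i _ ->].
have [->|fi] := eqVneq (face i) set0.
  by rewrite (_ : ind set0 = 0) ?mem0v //; apply/ffunP => e; rewrite !ffunE inE.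
by apply/memv_span/map_f; rewrite mem_enum; apply/imsetP; exists i; rewrite ?inE.
Qed.

(** Every edge lies in an even number of faces. *)
Lemma sum_ind_faces : \sum_i ind (face i) = 0.
Proof.
apply/ffunP => e; rewrite sum_ffunE ffunE.
under eq_bigr => i _ do rewrite ffunE.
rewrite -natr_sum (_ : (\sum_i _)%N = #|[set i | e \in face i]|).
  by have [->|->] := face_two e; rewrite F2_nat.
rewrite -sum1_card [RHS]big_mkcond /=; apply: eq_bigr => i _.
by rewrite inE; case: (e \in face i).
Qed.

(** By [sum_ind_faces] a face that occurs once is the sum of the other faces,
    so it can be left out of the spanning family. *)
Lemma dim_span_simple X : X \in faces -> mult X = 1%N ->
  (\dim span_faces + 1 <= #|faces|)%N.
Proof.
move=> XF mX; have sub : (span_faces <= <<[seq ind Y | Y <- enum (faces :\ X)]>>)%VS.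
  set S := (X in (_ <= X)%VS).
  have inS i : face i != X -> ind (face i) \in S.
    move=> fX; have [->|fi] := eqVneq (face i) set0.
      by rewrite (_ : ind set0 = 0) ?mem0v //; apply/ffunP => e; rewrite !ffunE inE.
    apply/memv_span/map_f; rewrite mem_enum inE in_set1 fX.
    by apply/imsetP; exists i; rewrite ?inE.
  apply/span_subvP => _ /mapP[i _ ->].
  have [fX|] := eqVneq (face i) X; last exact: inS.
  have := sum_ind_faces; rewrite (bigD1 i) //= => /eqP; rewrite addr_eq0 => /eqP ->.
  rewrite memvN memv_suml // => j ji; apply: inS; apply: contraNneq ji => fj.
  move/eqP: mX; rewrite /mult => /cards1P[k Ek].
  have : i \in [set j | face j == X] by rewrite inE fX.
  have : j \in [set j | face j == X] by rewrite inE fj.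
  by rewrite Ek !inE => /eqP -> /eqP ->.
apply: leq_trans (leq_add (dimvS sub) (leqnn 1)) _.
apply: leq_trans (leq_add (dim_span _) (leqnn 1)) _.
by rewrite size_map -cardE (cardsD1 X faces) XF addnC.
Qed.

(** If some nonempty face occurs once, the dimension is less than the number
    of distinct faces, whose sizes are at least 4 except for triangles and sum
    up to at most 2 |F|. Otherwise all nonempty faces occur twice, the
    distinct ones have at least 3 edges each, and their sizes sum up to at
    most |F|. *)
Lemma face_count :
  (4 * (\dim span_faces + 1) <= 2 * #|F| + #|triangles ends F|)%N \/
  (3 * \dim span_faces <= #|F|)%N.
Proof.
have size_face X : X \in faces ->
    (3 <= #|X|)%N /\ (4 <= #|X| + (X \in triangles ends F))%N.
  move=> XF; have [i Xi X0] := facesP XF.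
  have ge3 : (3 <= #|X|)%N by apply: even_set_ge3 => // v; rewrite Xi.
  split=> //; case: (ltngtP #|X| 3) => [|?|X3]; [lia | lia |].
  suff -> : X \in triangles ends F by rewrite X3.
  by rewrite inE X3 eqxx Xi face_sub; apply/forallP => v; exact: face_even.
case: (boolP [exists X in faces, mult X == 1%N]).
  case/exists_inP=> X XF /eqP mX; left.
  apply: leq_trans (leq_mul (leqnn 4) (dim_span_simple XF mX)) _.
  rewrite mulnC -sum_nat_const.
  apply: (@leq_trans (\sum_(X in faces) (#|X| + (X \in triangles ends F)))).
    by apply: leq_sum => Y /size_face[].
  rewrite big_split /=; apply: leq_add.
    apply: leq_trans sum_faces; apply: leq_sum => Y /mult_bounds/andP[m0 _].
    exact: leq_pmull.
  rewrite -sum1_card big_mkcond [leqRHS]big_mkcond; apply: leq_sum => Y _.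
  by case: ifP => // _; case: ifP.
rewrite negb_exists_in => /forall_inP mult2; right.
apply: leq_trans (leq_mul (leqnn 3) (dimvS span_facesE)) _.
apply: leq_trans (leq_mul (leqnn 3) (dim_span _)) _.
rewrite size_map -cardE -(leq_pmul2l (isT : 0 < 2)%N); apply: leq_trans sum_faces.
rewrite mulnA mulnC -sum_nat_const; apply: leq_sum => X XF.
have := mult_bounds XF; have := mult2 X XF; have [+ _] := size_face X XF.
by case: (mult X) => [|[|[|]]] //=; lia.
Qed.

End FaceCount.

(** * Faces of a minor *)

Section Minor.
Variables (Cl Eh W : finType) (c1 c2 : Eh -> Cl) (w1 w2 : Eh -> W).
Variables (V E : finType) (ends : E -> {set V}).
Hypotheses (card_ends : forall e, #|ends e| = 2%N) (ends_inj : injective ends).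
Variables (F : {set E}) (fib : Cl -> option V) (rho : E -> Eh) (r : V -> Cl).

(** The edges to be contracted: both cells belong to the fibre of the same
    vertex of the minor. *)
Definition inner : pred Eh :=
  fun h => (fib (c1 h) != None) && (fib (c1 h) == fib (c2 h)).
Definition kept : pred Eh := fun h => inner h || (h \in rho @: F).

(** A minor model: the fibre of a vertex v is a connected set of cells with
    base cell r v, and rho e is a side between the fibres of the ends of e. *)
Hypothesis fib_rho : {in F, forall e, exists u v,
  [/\ ends e = [set u; v], fib (c1 (rho e)) = Some u
    & fib (c2 (rho e)) = Some v]}.
Hypothesis fib_conn : forall c v, fib c = Some v ->
  connect (link c1 c2 inner) (r v) c.

Local Notation bd := (bd c1 c2).
Local Notation around := (around w1 w2).

Definition incidence : 'Hom(chain E, chain V) :=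
  lmap (fun e v => (v \in ends e)%:R).
Definition contract : 'Hom(chain Eh, chain E) :=
  lmap (fun h e => (e \in F)%:R * (h == rho e)%:R).
Definition cycle_space : {vspace chain E} := (lker incidence :&: on (mem F))%VS.

Lemma contractE x e : contract x e = (e \in F)%:R * x (rho e).
Proof.
rewrite lmapE (eq_bigr (fun h => (e \in F)%:R * (x h * (h == rho e)%:R))).
  by rewrite -mulr_sumr sum_delta.
by move=> h _; rewrite mulrCA.
Qed.

Lemma not_inner_rho e : e \in F -> ~~ inner (rho e).
Proof.
move=> eF; rewrite /inner; have [u [v [E0 -> ->]]] := fib_rho eF.
apply/eqP => -[uv]; have := card_ends e; rewrite E0 uv setUid cards1.
by [].
Qed.

Lemma rho_inj : {in F &, injective rho}.
Proof.
move=> e f eF fF E0; apply: ends_inj.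
have [u [v [-> fu fv]]] := fib_rho eF; have [u' [v' [-> fu' fv']]] := fib_rho fF.
by move: fu fv; rewrite E0 fu' fv' => -[->] [->].
Qed.

(** Summing the boundary over the fibre of v, inner edges cancel and those
    representing edges of F remain. *)
Lemma contract_cycle x : x \in lker bd -> x \in on kept ->
  contract x \in cycle_space.
Proof.
move=> /kerP x0 /onP xk; apply/memv_capP; split; last first.
  by apply/onP => e /negPf eF; rewrite contractE [e \in F]eF mul0r.
apply/kerP/ffunP => v; rewrite lmapE ffunE.
have E1 : \sum_(c | fib c == Some v) bd x c = 0.
  by rewrite x0 big1 // => c _; rewrite ffunE.
rewrite -[RHS]E1; under [RHS]eq_bigr => c _ do rewrite lmapE.
rewrite exchange_big /=; under [RHS]eq_bigr => h _ do rewrite -mulr_sumr.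
have sumh h : \sum_(c | fib c == Some v) ((c == c1 h)%:R + (c == c2 h)%:R) =
    (fib (c1 h) == Some v)%:R + (fib (c2 h) == Some v)%:R :> F2.
  rewrite big_mkcond /=.
  rewrite (eq_bigr (fun c => (fib c == Some v)%:R * (c == c1 h)%:R +
                             (fib c == Some v)%:R * (c == c2 h)%:R)).
    by rewrite big_split /= (sum_delta (fun c => (fib c == Some v)%:R))
      (sum_delta (fun c => (fib c == Some v)%:R)).
  by move=> c _; case: eqP; rewrite ?mul1r ?mul0r ?addr0.
under [RHS]eq_bigr => h _ do rewrite sumh.
rewrite [RHS](bigID (mem (rho @: F))) /= [X in _ = _ + X]big1 => [|h hF]; last first.
  case: (boolP (inner h)) => [/andP[_ /eqP ->]|hi]; first by rewrite F2_addxx mulr0.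
  by rewrite xk ?mul0r // /kept negb_or hi.
rewrite addr0 big_imset /=; last exact: rho_inj.
rewrite [RHS]big_mkcond; apply: eq_bigr => e _; rewrite contractE.
case: (boolP (e \in F)) => eF; last by rewrite !mul0r.
rewrite mul1r; congr (_ * _); have [a [b [E0 -> ->]]] := fib_rho eF.
have ab : a != b by have := card_ends e; rewrite E0 cards2; case: eqP.
rewrite E0 !inE !(inj_eq Some_inj) !(eq_sym v).
case: (eqVneq a v) => [av|_]; last by rewrite add0r.
case: (eqVneq b v) => [bv|_]; last by rewrite addr0.
by rewrite av bv eqxx in ab.
Qed.

(** A path inside the fibre of v from its base cell r v to c. *)
Lemma inner_path c v : fib c = Some v ->
  exists2 p, p \in on inner & bd p = delta (r v) + delta c.
Proof.
move=> /fib_conn con; apply: (connect_ind (P := fun c =>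
  exists2 p, p \in on inner & bd p = delta (r v) + delta c) _ con).
  move=> a b /existsP[h /andP[hi H]] [p pi bp].
  exists (p + delta h).
    apply: memvD => //; apply/onP => k ki; rewrite ffunE.
    by case: eqP ki => // ->; rewrite hi.
  rewrite linearD /= bp bd_delta.
  have -> : delta (c1 h) + delta (c2 h) = delta a + delta b.
    by case/orP: H => /andP[/eqP -> /eqP ->] //; rewrite addrC.
  by rewrite addrA -(addrA (delta (r v))) chain_addxx addr0.
by exists 0; [exact: mem0v | rewrite linear0 chain_addxx].
Qed.

Lemma on_sub (I : finType) (S S' : pred I) : subpred S S' -> (on S <= on S')%VS.
Proof.
move=> SS'; apply/subvP => x /onP xS; apply/onP => i Si; apply: xS.
by apply: contra Si; exact: SS'.
Qed.

(** The cell edge that represents e is completed by paths inside the two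
    fibres, so that it joins the base cells of the ends of e. *)
Lemma lift_edge e : e \in F -> exists q, [/\ q \in on kept,
  bd q = \sum_(v in ends e) delta (r v) & contract q = delta e].
Proof.
move=> eF; have [u [v [E0 fu fv]]] := fib_rho eF.
have [p pi bp] := inner_path fu; have [q qi bq] := inner_path fv.
have uv : u != v by have := card_ends e; rewrite E0 cards2; case: eqP.
have sub := on_sub (_ : subpred inner kept).
have ik : subpred inner kept by move=> h; rewrite /kept => ->.
exists (delta (rho e) + (p + q)); split.
- apply: memvD; last first.
    by apply: memvD; [exact: (subvP (sub ik)) pi | exact: (subvP (sub ik)) qi].
  apply/onP => h; rewrite ffunE; case: eqP => // ->.
  by rewrite /kept negb_or imset_f ?andbF.
- rewrite !linearD /= bp bq bd_delta E0 big_setU1 ?inE //= big_set1.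
  exact: chain_cancel.
- apply/ffunP => f; rewrite contractE !ffunE.
  case: (boolP (f \in F)) => fF; last first.
    by rewrite mul0r; case: eqP fF => // ->; rewrite eF.
  move/onP: pi => /(_ _ (not_inner_rho fF)) ->.
  move/onP: qi => /(_ _ (not_inner_rho fF)) ->.
  by rewrite mul1r !addr0 (inj_in_eq rho_inj).
Qed.

(** Lift the edges of a cycle of the minor one by one; the boundaries at the
    base cells cancel as the cycle is even at every vertex. *)
Lemma cycle_space_lift :
  (cycle_space <= contract @: (lker bd :&: on kept))%VS.
Proof.
have [q qP] : exists q : E -> chain Eh, forall e, e \in F ->
    [/\ q e \in on kept, bd (q e) = \sum_(v in ends e) delta (r v)
      & contract (q e) = delta e].
  apply: (@fin_all_exists E (fun=> chain Eh) (fun e q => e \in F ->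
    [/\ q \in on kept, bd q = \sum_(v in ends e) delta (r v)
      & contract q = delta e])) => e.
  case: (boolP (e \in F)) => [/lift_edge[q ?]|]; first by exists q.
  by exists 0.
apply/subvP => z; move=> /memv_capP[/kerP z0 /onP zF].
apply/memv_imgP; exists (\sum_(e in F) z e *: q e).
  apply/memv_capP; split; last first.
    by apply: memv_suml => e eF; apply: memvZ; have [] := qP e eF.
  apply/kerP; rewrite linear_sum /=.
  rewrite (eq_bigr (fun e => \sum_v (z e * (v \in ends e)%:R) *: delta (r v))).
    rewrite exchange_big big1 //= => v _; rewrite -scaler_suml.
    have := congr1 (fun f : chain V => f v) z0; rewrite lmapE ffunE => E1.
    rewrite (_ : \sum_(e in F) _ = 0) ?scale0r // -[RHS]E1 big_mkcond /=.
    apply: eq_bigr => e _; case: ifPn => // eF.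
    by rewrite zF ?mul0r.
  move=> e eF; rewrite linearZ /=; have [_ -> _] := qP e eF.
  rewrite scaler_sumr big_mkcond /=; apply: eq_bigr => v _.
  by case: ifP; rewrite ?mulr1 ?mulr0 ?scale0r.
rewrite linear_sum /= [LHS]chain_delta [RHS]big_mkcond /=.
apply: eq_bigr => e _; case: ifPn => eF.
  by rewrite linearZ /=; have [_ _ ->] := qP e eF.
by rewrite zF // scale0r.
Qed.

(** Boundaries of edges of F are chains of even total on the support of F, so
    they do not fill the chains on the support. *)
Lemma dim_cycle_space : F != set0 ->
  (#|F| + 1 <= \dim cycle_space + #|support ends F|)%N.
Proof.
move=> /set0Pn[e0 e0F].
have := limg_ker_dim incidence (on (mem F)).
rewrite capvC -/cycle_space dim_on -[#|mem F|]/#|F|.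
(* The total of a chain, as a linear map to chains on one point. *)
pose total : 'Hom(chain V, chain 'I_1) := lmap (fun v _ => 1).
pose T := (on (mem (support ends F)) :&: lker total)%VS.
have sub : (incidence @: on (mem F) <= T)%VS.
  apply/subvP => _ /memv_imgP[z /onP zF ->]; apply/memv_capP; split.
    apply/onP => v vS; rewrite lmapE big1 // => e _.
    case: (boolP (e \in F)) => eF; last by rewrite zF ?mul0r.
    case: (boolP (v \in ends e)) => ve; last by rewrite mulr0.
    by case/negP: vS; exact: (mem_support eF).
  apply/kerP/ffunP => i; rewrite lmapE ffunE.
  under eq_bigr => v _ do rewrite mulr1 lmapE.
  rewrite exchange_big big1 //= => e _; rewrite -mulr_sumr.
  rewrite (_ : \sum_v _ = 0) ?mulr0 //.
  have E2 : (\sum_v (v \in ends e : nat) = 2)%N.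
    rewrite -(card_ends e) -sum1_card [RHS]big_mkcond /=.
    by apply: eq_bigr => v _; case: (v \in ends e).
  by rewrite -natr_sum E2 (F2_nat 2).
have ltT : (\dim T < #|support ends F|)%N.
  rewrite -(dim_on (mem (support ends F))) ltnNge; apply/negP => le.
  have : on (mem (support ends F)) = T.
    by apply/eqP; rewrite eq_sym eqEdim capvSl.
  have [u [v [uv E0]]] := ends_mem card_ends e0.
  have uS : u \in support ends F by apply: (mem_support e0F); rewrite E0 !inE eqxx.
  move=> E1; have : delta u \in T.
    rewrite -E1; apply/onP => i iS; rewrite ffunE; case: eqP iS => // ->.
    by rewrite /= uS.
  move=> /memv_capP[_ /kerP] /(congr1 (fun f : chain 'I_1 => f ord0)); rewrite lmapE ffunE.
  under eq_bigr => i _ do rewrite ffunE mulrC.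
  by rewrite (sum_delta (fun=> 1)) => /eqP; rewrite oner_eq0.
move=> <-; rewrite -addnA leq_add2l addn1.
exact: leq_ltn_trans (dimvS sub) ltT.
Qed.
(** Corners joined by a deleted edge lie in the same face of the minor. *)
Let merge : rel W := link w1 w2 (predC kept).
Let cls := fingraph.root merge.

Lemma cls_deleted h : ~~ kept h -> cls (w1 h) = cls (w2 h).
Proof.
move=> hk; apply/(fingraph.rootP (link_sym _ _ _))/connect1/existsP; exists h.
by rewrite /= hk !eqxx.
Qed.

(** If a combination of face boundaries avoids the deleted edges, its
    coefficients agree at the two faces that such an edge separates. *)
Lemma constant_on_classes x w : around x \in on kept -> x (cls w) = x w.
Proof.
move=> /onP xk; have con : connect merge w (cls w) := connect_root _ _.
apply: (connect_ind (P := fun v => x v = x w) _ con) => // u v /existsP[h /andP[hk H]] <-.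
have := xk h hk; rewrite aroundE => /F2_add_eq0.
by case/orP: H => /andP[/eqP -> /eqP ->].
Qed.

Definition minor_face (i : W) : {set E} :=
  [set e in F | (cls (w1 (rho e)) == i) (+) (cls (w2 (rho e)) == i)].

Lemma ind_minor_face i :
  ind (minor_face i) = contract (around [ffun w => (cls w == i)%:R]).
Proof.
apply/ffunP => e; rewrite contractE aroundE !ffunE inE.
case: (e \in F); rewrite ?mul0r // mul1r -natrD [RHS]F2_nat.
by case: eqP => _; case: eqP.
Qed.

Hypothesis cycles : forall w c,
  \sum_h ((w == w1 h)%:R + (w == w2 h)%:R) * ((c == c1 h)%:R + (c == c2 h)%:R)
  = 0 :> F2.
Hypothesis conn : forall c c', connect (link c1 c2 predT) c c'.
Hypothesis co_conn : forall w w', connect (link w1 w2 predT) w w'.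

Lemma minor_face_even i v : ~~ odd (dg ends (minor_face i) v).
Proof.
have : ind (minor_face i) \in cycle_space.
  rewrite ind_minor_face; apply: contract_cycle.
    by apply: (subvP (around_cycle cycles)); apply: memv_img; exact: memvf.
  apply/onP => h hk; rewrite aroundE !ffunE (cls_deleted hk).
  exact: F2_addxx.
move=> /memv_capP[/kerP /(congr1 (fun f : chain V => f v)) + _].
rewrite lmapE ffunE (_ : \sum_e _ = (dg ends (minor_face i) v)%:R).
  by rewrite F2_nat; case: odd.
rewrite /dg -sum1_card natr_sum [RHS]big_mkcond /=.
apply: eq_bigr => e _; rewrite ffunE -natrM mulnb [in RHS]inE.
by case: (_ && _).
Qed.

(** An edge lies on the boundary of the merged faces of its two corners,
    unless these faces coincide. *)
Lemma minor_face_two e :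
  #|[set i | e \in minor_face i]| = 0%N \/ #|[set i | e \in minor_face i]| = 2%N.
Proof.
set A := [set i | _]; set x := cls (w1 (rho e)); set y := cls (w2 (rho e)).
case: (boolP (e \in F)) => eF; last first.
  left; apply/eqP; rewrite cards_eq0; apply/eqP/setP => i.
  by rewrite !inE (negPf eF).
have [xy|xy] := eqVneq x y; [left | right].
  apply/eqP; rewrite cards_eq0; apply/eqP/setP => i.
  by rewrite !inE -/x -/y xy addbb andbF.
suff -> : A = [set x; y] by rewrite cards2 xy.
apply/setP => i; rewrite !inE eF -/x -/y /= ![i == _]eq_sym.
by case: eqP => [xi|]; case: eqP => [yi|] //; rewrite xi yi eqxx in xy.
Qed.

(** A combination of face boundaries that avoids the deleted edges is constant
    on the merged corners, so it is a combination of boundaries of merged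
    faces. *)
Lemma contract_span :
  (contract @: (limg around :&: on kept) <=
   <<[seq ind (minor_face i) | i <- enum W]>>)%VS.
Proof.
apply/subvP => _ /memv_imgP[y /memv_capP[/memv_imgP[x _ ->] xk] ->].
have -> : contract (around x) = \sum_i x i *: ind (minor_face i).
  apply/ffunP => e; rewrite contractE aroundE sum_ffunE /=.
  under eq_bigr => i _ do rewrite !ffunE inE -[_ *: _]/(_ * _).
  case: (boolP (e \in F)) => eF; last first.
    by rewrite mul0r big1 // => i _; rewrite /= mulr0.
  rewrite mul1r -(constant_on_classes (w1 _) xk) -(constant_on_classes (w2 _) xk).
  rewrite -(sum_delta x (cls (w1 (rho e)))) -(sum_delta x (cls (w2 (rho e)))).
  rewrite -big_split; apply: eq_bigr => i _; rewrite /= -mulrDr -natrD.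
  rewrite [_%:R]F2_nat; congr (_ * _).
  by rewrite [in RHS](eq_sym _ i) [X in _ (+) X](eq_sym _ i); case: eqP; case: eqP.
apply: memv_suml => i _; apply/memvZ/memv_span/map_f.
by rewrite mem_enum.
Qed.

(** In the cell decomposition the boundaries have codimension at most 2 - chi
    in the cycles. This bound survives the restriction to the kept edges and
    the contraction, so the faces of the minor span a subspace of codimension
    at most 2 - chi in the cycle space of F, whose dimension is at least |F| -
    |S| + 1. The bounds of [face_count] give the claim, with |S| >= 4 for the
    second alternative. *)
Theorem minor_euler (chi : nat) : (#|Cl| + #|W| = #|Eh| + chi)%N ->
  (chi <= 1)%N -> F != set0 -> (4 <= #|support ends F|)%N ->
  (2 * #|F| + 4 * chi <= 4 * #|support ends F| + #|triangles ends F|)%N.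
Proof.
move=> hchi chi1 Fn0 S4.
have [e0 e0F] := set0Pn _ Fn0.
have h4 := codim_around conn co_conn (c1 (rho e0)) (w1 (rho e0)).
have h3 := dim_cycle_space Fn0; have h2 := dimvS cycle_space_lift.
have h1 := dimvS contract_span.
pose A := (lker bd :&: on kept)%VS; pose A' := (limg around :&: on kept)%VS.
have A'A : (A' <= A)%VS by apply: capvS (around_cycle cycles) (subvv _).
have dA : (\dim A + \dim (limg around) <= \dim (lker bd) + \dim A')%N.
  have <- : (A :&: limg around)%VS = A'.
    apply/eqP; rewrite eqEsubv; apply/andP; split; apply/subvP => x.
      by move=> /memv_capP[/memv_capP[_ ?] ?]; apply/memv_capP.
    move=> /[dup] /(subvP A'A) xA /memv_capP[? _]; exact/memv_capP.
  rewrite -dimv_sum_cap leq_add2r; apply: dimvS; rewrite subv_add capvSl.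
  exact: around_cycle.
have dc : (\dim (contract @: A) + \dim A' <= \dim A + \dim (contract @: A'))%N.
  have arith (dA1 dA2 cA1 cA2 k1 k2 : nat) : (k1 + cA1 = dA1 -> k2 + cA2 = dA2 ->
      k2 <= k1 -> cA1 + dA2 <= dA1 + cA2)%N by lia.
  apply: arith (limg_ker_dim contract A) (limg_ker_dim contract A') _.
  exact: dimvS (capvS A'A (subvv (lker contract))).
have arith (span cA1 cA2 cyc S T ker im dA1 dA2 f nC nW nE : nat) : (cA2 <= span ->
    cyc <= cA1 -> f + 1 <= cyc + S -> ker + nC + nW <= im + nE + 2 ->
    dA1 + im <= ker + dA2 -> cA1 + dA2 <= dA1 + cA2 -> nC + nW = nE + chi ->
    4 <= S -> 4 * (span + 1) <= 2 * f + T \/ 3 * span <= f ->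
    2 * f + 4 * chi <= 4 * S + T)%N by lia.
apply: arith h1 h2 h3 h4 dA dc hchi S4 _.
apply: face_count => //; [|exact: minor_face_even|exact: minor_face_two].
by move=> i; apply/subsetP => e; rewrite inE => /andP[].
Qed.

End Minor.

(** * Grids on a glued square *)

Local Close Scope ring_scope.

Section Grid.
Variables (n : nat) (a b : bool).
Local Notation N := n.+1.
Local Notation cell := ('I_N * 'I_N)%type.
Local Notation grid_edge := (bool * cell)%type.

Definition cell_at (i j : nat) : cell := (inord i, inord j).
(** Reversal of the coordinates 0, ..., m of a side. *)
Definition flip (f : bool) (m i : nat) := if f then (m - i)%N else i.

Definition right_of (c : cell) : cell :=
  if c.1.+1 < N then cell_at c.1.+1 c.2 else cell_at 0 (flip a n c.2).
Definition above (c : cell) : cell :=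
  if c.2.+1 < N then cell_at c.1 c.2.+1 else cell_at (flip b n c.1) 0.

(** The grid edge (true, c) is the right side of the cell c and (false, c) is
    its upper side, as common sides of two cells. *)
Definition gc1 (h : grid_edge) : cell := h.2.
Definition gc2 (h : grid_edge) : cell := if h.1 then right_of h.2 else above h.2.

(** Lattice points have coordinates 0, ..., N; those on opposite sides are
    glued like the sides of the square. *)
Inductive lattice_glue : nat * nat -> nat * nat -> Prop :=
| lattice_left_right y : (y <= N)%N -> lattice_glue (0, y) (N, flip a N y)
| lattice_bottom_top x : (x <= N)%N -> lattice_glue (x, 0) (flip b N x, N).

Definition lattice_equiv := clos_refl_sym_trans _ lattice_glue.

Variables (W : finType) (kap : nat * nat -> W).
(** The map kap names the classes of glued lattice points, that is, the
    corners of the grid on the surface. Its values outside the square are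
    arbitrary. *)
Definition corner_class :=
  [/\ forall p q, lattice_glue p q -> kap p = kap q,
      forall w, exists p, [/\ (p.1 <= N)%N, (p.2 <= N)%N & kap p = w]
    & forall p q, (p.1 <= N)%N -> (p.2 <= N)%N -> (q.1 <= N)%N ->
        (q.2 <= N)%N -> kap p = kap q -> lattice_equiv p q].
Hypothesis kapP : corner_class.

(** The two ends of the side h, as vertices of the cell h.2. *)
Definition gw1 (h : grid_edge) : W :=
  if h.1 then kap (h.2.1.+1, nat_of_ord h.2.2) else kap (nat_of_ord h.2.1, h.2.2.+1).
Definition gw2 (h : grid_edge) : W := kap (h.2.1.+1, h.2.2.+1).

Lemma cell_at_val i j : (i < N)%N -> (j < N)%N ->
  (cell_at i j).1 = i :> nat /\ (cell_at i j).2 = j :> nat.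
Proof. by move=> iN jN; rewrite /= !inordK. Qed.

Lemma cell_atE (c : cell) : c = cell_at c.1 c.2.
Proof. by case: c => i j; rewrite /cell_at !inord_val. Qed.

Lemma flip_lt f i : (i < N)%N -> (flip f n i < N)%N.
Proof. by rewrite /flip; case: f => //; lia. Qed.

Lemma cell_at_inj i j i' j' : (i < N)%N -> (j < N)%N -> (i' < N)%N -> (j' < N)%N ->
  cell_at i j = cell_at i' j' -> i = i' /\ j = j'.
Proof.
move=> iN jN iN' jN' E0; have := cell_at_val iN jN; rewrite E0.
by have [-> ->] := cell_at_val iN' jN'; case.
Qed.

Lemma right_of_inj : injective right_of.
Proof.
move=> c d; have := ltn_ord c.1; have := ltn_ord c.2.
have := ltn_ord d.1; have := ltn_ord d.2.
move=> d2 d1 c2 c1; have fc := flip_lt a c2; have fd := flip_lt a d2.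
rewrite /right_of (cell_atE c) (cell_atE d).
have [-> ->] := cell_at_val c1 c2; have [-> ->] := cell_at_val d1 d2.
case: ifP => cN; case: ifP => dN /cell_at_inj => /(_ _ _ _ _) H.
- have [||||E1 E2] := H; try lia. have E3 : c.1 = d.1 :> nat by lia. by rewrite E3 E2.
- by exfalso; have [||||E1 E2] := H; lia.
- by exfalso; have [||||E1 E2] := H; lia.
- have [||||_ E2] := H; try lia.
  have -> : c.1 = d.1 :> nat by lia.
  by have -> : c.2 = d.2 :> nat by move: E2; rewrite /flip; case: (a); lia.
Qed.

Lemma above_inj : injective above.
Proof.
move=> c d; have := ltn_ord c.1; have := ltn_ord c.2.
have := ltn_ord d.1; have := ltn_ord d.2.
move=> d2 d1 c2 c1; have fc := flip_lt b c1; have fd := flip_lt b d1.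
rewrite /above (cell_atE c) (cell_atE d).
have [-> ->] := cell_at_val c1 c2; have [-> ->] := cell_at_val d1 d2.
case: ifP => cN; case: ifP => dN /cell_at_inj => /(_ _ _ _ _) H.
- have [||||E1 E2] := H; try lia. have E3 : c.2 = d.2 :> nat by lia. by rewrite E3 E1.
- by exfalso; have [||||E1 E2] := H; lia.
- by exfalso; have [||||E1 E2] := H; lia.
- have [||||E1 _] := H; try lia.
  have -> : c.2 = d.2 :> nat by lia.
  by have -> : c.1 = d.1 :> nat by move: E1; rewrite /flip; case: (b); lia.
Qed.

Local Notation side w p q := ((w == kap p)%:R + (w == kap q)%:R : F2)%R.

(** Seen from the neighbouring cell the right side of c is its left side, with
    the ends exchanged if the glueing is reversing. *)
Lemma right_side w (c : cell) :
  side w (c.1.+1, nat_of_ord c.2) (c.1.+1, c.2.+1) =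
  side w (nat_of_ord (right_of c).1, nat_of_ord (right_of c).2)
         (nat_of_ord (right_of c).1, (right_of c).2.+1).
Proof.
have [glue _ _] := kapP.
have c1 := ltn_ord c.1; have c2 := ltn_ord c.2; have fc := flip_lt a c2.
rewrite /right_of; case: ifP => cN.
  by have [-> ->] := cell_at_val (cN : (c.1.+1 < N)%N) c2.
have [-> ->] := cell_at_val (ltn0Sn n) fc.
have -> : c.1.+1 = N by lia.
rewrite (glue _ _ (lattice_left_right (ltnW fc))) (glue _ _ (lattice_left_right fc)).
rewrite /flip; case: (a); last by [].
rewrite addrC; congr ((w == kap (_, _))%:R + (w == kap (_, _))%:R)%R; lia.
Qed.

Lemma above_side w (c : cell) :
  side w (nat_of_ord c.1, c.2.+1) (c.1.+1, c.2.+1) =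
  side w (nat_of_ord (above c).1, nat_of_ord (above c).2)
         ((above c).1.+1, nat_of_ord (above c).2).
Proof.
have [glue _ _] := kapP.
have c1 := ltn_ord c.1; have c2 := ltn_ord c.2; have fc := flip_lt b c1.
rewrite /above; case: ifP => cN.
  by have [-> ->] := cell_at_val c1 (cN : (c.2.+1 < N)%N).
have [-> ->] := cell_at_val fc (ltn0Sn n).
have -> : c.2.+1 = N by lia.
rewrite (glue _ _ (lattice_bottom_top (ltnW fc))) (glue _ _ (lattice_bottom_top fc)).
rewrite /flip; case: (b); last by [].
rewrite addrC; congr ((w == kap (_, _))%:R + (w == kap (_, _))%:R)%R; lia.
Qed.

(** The four sides of a cell form a closed path, so w occurs an even number of
    times among their ends. *)
Lemma grid_cycles w c :
  (\sum_h ((w == gw1 h)%:R + (w == gw2 h)%:R) * ((c == gc1 h)%:R + (c == gc2 h)%:R)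
  = 0 :> F2)%R.
Proof.
pose f h : F2 := ((w == gw1 h)%:R + (w == gw2 h)%:R)%R.
rewrite (eq_bigr (fun h : bool * cell => f (h.1, h.2) * ((c == gc1 (h.1, h.2))%:R +
  (c == gc2 (h.1, h.2))%:R))%R); last by case.
rewrite -(pair_bigA _ (fun d c' => f (d, c') * ((c == gc1 (d, c'))%:R +
  (c == gc2 (d, c'))%:R))%R) /=.
rewrite big_bool /=.
have E1 d : (\sum_c' f (d, c') * ((c == gc1 (d, c'))%:R + (c == gc2 (d, c'))%:R) =
    f (d, c) + \sum_c' f (d, c') * (c == gc2 (d, c'))%:R)%R.
  rewrite (eq_bigr (fun c' => f (d, c') * (c' == c)%:R +
    f (d, c') * (c == gc2 (d, c'))%:R)%R).
    by rewrite big_split /= (sum_delta (fun c' => f (d, c'))).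
  by move=> c' _; rewrite mulrDr [c == gc1 _]eq_sym.
rewrite !E1 {E1}.
have -> : (\sum_c' f (true, c') * (c == gc2 (true, c'))%:R)%R =
    side w (nat_of_ord c.1, nat_of_ord c.2) (nat_of_ord c.1, c.2.+1).
  pose g (c' : cell) := side w (nat_of_ord c'.1, nat_of_ord c'.2)
                               (nat_of_ord c'.1, c'.2.+1).
  rewrite -[RHS]/(g c) -(sum_delta g) [RHS](reindex_inj right_of_inj) /=.
  by apply: eq_bigr => c' _; rewrite /f /gc2 /gw1 /gw2 /= right_side (eq_sym c).
have -> : (\sum_c' f (false, c') * (c == gc2 (false, c'))%:R)%R =
    side w (nat_of_ord c.1, nat_of_ord c.2) (c.1.+1, nat_of_ord c.2).
  pose g (c' : cell) := side w (nat_of_ord c'.1, nat_of_ord c'.2)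
                               (c'.1.+1, nat_of_ord c'.2).
  rewrite -[RHS]/(g c) -(sum_delta g) [RHS](reindex_inj above_inj) /=.
  by apply: eq_bigr => c' _; rewrite /f /gc2 /gw1 /gw2 /= above_side (eq_sym c).
rewrite /f /gw1 /gw2 /= -!natrD F2_nat.
do 4 case: (w == _) => //=.
Qed.

Lemma grid_step_right i j (P : pred grid_edge) : (i.+1 < N)%N -> (j < N)%N ->
  P (true, cell_at i j) -> link gc1 gc2 P (cell_at i j) (cell_at i.+1 j).
Proof.
move=> iN jN Ph; apply/existsP; exists (true, cell_at i j); rewrite Ph /gc1 /gc2 /=.
have [E1 E2] := cell_at_val (ltnW iN) jN.
by rewrite /right_of E1 E2 iN !eqxx.
Qed.

Lemma grid_step_up i j (P : pred grid_edge) : (i < N)%N -> (j.+1 < N)%N ->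
  P (false, cell_at i j) -> link gc1 gc2 P (cell_at i j) (cell_at i j.+1).
Proof.
move=> iN jN Ph; apply/existsP; exists (false, cell_at i j); rewrite Ph /gc1 /gc2 /=.
have [E1 E2] := cell_at_val iN (ltnW jN).
by rewrite /above E1 E2 jN !eqxx.
Qed.

Lemma grid_conn c c' : connect (link gc1 gc2 predT) c c'.
Proof.
suff H (d : cell) : connect (link gc1 gc2 predT) (cell_at 0 0) d.
  by apply: connect_trans (H c'); rewrite (link_sym gc1 gc2 predT).
rewrite (cell_atE d); move: (ltn_ord d.1) (ltn_ord d.2).
move: (nat_of_ord d.1) (nat_of_ord d.2) => i j iN.
elim: j => [|j IHj] jN.
  elim: i iN => [|i IHi] iN; first exact: connect0.
  apply: connect_trans (IHi (ltnW iN)) (connect1 _).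
  exact: grid_step_right.
by apply: connect_trans (IHj (ltnW jN)) (connect1 _); exact: grid_step_up.
Qed.

Lemma grid_co_conn w w' : connect (link gw1 gw2 predT) w w'.
Proof.
have [glue surj _] := kapP.
have step h : connect (link gw1 gw2 predT) (gw1 h) (gw2 h).
  by apply/connect1/existsP; exists h; rewrite !eqxx.
have up1 x y : (x < N)%N -> (y < N)%N ->
    connect (link gw1 gw2 predT) (kap (x.+1, y)) (kap (x.+1, y.+1)).
  move=> xN yN; have := step (true, cell_at x y).
  by rewrite /gw1 /gw2 /=; have [-> ->] := cell_at_val xN yN.
have right1 x y : (x < N)%N -> (y < N)%N ->
    connect (link gw1 gw2 predT) (kap (x, y.+1)) (kap (x.+1, y.+1)).
  move=> xN yN; have := step (false, cell_at x y).
  by rewrite /gw1 /gw2 /=; have [-> ->] := cell_at_val xN yN.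
(* A side on the left or lower boundary of the square is not of the form
   (true, c) or (false, c), so its ends are joined through the glued side. *)
have up x y : (x <= N)%N -> (y < N)%N ->
    connect (link gw1 gw2 predT) (kap (x, y)) (kap (x, y.+1)).
  case: x => [_ yN|x xN]; last exact: up1.
  rewrite (glue _ _ (lattice_left_right (ltnW yN))) (glue _ _ (lattice_left_right yN)).
  rewrite /flip; case: (a); last exact: up1.
  rewrite link_sym (_ : N - y = (N - y.+1).+1)%N; last by lia.
  by apply: up1; lia.
have right0 x : (x < N)%N -> connect (link gw1 gw2 predT) (kap (x, 0)) (kap (x.+1, 0)).
  move=> xN; rewrite (glue _ _ (lattice_bottom_top (ltnW xN))).
  rewrite (glue _ _ (lattice_bottom_top xN)) /flip; case: (b); last exact: right1.
  rewrite link_sym (_ : N - x = (N - x.+1).+1)%N; last by lia.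
  by apply: right1; lia.
suff H v : connect (link gw1 gw2 predT) (kap (0, 0)) v.
  by apply: connect_trans (H w'); rewrite link_sym.
have [[x y] [/= + + <-]] := surj v.
elim: y => [|y IHy] xN yN.
  elim: x xN => [|x IHx] xN; first exact: connect0.
  by apply: connect_trans (IHx (ltnW xN)) _; exact: right0.
by apply: connect_trans (IHy xN (ltnW yN)) _; exact: up.
Qed.

(** The lattice point p is one of the four vertices of the cell c. *)
Definition corner_of (p : nat * nat) (c : cell) :=
  [&& c.1 <= p.1, p.1 <= c.1.+1, c.2 <= p.2 & p.2 <= c.2.+1].
Definition has_corner w (c : cell) :=
  [exists p : 'I_N.+1 * 'I_N.+1,
     (kap (nat_of_ord p.1, nat_of_ord p.2) == w) &&
     corner_of (nat_of_ord p.1, nat_of_ord p.2) c].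

Lemma has_cornerP w c :
  reflect (exists2 p, kap p = w & corner_of p c) (has_corner w c).
Proof.
apply: (iffP existsP) => [[p /andP[/eqP <- pc]]|[[x y] <- /= /[dup] pc /and4P[]]].
  by eexists; last exact: pc.
move=> /= x1 x2 y1 y2; have c1 := ltn_ord c.1; have c2 := ltn_ord c.2.
exists (inord x, inord y); rewrite /corner_of /= !inordK ?eqxx //=.
  by lia.
by lia.
Qed.

(** Inside the square the cells at a lattice point are at most four, and they
    are joined through sides that end in p. *)
Lemma star_square (P : pred cell) p c c' :
  (forall d, corner_of p d -> P d) -> corner_of p c -> corner_of p c' ->
  connect (link gc1 gc2 (fun h => P (gc1 h) && P (gc2 h))) c c'.
Proof.
move=> Pp pc pc'; set Q := fun h => _.
have right1 i j : (i.+1 < N)%N -> (j < N)%N -> corner_of p (cell_at i j) ->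
    corner_of p (cell_at i.+1 j) ->
    connect (link gc1 gc2 Q) (cell_at i j) (cell_at i.+1 j).
  move=> iN jN p1 p2; apply/connect1/grid_step_right => //.
  rewrite /Q /gc1 /gc2 /= Pp //= /right_of.
  by have [-> ->] := cell_at_val (ltnW iN) jN; rewrite iN Pp.
have up1 i j : (i < N)%N -> (j.+1 < N)%N -> corner_of p (cell_at i j) ->
    corner_of p (cell_at i j.+1) ->
    connect (link gc1 gc2 Q) (cell_at i j) (cell_at i j.+1).
  move=> iN jN p1 p2; apply/connect1/grid_step_up => //.
  rewrite /Q /gc1 /gc2 /= Pp //= /above.
  by have [-> ->] := cell_at_val iN (ltnW jN); rewrite jN Pp.
move: pc pc'; rewrite (cell_atE c) (cell_atE c').
move: (ltn_ord c.1) (ltn_ord c.2) (ltn_ord c'.1) (ltn_ord c'.2).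
move: (nat_of_ord c.1) (nat_of_ord c.2) (nat_of_ord c'.1) (nat_of_ord c'.2).
move=> i j i' j' iN jN iN' jN'.
have cE x y : (x < N)%N -> (y < N)%N -> corner_of p (cell_at x y) =
    [&& x <= p.1, p.1 <= x.+1, y <= p.2 & p.2 <= y.+1].
  by move=> xN yN; rewrite /corner_of; have [-> ->] := cell_at_val xN yN.
rewrite !cE // => /and4P[p1 p2 p3 p4] /and4P[q1 q2 q3 q4].
apply: (@connect_trans _ _ (cell_at i' j)).
  have [->|[E0|E0]] : i = i' \/ (i' = i.+1 \/ i = i'.+1) by lia.
  - exact: connect0.
  - by rewrite E0 in iN' *; apply: right1; rewrite ?cE //; lia.
  - by rewrite E0 in iN *; rewrite link_sym; apply: right1; rewrite ?cE //; lia.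
have [->|[E0|E0]] : j = j' \/ (j' = j.+1 \/ j = j'.+1) by lia.
- exact: connect0.
- by rewrite E0 in jN' *; apply: up1; rewrite ?cE //; lia.
- by rewrite E0 in jN *; rewrite link_sym; apply: up1; rewrite ?cE //; lia.
Qed.

Lemma ex_corner_of p : (p.1 <= N)%N -> (p.2 <= N)%N -> exists c, corner_of p c.
Proof.
move=> p1 p2; exists (cell_at p.1.-1 p.2.-1); rewrite /corner_of.
by have [||-> ->] := @cell_at_val p.1.-1 p.2.-1; lia.
Qed.

(** The cells at glued lattice points are joined through the glued sides that
    end there, so all cells at a corner of the surface are connected. *)
Lemma star_connected w c c' : has_corner w c -> has_corner w c' ->
  connect (link gc1 gc2 (fun h => has_corner w (gc1 h) && has_corner w (gc2 h)))
    c c'.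
Proof.
have [glue surj classes] := kapP.
move=> /has_cornerP[p pw pc] /has_cornerP[q qw qc].
have bound r d : corner_of r d -> (r.1 <= N)%N /\ (r.2 <= N)%N.
  by move=> /and4P[_ r1 _ r2]; have := ltn_ord d.1; have := ltn_ord d.2; lia.
have [p1 p2] := bound _ _ pc; have [q1 q2] := bound _ _ qc.
have pq := classes _ _ p1 p2 q1 q2 (etrans pw (esym qw)).
set Q := fun h => _.
have inw r : kap r = w -> forall d, corner_of r d -> has_corner w d.
  by move=> rw d rd; apply/has_cornerP; exists r.
have sq r : kap r = w -> forall d d', corner_of r d -> corner_of r d' ->
    connect (link gc1 gc2 Q) d d'.
  by move=> rw d d'; exact: star_square (inw _ rw).
suff H r s : lattice_equiv r s -> (r.1 <= N)%N -> (r.2 <= N)%N -> kap r = w ->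
    [/\ (s.1 <= N)%N, (s.2 <= N)%N, kap s = w & forall d d', corner_of r d ->
       corner_of s d' -> connect (link gc1 gc2 Q) d d'].
  by have [_ _ _] := H p q pq p1 p2 pw; apply.
move=> rs; suff H : ([/\ (r.1 <= N)%N, (r.2 <= N)%N & kap r = w] <->
      [/\ (s.1 <= N)%N, (s.2 <= N)%N & kap s = w]) /\
     ([/\ (r.1 <= N)%N, (r.2 <= N)%N & kap r = w] -> forall d d', corner_of r d ->
       corner_of s d' -> connect (link gc1 gc2 Q) d d').
  move=> r1 r2 rw; have r3 : [/\ (r.1 <= N)%N, (r.2 <= N)%N & kap r = w] by [].
  by have [[/(_ r3)[? ? ?] _] /(_ r3)] := H.
elim: rs => {r s pq} [r s rs|r|r s _ [IH1 IH2]|r s t _ [IH1 IH2] _ [IH3 IH4]].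
- have kE := glue _ _ rs; split; first by case: rs kE => z zN <- /=;
    split=> -[? ? ?]; split=> //; rewrite /flip; case: ifP => _; lia.
  case=> r1 r2 rw d d' rd sd'.
  have sw : kap s = w by rewrite -kE.
  (* A cell at the lattice point s on the right or top side crosses the glued
     side to a cell at r. *)
  suff [e se [e' re' lk]] : exists2 e, corner_of s e & exists2 e', corner_of r e' &
      link gc1 gc2 Q e e'.
    apply: connect_trans (sq _ rw _ _ rd re') _.
    apply: (@connect_trans _ _ e); last exact: sq _ sw _ _ se sd'.
    by rewrite link_sym; exact: connect1.
  case: rs rw sw {rd sd' kE r1 r2} => z zN rw sw.
    have zf : (flip a N z <= N)%N by rewrite /flip; case: (a); lia.
    have [e se] := ex_corner_of (p := (N, flip a N z)) (leqnn N) zf.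
    have e1 := ltn_ord e.1; have e2 := ltn_ord e.2.
    have re : corner_of (0, z) (right_of e).
      move: se; rewrite /corner_of /= => /and4P[h1 h2 h3 h4].
      rewrite /right_of (_ : (e.1.+1 < N)%N = false); last by lia.
      have [-> ->] := cell_at_val (ltn0Sn n) (flip_lt a e2).
      by move: h3 h4; rewrite /flip; case: (a); lia.
    exists e => //; exists (right_of e) => //.
    apply/existsP; exists (true, e); rewrite /Q /gc1 /gc2 /= !eqxx.
    by rewrite (inw _ sw) ?(inw _ rw).
  have zf : (flip b N z <= N)%N by rewrite /flip; case: (b); lia.
  have [e se] := ex_corner_of (p := (flip b N z, N)) zf (leqnn N).
  have e1 := ltn_ord e.1; have e2 := ltn_ord e.2.
  have re : corner_of (z, 0) (above e).
    move: se; rewrite /corner_of /= => /and4P[h1 h2 h3 h4].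
    rewrite /above (_ : (e.2.+1 < N)%N = false); last by lia.
    have [-> ->] := cell_at_val (flip_lt b e1) (ltn0Sn n).
    by move: h1 h2; rewrite /flip; case: (b); lia.
  exists e => //; exists (above e) => //.
  apply/existsP; exists (false, e); rewrite /Q /gc1 /gc2 /= !eqxx.
  by rewrite (inw _ sw) ?(inw _ rw).
- split=> // -[_ _ rw] d d' rd rd'; exact: sq _ rw _ _ rd rd'.
- split; first by rewrite IH1.
  by move=> sP d d' sd rd'; rewrite link_sym; apply: IH2 => //; apply/IH1.
- split; first by rewrite IH1 IH3.
  move=> rP d d' rd td'; have sP := IH1.1 rP; have [s1 s2 _] := sP.
  have [e se] := ex_corner_of s1 s2.
  exact: connect_trans (IH2 rP d e rd se) (IH4 sP e d' se td').
Qed.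

End Grid.

(** It suffices to name a representative om w of each class and to reach it
    from every lattice point. *)
Lemma corner_class_of_repr n a b (W : finType) (kap : nat * nat -> W)
    (om : W -> nat * nat) :
  (forall p q, lattice_glue n a b p q -> kap p = kap q) ->
  (forall w, [/\ (om w).1 <= n.+1, (om w).2 <= n.+1 & kap (om w) = w]) ->
  (forall p, p.1 <= n.+1 -> p.2 <= n.+1 -> lattice_equiv n a b p (om (kap p))) ->
  corner_class n a b kap.
Proof.
move=> glue omP rep; split=> // [w|p q p1 p2 q1 q2 E0].
  by exists (om w); have := omP w.
apply: rst_trans (rep p p1 p2) _; rewrite E0.
by apply: rst_sym; exact: rep.
Qed.

(** The lattice points with both coordinates less than N represent different
    classes. If both pairs of sides are reversed there is one further class,
    that of (0, N) and (N, 0), and otherwise there is none. This is where the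
    Euler characteristic of the surface enters. *)
Lemma ex_corner_class n a b : b ==> a ->
  exists (W : finType) (kap : nat * nat -> W),
    corner_class n a b kap /\ #|W| = n.+1 * n.+1 + (a && b).
Proof.
set N := n.+1; case: b => /= [->|_].
  (* Both sides reversed: the corners (0, N) and (N, 0) are glued and form the
     class None, in addition to one class for each cell. *)
  exists (option ('I_N * 'I_N)%type).
  exists (fun p : nat * nat =>
    if p.1 < N then
      if p.2 < N then Some (inord p.1, inord p.2)
      else if 0 < p.1 then Some (inord (N - p.1), ord0) else None
    else if 0 < p.2 then Some (ord0, inord (N - p.2)) else None).
  split; last by rewrite card_option card_prod card_ord addn1.
  apply: (corner_class_of_repr (om := fun w : option ('I_N * 'I_N)%type =>
    if w is Some c then (nat_of_ord c.1, nat_of_ord c.2) else (0, N))).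
  - move=> p q [z zN|z zN] /=; rewrite ltnn.
      case: (ltnP z N) => zN'.
        rewrite subn_gt0 zN'; congr (Some (_, _)).
          by apply/val_inj; rewrite /= inordK.
        by congr inord; lia.
      by rewrite (_ : N - z = 0) //; lia.
    case: (posnP z) => [->|z0].
      rewrite subn0 ltnn subnn /=; congr (Some (_, _)).
      by apply/val_inj; rewrite /= inordK.
    rewrite (_ : N - z < N) ?subn_gt0; last by lia.
    case: (ltnP z N) => zN'; last by [].
    congr (Some (_, _)); last by apply/val_inj; rewrite /= inordK.
    by congr inord; lia.
  - case=> [[i j]|] /=; last by rewrite ltnn.
    have iN := ltn_ord i; have jN := ltn_ord j.
    by rewrite iN jN !inord_val; split=> //; exact: ltnW.
  move=> [x y] /= xN yN.
  case: (ltnP x N) => xN'; [case: (ltnP y N) => yN'|].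
  - by rewrite !inordK //; exact: rst_refl.
  - have -> : y = N by lia.
    case: posnP => [->|x0]; first exact: rst_refl.
    apply: rst_sym; rewrite /= inordK; last by lia.
    apply: rst_step; have := @lattice_bottom_top n true true _ (leq_subr x N).
    by rewrite /flip subKn.
  have -> : x = N by lia.
  case: posnP => [->|y0].
    apply: rst_sym; apply: rst_step.
    by have := @lattice_left_right n true true _ (leqnn N); rewrite /flip subnn.
  apply: rst_sym; rewrite /= inordK; last by lia.
  apply: rst_step; have := @lattice_left_right n true true _ (leq_subr y N).
  by rewrite /flip subKn.
exists ('I_N * 'I_N)%type.
exists (fun p : nat * nat =>
  if p.1 < N then (inord p.1, inord (p.2 %% N))
  else (ord0, inord (flip a N p.2 %% N))).
split; last by rewrite andbF addn0 card_prod card_ord.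
apply: (corner_class_of_repr (om := fun c : 'I_N * 'I_N =>
  (nat_of_ord c.1, nat_of_ord c.2))).
- move=> p q [z zN|z zN] /=; rewrite ?ltnn.
    congr (_, _); first by apply/val_inj; rewrite /= inordK.
    by rewrite /flip; case: (a); rewrite // subKn.
  case: (ltnP z N) => zN'; first by rewrite modnn mod0n.
  congr (_, _); rewrite /flip; case: (a); rewrite ?subnn ?subn0 ?modnn ?mod0n //.
- move=> [i j] /=; have iN := ltn_ord i; have jN := ltn_ord j.
  by rewrite iN modn_small // !inord_val; split=> //; exact: ltnW.
have top x : x <= N -> lattice_equiv n a false (x, N) (x, 0).
  by move=> xN; apply: rst_sym; apply: rst_step; exact: (@lattice_bottom_top n a false).
have mid x y : x <= N -> y <= N -> lattice_equiv n a false (x, y) (x, y %% N).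
  move=> xN yN; case: (ltnP y N) => yN'.
    by rewrite modn_small //; exact: rst_refl.
  have -> : y = N by lia.
  by rewrite modnn; exact: top.
move=> [x y] /= xN yN; have ym : y %% N < N by rewrite ltn_pmod.
case: (ltnP x N) => xN' /=.
  by rewrite !inordK //; exact: mid.
have fN : flip a N y <= N by rewrite /flip; case: (a); lia.
rewrite inordK; last by rewrite ltn_pmod.
apply: rst_trans (mid _ _ (leq0n N) fN); apply: rst_sym; apply: rst_step.
have -> : x = N by lia.
have := @lattice_left_right n a false _ fN.
by rewrite {2}/flip {2}/flip; case: (a); rewrite // subKn.
Qed.

From mathcomp Require Import all_classical all_reals all_analysis.

(** * Functions on the glued square *)

Import Order.TTheory GRing.Theory Num.Theory.
Import numFieldNormedType.Exports.
Local Open Scope classical_set_scope.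
Local Open Scope ring_scope.

Section Surface.
Variables (R : realType) (a b : bool).
Local Notation S := (glued_square R a b).
Local Notation square := (unit_square R).

(** A representative in the square of a point of the surface. It is not a
    continuous choice, but composing it with a continuous function that is
    invariant under the glueing gives a continuous function. *)
Definition unglue (x : S) : R * R := \val (repr x).

Lemma square_bounds (p : R * R) : square p <->
  [/\ 0 <= p.1, p.1 <= 1, 0 <= p.2 & p.2 <= 1].
Proof.
rewrite /unit_square /= !in_itv /=; split.
  by case=> /andP[? ?] /andP[? ?].
by case=> ? ? ? ?; split; apply/andP.
Qed.

Lemma unglue_square (x : S) : square (unglue x).
Proof. exact: set_valP. Qed.

Lemma unglue_equiv (p : square) :
  clos_refl_sym_trans square (fun p q => side_glue a b (val p) (val q))
    (repr (\pi_S p)%qT) p.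
Proof.
pose Q : eqQuotType (glue_equiv R a b) := {eq_quot (glue_equiv R a b)}%qT.
have /(@eqquotP _ _ Q) : (\pi_Q (repr (\pi_Q p)) = \pi_Q p)%qT by exact: reprK.
by move/asboolP.
Qed.

Definition glue_invariant (T : Type) (f : R * R -> T) :=
  forall p q, square p -> square q -> side_glue a b p q -> f p = f q.

Lemma invariant_equiv (T : Type) (f : R * R -> T) (p q : square) :
  glue_invariant f ->
  clos_refl_sym_trans square (fun p q => side_glue a b (val p) (val q)) p q ->
  f (val p) = f (val q).
Proof.
move=> fi; elim=> {p q} [p q pq|//|p q _ -> //|p q s _ -> _ -> //].
by apply: fi => //; exact: set_valP.
Qed.

Lemma invariant_unglue (T : Type) (f : R * R -> T) (p : square) :
  glue_invariant f -> f (unglue (\pi_S p)%qT) = f (val p).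
Proof. by move=> fi; apply: invariant_equiv fi (unglue_equiv p). Qed.

Lemma val_continuous : continuous (val : square -> R * R).
Proof. exact: initial_continuous. Qed.

Lemma unglue_continuous (f : R * R -> R) : continuous f -> glue_invariant f ->
  continuous (f \o unglue).
Proof.
move=> fc fi; apply/quotient_continuous.
have -> : (f \o unglue) \o \pi_S%qT = f \o (val : square -> R * R).
  by apply/funext => p /=; exact: invariant_unglue.
by move=> p; apply: continuous_comp; [exact: val_continuous | exact: fc].
Qed.

Lemma unglue_open (A : set (R * R)) : open A -> glue_invariant A ->
  open [set x : S | A (unglue x)].
Proof.
move=> oA iA; rewrite /open /= /quotient_open.
have -> : \pi_S%qT @^-1` [set x : S | A (unglue x)] = (val : square -> R * R) @^-1` A.
  apply/seteqP; split=> p /=; by rewrite (invariant_unglue p iA).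
apply: open_comp => //; move=> p _; exact: val_continuous.
Qed.

(** * Functions that separate points *)

(** In the centred coordinates s and r the glueings are sign changes on the
    sides, where 1 - s^2 or 1 - r^2 vanishes, so that even functions and
    suitable products are invariant. The seven functions together distinguish
    points that are not glued. *)
Definition separator (i : nat) (p : R * R) : R :=
  let s := 1 - 2 * p.1 in let r := 1 - 2 * p.2 in
  match i with
  | 0%N => 1 - s ^+ 2
  | 1%N => 1 - r ^+ 2
  | 2%N => (1 - s ^+ 2) * s * (if b then r else 1)
  | 3%N => (1 - r ^+ 2) * r * (if a then s else 1)
  | 4%N => (1 - s ^+ 2) * (1 - r ^+ 2) * s
  | 5%N => (1 - s ^+ 2) * (1 - r ^+ 2) * r
  | _ => if a && b then s * r else 0
  end.

Lemma separator_invariant i : glue_invariant (separator i).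
Proof.
move=> p q _ _ [] t; rewrite /separator /=.
  by case: i => [|[|[|[|[|[|i]]]]]]; case: (a); case: (b) => //=; ring.
by case: i => [|[|[|[|[|[|i]]]]]]; case: (a); case: (b) => //=; ring.
Qed.

(** The functions are polynomials in the coordinates. *)
Lemma separator_ind (P : (R * R -> R) -> Prop) :
  (forall c, P (fun=> c)) -> P fst -> P snd ->
  (forall f g, P f -> P g -> P (fun p => f p - g p)) ->
  (forall f g, P f -> P g -> P (fun p => f p * g p)) ->
  forall i, P (separator i).
Proof.
move=> Pc P1 P2 PB PM i.
have gs : P (fun p => 1 - 2 * p.1) by apply: (PB _ _) => //; exact: PM.
have gr : P (fun p => 1 - 2 * p.2) by apply: (PB _ _) => //; exact: PM.
have gX : P (fun p => 1 - (1 - 2 * p.1) ^+ 2) by apply: (PB _ _) => //; exact: PM.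
have gY : P (fun p => 1 - (1 - 2 * p.2) ^+ 2) by apply: (PB _ _) => //; exact: PM.
have gif (f : bool) h : P h -> P (fun p => if f then h p else 1) by case: f.
rewrite /separator; case: i => [|[|[|[|[|[|i]]]]]] //.
- by apply: (PM _ _); [exact: PM | exact: gif].
- by apply: (PM _ _); [exact: PM | exact: gif].
- by apply: (PM _ _) => //; exact: PM.
- by apply: (PM _ _) => //; exact: PM.
- by case: (a && b) => //; exact: PM.
Qed.

Lemma separator_continuous i : continuous (separator i).
Proof.
apply: (separator_ind (P := fun f => continuous f)) => {i}.
- by move=> c p; exact: cvg_cst.
- by move=> p; exact: cvg_fst.
- by move=> p; exact: cvg_snd.
- by move=> f g fc gc p; apply: cvgB; [exact: fc | exact: gc].
- by move=> f g fc gc p; apply: cvgM; [exact: fc | exact: gc].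
Qed.

(** Lipschitz functions on the square; the bound on the values makes the
    property stable under products. *)
Definition good (f : R * R -> R) := exists C : R, forall p q, square p -> square q ->
  `|f p - f q| <= C * (`|p.1 - q.1| + `|p.2 - q.2|) /\ `|f p| <= C.

Lemma good_cst c : good (fun=> c).
Proof.
by exists (`|c|) => p q _ _; rewrite subrr normr0; split; rewrite ?mulr_ge0 ?addr_ge0.
Qed.

Lemma good_fst : good fst.
Proof.
exists 1 => p q /square_bounds[? ? ? ?] _; split; first by rewrite mul1r lerDl.
by rewrite ger0_norm.
Qed.

Lemma good_snd : good snd.
Proof.
exists 1 => p q /square_bounds[? ? ? ?] _; split; first by rewrite mul1r lerDr.
by rewrite ger0_norm.
Qed.

Lemma goodB f g : good f -> good g -> good (fun p => f p - g p).
Proof.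
move=> [C Cf] [D Dg]; exists (C + D) => p q sp sq.
have [f1 f2] := Cf p q sp sq; have [g1 g2] := Dg p q sp sq; split.
  have -> : f p - g p - (f q - g q) = (f p - f q) - (g p - g q) by ring.
  by rewrite mulrDl (le_trans (ler_normB _ _)) // lerD.
by rewrite (le_trans (ler_normB _ _)) // lerD.
Qed.

Lemma goodM f g : good f -> good g -> good (fun p => f p * g p).
Proof.
move=> [C Cf] [D Dg]; exists (2 * C * D) => p q sp sq.
have [f1 f2] := Cf p q sp sq; have [g1 g2] := Dg p q sp sq.
have [_ f2'] := Cf q p sq sp.
set d := `|_| + `|_| in f1 g1 *; have d0 : 0 <= d by rewrite addr_ge0.
have C0 : 0 <= C := le_trans (normr_ge0 _) f2.
have D0 : 0 <= D := le_trans (normr_ge0 _) g2.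
split.
  have -> : f p * g p - f q * g q = (f p - f q) * g p + f q * (g p - g q) by ring.
  rewrite (le_trans (ler_normD _ _)) // !normrM.
  have := ler_pM (normr_ge0 _) (normr_ge0 _) f1 g2.
  have := ler_pM (normr_ge0 _) (normr_ge0 _) f2' g1.
  set A := `|f p - f q| * _; set B := `|f q| * _ => h1 h2.
  have -> : 2 * C * D * d = C * d * D + C * (D * d) by ring.
  exact: lerD.
rewrite normrM; have := ler_pM (normr_ge0 _) (normr_ge0 _) f2 g2.
by move=> h; apply: le_trans h _; have := mulr_ge0 C0 D0; lra.
Qed.

Lemma separator_good i : good (separator i).
Proof.
apply: separator_ind; [exact: good_cst | exact: good_fst | exact: good_snd | |].
  exact: goodB.
exact: goodM.
Qed.

(** A substitute for a metric on the surface: it is continuous, is controlled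
    by the distance in the square, does not distinguish glued points, and
    vanishes on no other pairs. *)
Definition sep_dist (p q : R * R) : R :=
  \sum_(i < 7) `|separator i p - separator i q|.

Lemma sep_dist_lipschitz : exists2 C : R, 0 <= C & forall p q, square p -> square q ->
  sep_dist p q <= C * (`|p.1 - q.1| + `|p.2 - q.2|).
Proof.
have [C CP] : exists C : 'I_7 -> R, forall (i : 'I_7) p q, square p -> square q ->
    `|separator i p - separator i q| <= C i * (`|p.1 - q.1| + `|p.2 - q.2|).
  apply: (@fin_all_exists 'I_7 (fun=> R) (fun (i : 'I_7) C => forall p q, square p ->
    square q -> `|separator i p - separator i q| <= C * (`|p.1 - q.1| + `|p.2 - q.2|))).
  by move=> i; have [C CP] := separator_good i; exists C => p q sp sq; have [] := CP p q sp sq.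
exists (\sum_i `|C i|); first exact: sumr_ge0.
move=> p q sp sq; rewrite mulr_suml; apply: ler_sum => i _.
apply: le_trans (CP i p q sp sq) _; rewrite ler_wpM2r ?addr_ge0 //.
exact: ler_norm.
Qed.

Lemma sep_dist_triangle p q s : sep_dist p s <= sep_dist p q + sep_dist q s.
Proof.
by rewrite -big_split; apply: ler_sum => i _; exact: ler_distD.
Qed.

Lemma sep_dist_sym p q : sep_dist p q = sep_dist q p.
Proof. by apply: eq_bigr => i _; exact: distrC. Qed.

Lemma sep_dist0 p q : sep_dist p q = 0 -> forall i, (i < 7)%N ->
  separator i p = separator i q.
Proof.
move=> /eqP; rewrite psumr_eq0 => [/allP H i i7|i _]; last exact: normr_ge0.
have := H (Ordinal i7) (mem_index_enum _).
by rewrite /= normr_eq0 subr_eq0 => /eqP.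
Qed.

(** * Stars of corners and cells near a set *)

Section Cells.
Variables (n : nat) (W : finType) (kap : nat * nat -> W).
Local Notation N := n.+1.
Local Notation cell := ('I_N * 'I_N)%type.

Definition node (m : nat * nat) : R * R := (m.1%:R / N%:R, m.2%:R / N%:R).

Lemma flip_natr (f : bool) (y : nat) : (y <= N)%N ->
  (flip f N y)%:R / N%:R = (if f then 1 - y%:R / N%:R else y%:R / N%:R) :> R.
Proof.
by move=> yN; rewrite /flip; case: f => //; rewrite natrB // mulrBl divff ?pnatr_eq0.
Qed.

Lemma node_square m : (m.1 <= N)%N -> (m.2 <= N)%N -> square (node m).
Proof.
move=> m1 m2; apply/square_bounds; rewrite /node /=.
by split; rewrite ?divr_ge0 // ler_pdivrMr ?ltr0n // mul1r ler_nat.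
Qed.

Lemma node_invariant (T : Type) (f : R * R -> T) m m' : glue_invariant f ->
  lattice_equiv n a b m m' -> f (node m) = f (node m').
Proof.
move=> fi; elim=> {m m'} [m m' mm'|//|m m' _ -> //|m m' m'' _ -> _ -> //].
apply: fi.
- by apply: node_square; case: mm' => ? ?.
- apply: node_square; case: mm' => z zN //=; rewrite /flip; case: ifP => //; lia.
case: mm' => z zN; rewrite /node /= mul0r divff ?pnatr_eq0 // flip_natr //.
  exact: glue_left_right.
exact: glue_bottom_top.
Qed.

(** The open star of a lattice point: the interior of the union of the cells
    around it, in coordinates scaled by N. *)
Definition star_at (m : nat * nat) (q : R * R) :=
  `|q.1 * N%:R - m.1%:R| < 1 /\ `|q.2 * N%:R - m.2%:R| < 1.

Definition star (w : W) : set (R * R) := [set q | exists m,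
  [/\ (m.1 <= N)%N, (m.2 <= N)%N, kap m = w & star_at m q]].

Lemma star_open w : open (star w).
Proof.
have -> : star w = \bigcup_(m in [set m | [/\ (m.1 <= N)%N, (m.2 <= N)%N & kap m = w]])
    [set q | star_at m q].
  apply/seteqP; split=> q /=; first by case=> m [m1 m2 mw mq]; exists m.
  by case=> m [m1 m2 mw] mq; exists m.
apply: bigcup_open => m _.
have opn (f : R * R -> R) (k : nat) : continuous f ->
    open [set q | `|f q * N%:R - k%:R| < 1].
  move=> fc; apply: (@open_comp _ _ (fun q => `|f q * N%:R - k%:R|) [set x | x < 1]).
    move=> q _; apply: cvg_norm; apply: cvgB; last exact: cvg_cst.
    by apply: cvgM; [exact: fc | exact: cvg_cst].
  exact: open_lt.
by apply: openI; apply: opn => q; [exact: cvg_fst | exact: cvg_snd].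
Qed.

Lemma flipK (f : bool) y : (y <= N)%N -> flip f N (flip f N y) = y.
Proof. by rewrite /flip; case: f => // ?; rewrite subKn. Qed.

Lemma flip_le (f : bool) y : (y <= N)%N -> (flip f N y <= N)%N.
Proof. by rewrite /flip; case: f => // ?; rewrite leq_subr. Qed.

Lemma flip_dist (f : bool) y (t : R) : (y <= N)%N ->
  `|(if f then 1 - t else t) * N%:R - (flip f N y)%:R| = `|t * N%:R - y%:R|.
Proof.
move=> yN; rewrite /flip; case: f => //; rewrite natrB // -normrN.
by congr `|_|; ring.
Qed.

Lemma star0 (k : nat) : `|0 * N%:R - k%:R| < 1 :> R -> k = 0%N.
Proof. by rewrite mul0r sub0r normrN normr_nat -[1]/(1%:R) ltr_nat; case: k. Qed.

Lemma starN (k : nat) : (k <= N)%N -> `|1 * N%:R - k%:R| < 1 :> R -> k = N.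
Proof.
by move=> kN; rewrite mul1r -natrB // normr_nat -[1]/(1%:R) ltr_nat; lia.
Qed.

Definition in_cell (q : R * R) (c : cell) :=
  [/\ (c.1 : nat)%:R <= q.1 * N%:R, q.1 * N%:R <= c.1.+1%:R,
      (c.2 : nat)%:R <= q.2 * N%:R & q.2 * N%:R <= c.2.+1%:R].

Lemma ex_coordinate (t : R) : 0 <= t -> t <= 1 ->
  exists i : 'I_N, (i : nat)%:R <= t * N%:R /\ t * N%:R <= i.+1%:R.
Proof.
move=> t0 t1; have tN0 : 0 <= t * N%:R by rewrite mulr_ge0.
have tN : t * N%:R <= N%:R by rewrite ler_piMl.
have /andP[k1 k2] := truncn_itv tN0; set k := Num.truncn _ in k1 k2.
have kN : (k <= N)%N by rewrite -(ler_nat R) (le_trans k1).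
case: (ltnP k N) => kN'; first by exists (Ordinal kN'); split=> //; exact: ltW.
have kE : k = N by lia.
exists ord_max; split=> //; rewrite (le_trans _ k1) // kE ler_nat; exact: leqnSn.
Qed.

Lemma ex_cell (q : R * R) : square q -> exists c, in_cell q c.
Proof.
move=> /square_bounds[q1 q2 q3 q4].
have [i [i1 i2]] := ex_coordinate q1 q2; have [j [j1 j2]] := ex_coordinate q3 q4.
by exists (i, j).
Qed.

(** A cell that contains x; on a common side one of the cells is chosen. *)
Definition cell_of (x : S) : cell := projT1 (cid (ex_cell (unglue_square x))).

Lemma cell_ofP x : in_cell (unglue x) (cell_of x).
Proof. by rewrite /cell_of; case: cid. Qed.

Lemma nat_close (i m : nat) (t : R) : i%:R <= t -> t <= i.+1%:R -> `|t - m%:R| < 1 ->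
  (i <= m <= i.+1)%N.
Proof.
rewrite ltr_norml => i1 i2 /andP[m1 m2].
rewrite -[(i <= m)%N]ltnS -[(m <= _)%N]ltnS -!(ltr_nat R) -!natr1.
by rewrite -natr1 in i2; apply/andP; split; lra.
Qed.

Lemma corner_of_star q c m : in_cell q c -> star_at m q -> corner_of m c.
Proof.
case=> c1 c2 c3 c4 [m1 m2]; rewrite /corner_of.
have /andP[-> ->] := nat_close c1 c2 m1.
by have /andP[-> ->] := nat_close c3 c4 m2.
Qed.

Hypothesis kapP : corner_class n a b kap.

(** A point of a side that lies in the star of a lattice point is glued to a
    point in the star of the glued lattice point. *)
Lemma star_invariant w : glue_invariant (star w).
Proof.
have [glue _ _] := kapP; move=> p q _ _ [] t; apply/propext; split.
- case=> -[x y] [/= x1 y1 mw [/star0 x0 yt]]; rewrite /= in x0 yt; rewrite x0 in mw.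
  exists (N, flip a N y); split=> //=; first exact: flip_le.
    by rewrite -mw; apply/esym/glue; exact: lattice_left_right.
  by split; rewrite /= ?mul1r ?subrr ?normr0 // flip_dist.
- case=> -[x y] [/= x1 y1 mw [/(starN x1) x0 yt]]; rewrite /= in yt; rewrite x0 in mw.
  exists (0%N, flip a N y); split=> //=; first exact: flip_le.
    rewrite -mw -{2}(flipK a y1); apply: glue; apply: lattice_left_right.
    exact: flip_le.
  split; rewrite /= ?mul0r ?subrr ?normr0 //.
  by rewrite -(flip_dist a t (flip_le a y1)) flipK.
- case=> -[x y] [/= x1 y1 mw [xt /star0 y0]]; rewrite /= in y0 xt; rewrite y0 in mw.
  exists (flip b N x, N); split=> //=; first exact: flip_le.
    by rewrite -mw; apply/esym/glue; exact: lattice_bottom_top.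
  by split; rewrite /= ?mul1r ?subrr ?normr0 // flip_dist.
- case=> -[x y] [/= x1 y1 mw [xt /(starN y1) y0]]; rewrite /= in xt; rewrite y0 in mw.
  exists (flip b N x, 0%N); split=> //=; first exact: flip_le.
    rewrite -mw -{2}(flipK b x1); apply: glue; apply: lattice_bottom_top.
    exact: flip_le.
  split; rewrite /= ?mul0r ?subrr ?normr0 //.
  by rewrite -(flip_dist b t (flip_le b x1)) flipK.
Qed.

Lemma ex_star q : square q -> exists w, star w q.
Proof.
move=> /square_bounds[q1 q2 q3 q4].
have H (t : R) : 0 <= t -> t <= 1 -> exists k : nat, (k <= N)%N /\ `|t * N%:R - k%:R| < 1.
  move=> t0 t1; have [i [i1 i2]] := ex_coordinate t0 t1.
  have iN := ltn_ord i; case: (ltrP (t * N%:R) i.+1%:R) => lt.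
    exists i; split; first exact: ltnW.
    by rewrite ltr_norml -natr1 in lt *; lra.
  exists i.+1; split=> //; have -> : t * N%:R = i.+1%:R by apply/eqP; rewrite eq_le i2.
  by rewrite subrr normr0.
have [k [kN k1]] := H _ q1 q2; have [k' [kN' k1']] := H _ q3 q4.
by exists (kap (k, k')), (k, k').
Qed.

(** The cells at the corners whose open stars meet K. These cells include
    those that K passes through, and they behave well for connected sets
    because open stars form an open cover. *)
Definition near_cells (K : set S) (c : cell) : bool :=
  `[< exists x w, [/\ K x, star w (unglue x) & has_corner kap w c] >].

Lemma star_has_corner x w : star w (unglue x) -> has_corner kap w (cell_of x).
Proof.
case=> m [m1 m2 <- mx]; apply/has_cornerP; exists m => //.
exact: corner_of_star (cell_ofP x) mx.
Qed.

Lemma near_cell_of K x : K x -> near_cells K (cell_of x).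
Proof.
move=> Kx; have [w sx] := ex_star (unglue_square x).
by apply/asboolP; exists x, w; split=> //; exact: star_has_corner.
Qed.

Definition near_link (K : set S) : rel cell :=
  link (@gc1 n) (@gc2 n a b) (fun h => near_cells K (gc1 h) && near_cells K (gc2 a b h)).

Lemma star_near_connected K x w c c' : K x -> star w (unglue x) ->
  has_corner kap w c -> has_corner kap w c' -> connect (near_link K) c c'.
Proof.
move=> Kx sx wc wc'; have := star_connected kapP wc wc'.
apply: connect_sub => d d' /existsP[h /andP[/andP[h1 h2] hd]].
apply/connect1/existsP; exists h; rewrite hd andbT.
by apply/andP; split; apply/asboolP; exists x, w.
Qed.

(** Open stars cover the surface. If K meets the star of a corner, all cells
    at this corner are near and connected, so the points of K whose cells are
    reachable from c form an open and closed subset of K. *)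
Lemma near_connected K c c' : connected K -> near_cells K c -> near_cells K c' ->
  connect (near_link K) c c'.
Proof.
move=> cK /asboolP[x [w [Kx sx wc]]] /asboolP[x' [w' [Kx' sx' wc']]].
(* By step below, an open star that contains a point of P in K consists of
   points of P only. *)
pose P := [set y | connect (near_link K) c (cell_of y)].
have Px : P x by exact: star_near_connected Kx sx wc (star_has_corner sx).
have sym : connect_sym (near_link K) by exact: link_sym.
have step y y' v : K y -> star v (unglue y) -> star v (unglue y') -> P y -> P y'.
  move=> Ky sy sy'; move/connect_trans; apply.
  exact: star_near_connected Ky sy (star_has_corner sy) (star_has_corner sy').
have osw v : open [set y : S | star v (unglue y)].
  exact: unglue_open (@star_open v) (@star_invariant v).
suff E0 : K `&` P = K.
  have [_ Px'] : (K `&` P) x' by rewrite E0.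
  apply: connect_trans Px' _.
  exact: star_near_connected Kx' sx' (star_has_corner sx') wc'.
have oU (Q : set S) : open (\bigcup_(v in [set v | exists y, [/\ K y, Q y & star v (unglue y)]])
    [set y : S | star v (unglue y)]).
  by apply: bigcup_open => v _; exact: osw.
apply: cK; first by exists x.
- exists (\bigcup_(v in [set v | exists y, [/\ K y, P y & star v (unglue y)]])
    [set y : S | star v (unglue y)]) => //.
  apply/seteqP; split=> y [Ky Py]; split=> //.
    by have [v sy] := ex_star (unglue_square y); exists v => //; exists y.
  by have [v [z [Kz Pz sz]] sy] := Py; exact: step Kz sz sy Pz.
- exists (~` \bigcup_(v in [set v | exists y, [/\ K y, ~ P y & star v (unglue y)]])
    [set y : S | star v (unglue y)]); first exact: open_closedC.
  apply/seteqP; split=> y [Ky Py]; split=> //.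
    by case=> v [z [Kz nPz sz]] /= sy; apply: nPz; exact: step Ky sy sz Py.
  apply: contrapT => nPy; apply: Py.
  by have [v sy] := ex_star (unglue_square y); exists v => //; exists y.
Qed.

End Cells.

(** * The separating functions determine the point *)

(** The projection to the surface as a function of two real coordinates; an
    option type gives it a value outside the square. *)
Definition glue_class (p : R * R) : option S :=
  if pselect (square p) is left sp then
    Some (\pi_S (exist (fun p => p \in square) p (mem_set sp) : square))%qT
  else None.

Lemma glue_class_invariant : glue_invariant glue_class.
Proof.
move=> p q sp sq pq; rewrite /glue_class.
case: pselect => // sp'; case: pselect => // sq'; congr Some.
pose Q : eqQuotType (glue_equiv R a b) := {eq_quot (glue_equiv R a b)}%qT.
by apply/(@eqquotP _ _ Q)/asboolP; exact: rst_step.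
Qed.

Lemma glue_class_unglue x : glue_class (unglue x) = Some x.
Proof.
rewrite /glue_class; case: pselect => [sx|[]]; last exact: unglue_square.
congr Some; rewrite -[RHS]reprK; congr (\pi_S _)%qT; exact: val_inj.
Qed.

Lemma glue_class_left_right t : 0 <= t <= 1 ->
  glue_class (0, t) = glue_class (1, if a then 1 - t else t).
Proof.
case/andP=> t0 t1; apply: glue_class_invariant.
- by apply/square_bounds; split=> //=.
- by apply/square_bounds; split=> //=; case: (a) => //=; lra.
- exact: glue_left_right.
Qed.

Lemma glue_class_bottom_top t : 0 <= t <= 1 ->
  glue_class (t, 0) = glue_class (if b then 1 - t else t, 1).
Proof.
case/andP=> t0 t1; apply: glue_class_invariant.
- by apply/square_bounds; split=> //=.
- by apply/square_bounds; split=> //=; case: (b) => //=; lra.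
- exact: glue_bottom_top.
Qed.

Hypothesis ba : b ==> a.

(** The first two functions determine the coordinates up to reflection. In the
    interior of the square the functions 4 and 5, counted from 0, determine
    the signs; on a side the functions 2 and 3 determine the remaining
    coordinate compatibly with the glueing, and at the vertices of the square
    the last function decides between the two classes of the projective plane.
    *)
Lemma separated (x y : S) : sep_dist (unglue x) (unglue y) = 0 -> x = y.
Proof.
move=> /sep_dist0 H; suff : glue_class (unglue x) = glue_class (unglue y).
  by rewrite !glue_class_unglue => -[].
have /square_bounds := unglue_square x; have /square_bounds := unglue_square y.
have := (H 0 isT, H 1 isT, H 2 isT, H 3 isT, H 4 isT, H 5 isT, H 6 isT)%N.
case: (unglue x) (unglue y) => {H}{}x z [{}y w].
rewrite /separator /= => -[[[[[[e0 e1] e2] e3] e4] e5] e6].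
move=> [y0 y1 w0 w1] [x0 x1 z0 z1].
have LRt t : a -> 0 <= t <= 1 -> glue_class (0, t) = glue_class (1, 1 - t).
  by move=> aT /glue_class_left_right ->; congr (glue_class (_, _)); rewrite aT.
have LRf t : ~~ a -> 0 <= t <= 1 -> glue_class (0, t) = glue_class (1, t).
  by move=> /negPf aF /glue_class_left_right ->; congr (glue_class (_, _)); rewrite aF.
have BTt t : b -> 0 <= t <= 1 -> glue_class (t, 0) = glue_class (1 - t, 1).
  by move=> bT /glue_class_bottom_top ->; congr (glue_class (_, _)); rewrite bT.
have BTf t : ~~ b -> 0 <= t <= 1 -> glue_class (t, 0) = glue_class (t, 1).
  by move=> /negPf bF /glue_class_bottom_top ->; congr (glue_class (_, _)); rewrite bF.
have aC : a \/ ~~ a by case: (a); [left|right].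
have bC : b \/ ~~ b by case: (b); [left|right].
have refl_or (u v : R) : 1 - (1 - 2 * u) ^+ 2 = 1 - (1 - 2 * v) ^+ 2 ->
    v = u \/ v = 1 - u.
  move=> E0; have : (v - u) * (v - (1 - u)) = 0 by lra.
  by move/eqP; rewrite mulf_eq0 !subr_eq0 => /orP[/eqP|/eqP]; [left|right].
have inner (u : R) : u != 0 -> u != 1 -> 1 - (1 - 2 * u) ^+ 2 != 0.
  move=> u0 u1; have -> : 1 - (1 - 2 * u) ^+ 2 = 4 * u * (1 - u) by ring.
  by rewrite !mulf_neq0 ?subr_eq0 // 1?eq_sym ?pnatr_eq0.
have inv (u v : R) : 1 - 2 * u = 1 - 2 * v -> u = v by lra.
have yx := refl_or _ _ e0; have wz := refl_or _ _ e1.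
have side (u v : R) : (u == 0) || (u == 1) -> v = u \/ v = 1 - u ->
    (u = 0 /\ v = 0) \/ (u = 0 /\ v = 1) \/ (u = 1 /\ v = 0) \/ (u = 1 /\ v = 1).
  by case/orP=> /eqP -> [] ->; rewrite ?subr0 ?subrr; tauto.
case: (boolP ((x == 0) || (x == 1))) => xi.
  case: (boolP ((z == 0) || (z == 1))) => zi.
    have t0 : 0 <= (0 : R) <= 1 by rewrite lexx ler01.
    have t1 : 0 <= (1 : R) <= 1 by rewrite lexx ler01.
    have [bT|bF] := bC.
      have aT : a := implyP ba bT.
      have := LRt _ aT t0; have := LRt _ aT t1.
      have := BTt _ bT t0; have := BTt _ bT t1.
      rewrite !subr0 !subrr => _ _ l1 l0; rewrite aT bT /= in e6.
      have s0 : 1 - 2 * 0 = 1 :> R by ring.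
      have s1 : 1 - 2 * 1 = -1 :> R by ring.
      have N1 : (1 : R) <> -1 by lra.
      have [[xE yE]|[[xE yE]|[[xE yE]|[xE yE]]]] := side _ _ xi yx;
      have [[zE wE]|[[zE wE]|[[zE wE]|[zE wE]]]] := side _ _ zi wz;
      rewrite xE yE zE wE ?s0 ?s1 ?mulrNN ?mulr1 ?mul1r in e6 *;
      rewrite ?l0 ?l1 //; by [case: N1 | case: N1; rewrite -e6].
    have b0 := BTf _ bF t0; have b1 := BTf _ bF t1.
    have l0 : glue_class (0, 0) = glue_class (1, 1).
      have [aT|aF] := aC; first by rewrite LRt // subr0.
      by rewrite LRf.
    have [[xE yE]|[[xE yE]|[[xE yE]|[xE yE]]]] := side _ _ xi yx;
    have [[zE wE]|[[zE wE]|[[zE wE]|[zE wE]]]] := side _ _ zi wz;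
    by rewrite xE yE zE wE -?b0 ?l0 ?b1.
  have nz : z != 0 by apply: contraNneq zi => ->; rewrite eqxx.
  have nz' : z != 1 by apply: contraNneq zi => ->; rewrite eqxx orbT.
  have : (1 - (1 - 2 * z) ^+ 2) * ((1 - 2 * z) * (if a then 1 - 2 * x else 1)) =
         (1 - (1 - 2 * z) ^+ 2) * ((1 - 2 * w) * (if a then 1 - 2 * y else 1)).
    by rewrite mulrA e3 [in RHS]e1 mulrA.
  move/(mulfI (inner _ nz nz')) => {e0 e1 e2 e3 e4 e5 e6} rs.
  have tz : 0 <= z <= 1 by rewrite z0 z1.
  have tw : 0 <= w <= 1 by rewrite w0 w1.
  have [aT|aF] := aC; [have lz := LRt _ aT tz; have lw := LRt _ aT tw;
    rewrite aT in rs | have lz := LRf _ aF tz; have lw := LRf _ aF tw;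
    rewrite (negPf aF) in rs];
  have [[xE yE]|[[xE yE]|[[xE yE]|[xE yE]]]] := side _ _ xi yx;
    rewrite xE yE in rs *.
  - by have -> : w = z by lra.
  - by rewrite lz; congr (glue_class (_, _)); lra.
  - by rewrite lw; congr (glue_class (_, _)); lra.
  - by have -> : w = z by lra.
  - by have -> : w = z by lra.
  - by rewrite lz; congr (glue_class (_, _)); lra.
  - by rewrite lw; congr (glue_class (_, _)); lra.
  - by have -> : w = z by lra.
have nx : x != 0 by apply: contraNneq xi => ->; rewrite eqxx.
have nx' : x != 1 by apply: contraNneq xi => ->; rewrite eqxx orbT.
have iX := inner _ nx nx'.
case: (boolP ((z == 0) || (z == 1))) => zi.
  have : (1 - (1 - 2 * x) ^+ 2) * ((1 - 2 * x) * (if b then 1 - 2 * z else 1)) =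
         (1 - (1 - 2 * x) ^+ 2) * ((1 - 2 * y) * (if b then 1 - 2 * w else 1)).
    by rewrite mulrA e2 [in RHS]e0 mulrA.
  move/(mulfI iX) => {e0 e1 e2 e3 e4 e5 e6} rs.
  have tx : 0 <= x <= 1 by rewrite x0 x1.
  have ty : 0 <= y <= 1 by rewrite y0 y1.
  have [bT|bF] := bC; [have bx := BTt _ bT tx; have bY := BTt _ bT ty;
    rewrite bT in rs | have bx := BTf _ bF tx; have bY := BTf _ bF ty;
    rewrite (negPf bF) in rs];
  have [[zE wE]|[[zE wE]|[[zE wE]|[zE wE]]]] := side _ _ zi wz;
    rewrite zE wE in rs *.
  - by have -> : y = x by lra.
  - by rewrite bx; congr (glue_class (_, _)); lra.
  - by rewrite bY; congr (glue_class (_, _)); lra.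
  - by have -> : y = x by lra.
  - by have -> : y = x by lra.
  - by rewrite bx; congr (glue_class (_, _)); lra.
  - by rewrite bY; congr (glue_class (_, _)); lra.
  - by have -> : y = x by lra.
have nz : z != 0 by apply: contraNneq zi => ->; rewrite eqxx.
have nz' : z != 1 by apply: contraNneq zi => ->; rewrite eqxx orbT.
have iXY := mulf_neq0 iX (inner _ nz nz').
rewrite -e0 -e1 in e4 e5.
by rewrite (inv _ _ (mulfI iXY e4)) (inv _ _ (mulfI iXY e5)).
Qed.

(** * Disjoint compact sets have no common near cell *)

Lemma continuous_bigsum (T : topologicalType) (k : nat) (g : nat -> T -> R) :
  (forall i, continuous (g i)) -> continuous (fun x => \sum_(i < k) g i x).
Proof.
move=> gc; elim: k => [|k IHk].
  by under eq_fun do rewrite big_ord0; move=> x; exact: cvg_cst.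
under eq_fun do rewrite big_ord_recr /=.
by move=> x; apply: cvgD; [exact: IHk | exact: gc].
Qed.

Lemma unglue_dist_continuous :
  continuous (fun xy : S * S => sep_dist (unglue xy.1) (unglue xy.2)).
Proof.
apply: (@continuous_bigsum (S * S)%type 7 (fun i xy =>
  `|separator i (unglue xy.1) - separator i (unglue xy.2)|)) => i xy.
have fc := unglue_continuous (@separator_continuous i) (@separator_invariant i).
by apply: cvg_norm; apply: cvgB;
  [apply: (@continuous_comp _ _ _ fst (separator i \o unglue)) |
   apply: (@continuous_comp _ _ _ snd (separator i \o unglue))];
  [exact: cvg_fst | exact: fc | exact: cvg_snd | exact: fc].
Qed.

(** The distance of the separating functions is continuous and positive on a
    compact product, so it has a positive minimum. *)
Lemma compact_separated (K K' : set S) : compact K -> compact K' ->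
  K `&` K' = set0 -> K !=set0 -> K' !=set0 ->
  exists2 e : R, 0 < e & forall x y, K x -> K' y -> e <= sep_dist (unglue x) (unglue y).
Proof.
move=> cK cK' KK' [x0 Kx0] [y0 Ky0].
have K0 : K `*` K' !=set0 by exists (x0, y0).
have cf : {within K `*` K', continuous
    (fun xy : S * S => sep_dist (unglue xy.1) (unglue xy.2))}.
  exact: continuous_subspaceT unglue_dist_continuous.
have [[x y] /set_mem[/= Kx Ky] min] := compact_EVT_min K0 (compact_setX cK cK') cf.
exists (sep_dist (unglue x) (unglue y)); last first.
  by move=> u v Ku Kv; apply: (min (u, v)); exact: mem_set.
rewrite lt_neqAle sumr_ge0 // andbT eq_sym; apply/eqP => /separated xy.
have : (K `&` K') x by split; rewrite // xy.
by rewrite KK'.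
Qed.

(** A common near cell gives points of the two sets that are joined by three
    short steps in the square and by glueings, so their separating distance is
    at most 6 C / N. *)
Lemma near_disjoint (K K' : set S) : compact K -> compact K' ->
  K `&` K' = set0 ->
  exists n0, forall n, (n0 <= n)%N -> forall (W : finType) (kap : nat * nat -> W),
    corner_class n a b kap ->
    forall c, near_cells (n := n) kap K c -> near_cells kap K' c -> False.
Proof.
move=> cK cK' KK'.
case: (pselect (K !=set0)) => [K0|K0]; last first.
  by exists 0%N => n _ W kap _ c /asboolP[x [w [Kx _ _]]]; case: K0; exists x.
case: (pselect (K' !=set0)) => [K0'|K0']; last first.
  by exists 0%N => n _ W kap _ c _ /asboolP[x [w [Kx _ _]]]; case: K0'; exists x.
have [e e0 eP] := compact_separated cK cK' KK' K0 K0'.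
have [C C0 CP] := sep_dist_lipschitz.
exists (Num.truncn (6 * C / e)).+1 => n n0 W kap kapP c.
move=> /asboolP[x [w [Kx [m [m1 m2 mw mx]] /has_cornerP[p pw pc]]]].
move=> /asboolP[y [v [Ky [k [k1 k2 kv ky]] /has_cornerP[q qv qc]]]].
have [_ _ classes] := kapP.
have bound r : corner_of r c -> (r.1 <= n.+1)%N /\ (r.2 <= n.+1)%N.
  by move=> /and4P[_ r1 _ r2]; have := ltn_ord c.1; have := ltn_ord c.2; lia.
have [p1 p2] := bound p pc; have [q1 q2] := bound q qc.
pose N : R := n.+1%:R; have N0 : 0 < N by rewrite ltr0n.
(* Each of the three steps x to m, p to q, k to y changes both coordinates by
   at most 1 / N, whereas m and p, and likewise q and k, are glued. *)
have close u u' : square u -> square u' -> `|u.1 * N - u'.1 * N| <= 1 ->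
    `|u.2 * N - u'.2 * N| <= 1 -> sep_dist u u' <= 2 * C / N.
  move=> su su'; rewrite -!mulrBl !normrM (gtr0_norm N0) -!ler_pdivlMr // => h1 h2.
  apply: le_trans (CP _ _ su su') _.
  have -> : 2 * C / N = C * (1 / N + 1 / N) by ring.
  by rewrite ler_wpM2l // lerD.
have nodeN (r : nat * nat) : (node n r).1 * N = r.1%:R /\ (node n r).2 * N = r.2%:R.
  by rewrite /node /= !mulfVK ?gt_eqF.
have glued r r' : (r.1 <= n.+1)%N -> (r.2 <= n.+1)%N -> (r'.1 <= n.+1)%N ->
    (r'.2 <= n.+1)%N -> kap r = kap r' -> sep_dist (node n r) (node n r') = 0.
  move=> r1 r2 r3 r4 /classes -/(_ r1 r2 r3 r4) rr'; apply: big1 => i _.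
  by rewrite (node_invariant (@separator_invariant i) rr') subrr normr0.
have d1 : sep_dist (unglue x) (node n m) <= 2 * C / N.
  apply: close; [exact: unglue_square | exact: node_square | |];
  by rewrite ?(nodeN m).1 ?(nodeN m).2; have [? ?] := mx; apply: ltW.
have d2 : sep_dist (unglue y) (node n k) <= 2 * C / N.
  apply: close; [exact: unglue_square | exact: node_square | |];
  by rewrite ?(nodeN k).1 ?(nodeN k).2; have [? ?] := ky; apply: ltW.
have d3 : sep_dist (node n p) (node n q) <= 2 * C / N.
  have near1 (i s t : nat) : (i <= s <= i.+1)%N -> (i <= t <= i.+1)%N ->
      `|s%:R - t%:R| <= 1 :> R.
    move=> /andP[u1 u2] /andP[t1 t2]; rewrite ler_norml.
    rewrite -!(ler_nat R) -?natr1 in u1 u2 t1 t2; apply/andP; split; lra.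
  move: pc qc => /and4P[c1 c2 c3 c4] /and4P[c5 c6 c7 c8].
  apply: close; [exact: node_square | exact: node_square | |];
  rewrite ?(nodeN p).1 ?(nodeN q).1 ?(nodeN p).2 ?(nodeN q).2.
    by apply: (near1 c.1); rewrite ?c1 ?c5.
  by apply: (near1 c.2); rewrite ?c3 ?c7.
have := eP _ _ Kx Ky; apply/negP; rewrite -ltNge.
have t1 := sep_dist_triangle (unglue x) (node n m) (unglue y).
have t2 := sep_dist_triangle (node n m) (node n p) (unglue y).
have t3 := sep_dist_triangle (node n p) (node n q) (unglue y).
have t4 := sep_dist_triangle (node n q) (node n k) (unglue y).
have g1 := glued m p m1 m2 p1 p2 (etrans mw (esym pw)).
have g2 := glued q k q1 q2 k1 k2 (etrans qv (esym kv)).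
rewrite (sep_dist_sym (node n k)) in t4.
have big : 6 * C / e < N.
  apply: lt_trans (truncnS_gt _) _; rewrite ltr_nat ltnS; exact: n0.
have : 6 * C / N < e by rewrite ltr_pdivrMr // (mulrC e) -ltr_pdivrMr.
have -> : 6 * C / N = 2 * C / N + 2 * C / N + 2 * C / N by ring.
rewrite g1 in t2; rewrite g2 in t4.
have arith (u A1 A2 A3 B1 B2 B3 A : R) : u <= A1 + B1 -> B1 <= 0 + B2 ->
    B2 <= A2 + B3 -> B3 <= 0 + A3 -> A1 <= A -> A2 <= A -> A3 <= A ->
    A + A + A < e -> u < e.
  by clear; lra.
exact: arith t1 t2 t3 t4 d1 d3 d2.
Qed.

End Surface.

(** * A minor model of the embedded graph *)

Section Model.
Variables (R : realType) (G : sgraph) (a b : bool) (ba : b ==> a).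
Local Notation S := (glued_square R a b).
Variable emb : embedding R G S.
Local Notation arc := (arc_of emb).
Local Notation point := (point_of emb).

Lemma edge_card (A : edge G) : #|val A| = 2%N.
Proof.
have /imsetP[[x y]] := valP A; rewrite inE /= => xy ->.
by rewrite cards2; case: eqP xy => // ->; rewrite adj_irrefl.
Qed.

Lemma ex_arc_ends (A : edge G) : exists p : G * G,
  [/\ val A = [set p.1; p.2]%SET, arc A 0 = point p.1 & arc A 1 = point p.2].
Proof. by have [x [y H]] := arc_ends emb A; exists (x, y). Qed.

Definition src A := (projT1 (cid (ex_arc_ends A))).1.
Definition tgt A := (projT1 (cid (ex_arc_ends A))).2.

Lemma src_tgt A :
  [/\ val A = [set src A; tgt A]%SET, arc A 0 = point (src A) & arc A 1 = point (tgt A)].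
Proof. by rewrite /src /tgt; case: cid. Qed.

Lemma src_neq_tgt A : src A != tgt A.
Proof.
have := edge_card A; have [-> _ _] := src_tgt A.
by rewrite cards2; case: eqP.
Qed.

Definition endpoint (t : R) := t = 0 \/ t = 1.

(** Arcs meet only at common ends. *)
Lemma arc_eq A B (s t : R) : 0 <= s <= 1 -> 0 <= t <= 1 -> arc A s = arc B t ->
  (A = B /\ s = t) \/ (endpoint s /\ endpoint t).
Proof.
have interior (u : R) : 0 <= u <= 1 -> endpoint u \/ u \in `]0, 1[.
  rewrite in_itv /= => /andP[u0 u1]; rewrite !lt_neqAle u0 u1 !andbT.
  case: (eqVneq u 0) => [->|u0']; first by left; left.
  case: (eqVneq u 1) => [->|u1']; first by left; right.
  by right.
have not_end A' B' (u v : R) : u \in `]0, 1[ -> endpoint v -> arc A' u <> arc B' v.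
  move=> ui; have [_ E0 E1] := src_tgt B'.
  by case=> ->; rewrite ?E0 ?E1; exact: arc_point.
move=> s01 t01 E0; case: (interior s s01) => si; case: (interior t t01) => ti.
- by right.
- by case: (not_end B A t s ti si).
- by case: (not_end A B s t si ti).
- left; case: (eqVneq A B) => [AB|AB]; last first.
    by case: (arc_arc (e := emb) AB si ti E0).
  split=> //; apply: (arc_inj (e := emb) (A := A)); rewrite ?in_itv //=.
  by rewrite E0 AB.
Qed.

(** Every arc is cut into three pieces. The outer pieces belong to the vertex
    at their end, the middle piece belongs to no vertex. *)
Local Notation third := (edge G * 'I_3)%type.
Definition third_itv (i : 'I_3) : set R := `[i%:R / 3, i.+1%:R / 3].
Definition piece (p : third) : set S := arc p.1 @` third_itv p.2.
Definition owner (p : third) : option G :=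
  match val p.2 with 0%N => Some (src p.1) | 1%N => None | _ => Some (tgt p.1) end.

Lemma third_sub i : third_itv i `<=` `[0, 1].
Proof.
move=> t; rewrite /third_itv /= !in_itv /= => /andP[t1 t2].
have i0 : 0 <= (i : nat)%:R :> R by exact: ler0n.
have i3 : i.+1%:R <= 3 :> R by rewrite ler_nat ltn_ord.
by apply/andP; split; lra.
Qed.

Lemma piece_compact p : compact (piece p).
Proof.
apply: continuous_compact; last exact: segment_compact.
exact: continuous_subspaceW (@third_sub p.2) (@arc_continuous _ _ _ emb p.1).
Qed.

Lemma piece_connected p : connected (piece p).
Proof.
apply: connected_continuous_connected; first exact: segment_connected.
exact: continuous_subspaceW (@third_sub p.2) (@arc_continuous _ _ _ emb p.1).
Qed.

(** Pairs of pieces that cannot meet: outer pieces of different vertices,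
    middle pieces of different edges, and a middle piece and an outer piece of
    a vertex that is not an end. *)
Definition apart (p q : third) : bool :=
  match owner p, owner q with
  | Some u, Some v => u != v
  | None, None => p.1 != q.1
  | None, Some v => v \notin val p.1
  | Some v, None => v \notin val q.1
  end.

Lemma third_cases (i : 'I_3) : [\/ i = 0 :> nat, i = 1 :> nat | i = 2 :> nat]%N.
Proof. by case: i => [[|[|[|]]]] //; [constructor 1 | constructor 2 | constructor 3]. Qed.

Lemma third_endpoint p s : third_itv p.2 s -> endpoint s ->
  exists2 u, owner p = Some u & arc p.1 s = point u.
Proof.
have [_ E0 E1] := src_tgt p.1; rewrite /third_itv /owner /= in_itv /=.
case: (third_cases p.2) => -> /= /andP[s1 s2] [] s01; rewrite s01 in s1 s2 *.
- by exists (src p.1).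
- by clear -s1 s2; exfalso; lra.
- by clear -s1 s2; exfalso; lra.
- by clear -s1 s2; exfalso; lra.
- by clear -s1 s2; exfalso; lra.
- by exists (tgt p.1).
Qed.

Lemma apart_disjoint p q : apart p q -> piece p `&` piece q = classical_sets.set0.
Proof.
move=> pq; apply/seteqP; split=> // _ [[s si <-] [t ti E0]].
have s01 : 0 <= s <= 1 by have := third_sub si; rewrite /= in_itv.
have t01 : 0 <= t <= 1 by have := third_sub ti; rewrite /= in_itv.
case: (arc_eq t01 s01 E0) => [[AB st]|[te se]]; last first.
  have [u pu su] := third_endpoint si se; have [v qv tv] := third_endpoint ti te.
  move: pq; rewrite /apart pu qv => /negP; apply; apply/eqP.
  by apply: (point_inj (e := emb)); rewrite -su -tv.
move: pq; rewrite /apart /owner; have [vE _ _] := src_tgt p.1.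
rewrite st in ti; move: si ti; rewrite /third_itv /= !in_itv /=.
case: (third_cases p.2) => ->; case: (third_cases q.2) => -> /= /andP[s1 s2] /andP[t1 t2];
  rewrite AB ?eqxx // ?vE ?inE ?eqxx ?orbT //; clear -s1 s2 t1 t2; lra.
Qed.

(** There are finitely many pairs of pieces, and all are compact. *)
Lemma ex_fine_grid : exists n, forall (W : finType) (kap : nat * nat -> W),
  corner_class n a b kap -> forall p q, apart p q ->
  forall c, near_cells (n := n) kap (piece p) c -> near_cells kap (piece q) c -> False.
Proof.
have [N NP] : exists N : third * third -> nat, forall pq : third * third,
    apart pq.1 pq.2 -> forall n, (N pq <= n)%N ->
    forall (W : finType) (kap : nat * nat -> W), corner_class n a b kap ->
    forall c, near_cells (n := n) kap (piece pq.1) c -> near_cells kap (piece pq.2) c -> False.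
  apply: (@fin_all_exists _ (fun=> nat) (fun (pq : third * third) N =>
    apart pq.1 pq.2 -> forall n, (N <= n)%N ->
    forall (W : finType) (kap : nat * nat -> W), corner_class n a b kap ->
    forall c, near_cells (n := n) kap (piece pq.1) c -> near_cells kap (piece pq.2) c -> False)).
  move=> [p q] /=; case: (boolP (apart p q)) => pq; last by exists 0%N.
  have [N NP] := near_disjoint ba (@piece_compact p) (@piece_compact q) (apart_disjoint pq).
  by exists N => _; exact: NP.
exists (\max_pq N pq)%N => W kap kapP p q pq c.
by apply: (NP (p, q) pq) => //; exact: leq_bigmax.
Qed.

Section Fibres.
Variables (n : nat) (W : finType) (kap : nat * nat -> W).
Hypothesis kapP : corner_class n a b kap.
Local Notation cell := ('I_n.+1 * 'I_n.+1)%type.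
Local Notation near p := (near_cells (n := n) kap (piece p)).
Hypothesis fine : forall p q, apart p q -> forall c, near p c -> near q c -> False.
Local Notation glink := (link (@gc1 n) (@gc2 n a b)).

Definition star_cell v (c : cell) : bool :=
  [exists p : third, (owner p == Some v) && near p c].

Lemma star_cellP v c :
  reflect (exists2 p : third, owner p = Some v & near p c) (star_cell v c).
Proof.
by apply: (iffP existsP) => [[p /andP[/eqP ? ?]]|[p /eqP pv pc]]; exists p; rewrite ?pv.
Qed.

Lemma star_cell_uniq u v c : star_cell u c -> star_cell v c -> u = v.
Proof.
move=> /star_cellP[p pu pc] /star_cellP[q qv qc]; apply/eqP; apply: contraT => uv.
by case: (@fine p q _ c pc qc); rewrite /apart pu qv.
Qed.

Definition first (A : edge G) : third := pair A (ord0 : 'I_3).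
Definition middle (A : edge G) : third := pair A (lift ord0 ord0 : 'I_3).
Definition last_third (A : edge G) : third := pair A (ord_max : 'I_3).
Definition start A : cell := cell_of n (arc A (1 / 3)).
Definition stop A : cell := cell_of n (arc A (2 / 3)).
Definition vertex_cell v : cell := cell_of n (point v).

Lemma near_arc p s : third_itv p.2 s -> near p (cell_of n (arc p.1 s)).
Proof. by move=> si; apply: near_cell_of; exists s. Qed.

Lemma start_near A : near (first A) (start A) /\ near (middle A) (start A).
Proof.
split; apply: (near_arc (p := (_, _))); rewrite /third_itv /= in_itv /= /bump /=;
  apply/andP; split; lra.
Qed.

Lemma stop_near A : near (middle A) (stop A) /\ near (last_third A) (stop A).
Proof.
split; apply: (near_arc (p := (_, _))); rewrite /third_itv /= in_itv /= /bump /=;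
  apply/andP; split; lra.
Qed.

Lemma vertex_near p v : owner p = Some v -> near p (vertex_cell v).
Proof.
have [_ E0 E1] := src_tgt p.1; rewrite /owner /vertex_cell /=.
case: (third_cases p.2) => pE; rewrite pE // => -[<-]; rewrite -?E0 -?E1;
  apply: near_arc; rewrite /third_itv /= in_itv /= pE; apply/andP; split; lra.
Qed.

Lemma star_start A : star_cell (src A) (start A).
Proof. by apply/star_cellP; exists (first A) => //; have [] := start_near A. Qed.

Lemma star_stop A : star_cell (tgt A) (stop A).
Proof. by apply/star_cellP; exists (last_third A) => //; have [] := stop_near A. Qed.

(** The cells near the middle piece of A that can be reached from its start
    without meeting the star of the target are added to the fibre of the
    source. *)
Definition free A c := near (middle A) c && ~~ star_cell (tgt A) c.
Definition reach A c :=
  connect (glink (fun h => free A (gc1 h) && free A (gc2 a b h))) (start A) c.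

Lemma start_free A : free A (start A).
Proof.
apply/andP; split; first by have [] := start_near A.
apply/negP => /(star_cell_uniq (star_start A)) E0.
by have := src_neq_tgt A; rewrite E0 eqxx.
Qed.

Lemma link_free (P : pred cell) c d :
  glink (fun h => P (gc1 h) && P (gc2 a b h)) c d -> P c /\ P d.
Proof.
case/existsP=> h /andP[/andP[h1 h2]].
by case/orP=> /andP[/eqP <- /eqP <-].
Qed.

Lemma reach_free A c : reach A c -> free A c.
Proof.
move=> Ac; apply: (connect_ind (P := fun c => free A c) _ Ac (start_free A)).
by move=> u v /link_free[].
Qed.

Lemma reach_star A v c : reach A c -> star_cell v c -> v = src A.
Proof.
move=> /reach_free/andP[mc tc] vc; have := vc => /star_cellP[p pv pc].
have : v \in val A.
  apply: contraT => vA; case: (@fine (middle A) p _ c mc pc).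
  by rewrite /apart pv.
have [-> _ _] := src_tgt A; rewrite !inE => /orP[/eqP //|/eqP vt].
by rewrite -vt vc in tc.
Qed.

Lemma reach_uniq A B c : reach A c -> reach B c -> A = B.
Proof.
move=> /reach_free/andP[Ac _] /reach_free/andP[Bc _]; apply/eqP; apply: contraT => AB.
by case: (@fine (middle A) (middle B) _ c Ac Bc).
Qed.

Definition in_fibre v c := star_cell v c || [exists A, reach A c && (src A == v)].
Definition fibre c : option G := [pick v | in_fibre v c].

Lemma in_fibre_uniq u v c : in_fibre u c -> in_fibre v c -> u = v.
Proof.
case/orP=> [uc|/existsP[A /andP[Ac /eqP <-]]];
case/orP=> [vc|/existsP[B /andP[Bc /eqP <-]]].
- exact: star_cell_uniq uc vc.
- exact: reach_star Bc uc.
- by rewrite (reach_star Ac vc).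
- by rewrite (reach_uniq Ac Bc).
Qed.

Lemma fibreP v c : fibre c = Some v <-> in_fibre v c.
Proof.
rewrite /fibre; case: pickP => [u uc|no]; last by rewrite no.
by split=> [[<-]//|vc]; rewrite (in_fibre_uniq uc vc).
Qed.

Lemma inner_of_fibre v h : in_fibre v (gc1 h) -> in_fibre v (gc2 a b h) ->
  inner (@gc1 n) (@gc2 n a b) fibre h.
Proof. by rewrite /inner => /fibreP -> /fibreP ->; rewrite eqxx. Qed.

Lemma star_connected_root v c : star_cell v c ->
  connect (glink (inner (@gc1 n) (@gc2 n a b) fibre)) (vertex_cell v) c.
Proof.
case/star_cellP=> p pv pc.
have := near_connected kapP (@piece_connected p) (vertex_near pv) pc.
apply: connect_sub => d d' /existsP[h /andP[/andP[h1 h2] hd]].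
apply/connect1/existsP; exists h; rewrite hd andbT.
by apply: (@inner_of_fibre v); apply/orP; left; apply/star_cellP; exists p.
Qed.

(** Pieces are connected and the outer pieces of v contain its point, so their
    near cells are connected to its cell; the added parts start in the star of
    v. *)
Lemma fibre_connected c v : fibre c = Some v ->
  connect (glink (inner (@gc1 n) (@gc2 n a b) fibre)) (vertex_cell v) c.
Proof.
move/fibreP/orP=> [|/existsP[A /andP[Ac /eqP <-]]]; first exact: star_connected_root.
apply: connect_trans (star_connected_root (star_start A)) _.
suff [] : reach A c /\ connect (glink (inner (@gc1 n) (@gc2 n a b) fibre)) (start A) c by [].
apply: (connect_ind (P := fun c => reach A c /\
  connect (glink (inner (@gc1 n) (@gc2 n a b) fibre)) (start A) c) _ Ac).
  move=> d d' dd' [Ad sd]; have Ad' : reach A d' := connect_trans Ad (connect1 dd').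
  split=> //; apply: connect_trans sd (connect1 _).
  have /existsP[h /andP[_ hd]] := dd'; apply/existsP; exists h; rewrite hd andbT.
  have inA e : reach A e -> in_fibre (src A) e.
    by move=> Ae; apply/orP; right; apply/existsP; exists A; rewrite Ae eqxx.
  by apply: (@inner_of_fibre (src A)); apply: inA;
    case/orP: hd => /andP[/eqP e1 /eqP e2]; rewrite ?e1 ?e2.
by split; exact: connect0.
Qed.

(** The near cells of the middle piece lead from the star of the source to the
    star of the target. The first step into the star of the target leaves the
    fibre of the source. *)
Lemma ex_crossing (A : edge G) : exists h : bool * cell, exists u v,
  [/\ val A = [set u; v]%SET, fibre (gc1 h) = Some u & fibre (gc2 a b h) = Some v].
Proof.
have [E0 _ _] := src_tgt A.
have [s1 s2] := start_near A; have [t1 t2] := stop_near A.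
have con := near_connected kapP (@piece_connected (middle A)) s2 t1.
apply: contrapT => none.
have : reach A (stop A).
  apply: (connect_ind (P := fun c => reach A c) _ con); last exact: connect0.
  move=> c d cd Ac; have [cn dn] := link_free cd.
  have fc := reach_free Ac.
  case: (boolP (star_cell (tgt A) d)) => td; last first.
    apply: connect_trans Ac (connect1 _); have /existsP[h /andP[_ hd]] := cd.
    apply/existsP; exists h; rewrite hd andbT.
    have fd : free A d by rewrite /free dn.
    by case/orP: hd => /andP[/eqP -> /eqP ->]; rewrite fc fd.
  have cF : fibre c = Some (src A).
    by apply/fibreP/orP; right; apply/existsP; exists A; rewrite Ac eqxx.
  have dF : fibre d = Some (tgt A) by apply/fibreP/orP; left.
  case: none; have /existsP[h /andP[_ hd]] := cd; exists h.
  case/orP: hd => /andP[/eqP h1 /eqP h2].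
    by exists (src A), (tgt A); rewrite h1 h2.
  by exists (tgt A), (src A); rewrite h1 h2 finset.setUC.
by move/reach_free/andP => [_]; rewrite star_stop.
Qed.

End Fibres.

(** The fibres of the vertices in a fine grid are a minor model of the graph,
    and the numbers of cells, corners and sides are N^2, N^2 + chi and 2 N^2. *)
Theorem embedded_euler (F : {set edge G}) : F != finset.set0 ->
  (4 <= #|support (fun A : edge G => val A) F|)%N ->
  (2 * #|F| + 4 * (a && b) <= 4 * #|support (fun A : edge G => val A) F| +
     #|triangles (fun A : edge G => val A) F|)%N.
Proof.
move=> F0 S4; have [n fine] := ex_fine_grid.
have [W [kap [kapP cW]]] := ex_corner_class n ba.
have [rho rhoP] : exists rho : edge G -> bool * ('I_n.+1 * 'I_n.+1), forall A,
    exists u v, [/\ val A = [set u; v]%SET, fibre kap (gc1 (rho A)) = Some u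
      & fibre kap (gc2 a b (rho A)) = Some v].
  apply: (@fin_all_exists _ (fun=> (bool * ('I_n.+1 * 'I_n.+1))%type)
    (fun A h => exists u v, [/\ val A = [set u; v]%SET,
      fibre kap (gc1 h) = Some u & fibre kap (gc2 a b h) = Some v])) => A.
  exact: ex_crossing kapP (fine W kap kapP) A.
refine (@minor_euler _ _ _ (@gc1 n) (@gc2 n a b) (gw1 kap) (gw2 kap) _ _
  (fun A : edge G => val A) edge_card val_inj F (fibre kap) rho
  (vertex_cell n) _ _ _ _ _ (a && b : nat) _ _ _ _) => //.
- move=> c v; exact: fibre_connected kapP (fine W kap kapP) c v.
- exact: grid_cycles kapP.
- exact: grid_conn.
- exact: grid_co_conn kapP.
- by rewrite cW !card_prod card_bool !card_ord; lia.
- by case: (a && b).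
Qed.

End Model.

(** * List chromatic numbers and degrees *)

Section ListChromaticNumber.
Variables (I : finType) (r : rel I) (r_irr : irreflexive r).

Lemma list_chromatic_number_le k : choosable r k -> (list_chromatic_number r_irr <= k)%N.
Proof.
move=> ck; rewrite /list_chromatic_number; case: ex_minnP => n _; apply.
exact/asboolP.
Qed.

(** Give all elements the same list. *)
Lemma clique_list_chromatic_number (K : {set I}) :
  {in K &, forall i j, i != j -> r i j} -> (#|K| <= list_chromatic_number r_irr)%N.
Proof.
move=> clique; rewrite /list_chromatic_number; case: ex_minnP => n /asboolP cn _.
have [i|c [cL c_proper]] := cn nat (fun=> [fset x in iota 0 n]%fset).
  by rewrite card_fseq undup_id ?iota_uniq // size_iota.
have cn' i : (c i < n)%N by have := cL i; rewrite !inE mem_iota.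
rewrite -[X in (_ <= X)%N]card_ord -(@card_in_imset _ _ (fun i => Ordinal (cn' i)) K).
  exact: max_card.
move=> i j iK jK [/eqP cij]; apply/eqP; apply: contraT => ij.
by have := c_proper i j (clique i j iK jK ij); rewrite cij.
Qed.

End ListChromaticNumber.

Section Degrees.
Variable G : sgraph.
Local Notation ends := (fun A : edge G => val A).

Lemma edge_adj (A : edge G) x y : val A = [set x; y]%SET -> adj x y.
Proof.
move=> AE; have /imsetP[[u v]] := valP A; rewrite inE /= => uv; rewrite AE => E0.
have xy : x != y by have := edge_card A; rewrite AE cards2; case: eqP.
have : x \in [set u; v]%SET by rewrite -E0 !inE eqxx.
have : y \in [set u; v]%SET by rewrite -E0 !inE eqxx orbT.
rewrite !inE => /orP[]/eqP yE /orP[]/eqP xE; move: xy uv; rewrite xE yE ?eqxx //.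
by rewrite adj_sym.
Qed.

Lemma adj_edge (x y : G) : adj x y -> exists A : edge G, val A = [set x; y]%SET.
Proof.
move=> xy; have H : [set x; y]%SET \in edge_set G.
  by apply/imsetP; exists (x, y); rewrite ?inE.
by exists (exist (fun A => A \in edge_set G) _ H).
Qed.

Lemma card_incident v : #|[set A : edge G | v \in val A]%SET| = #|[set y | adj v y]%SET|.
Proof.
rewrite -(card_imset (mem [set A : edge G | v \in val A]%SET) val_inj).
rewrite -(@card_in_imset _ _ (fun y => [set v; y]%SET) [set y | adj v y]%SET).
  apply: eq_card => B; apply/imsetP/imsetP => [[A]|[y]]; rewrite inE.
    move=> vA ->; have [x [y [xy AE]]] := ends_mem (@edge_card G) A.
    move: vA; rewrite AE !inE => /orP[]/eqP ->.
      by exists y; rewrite // inE (edge_adj AE).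
    by exists x; rewrite 1?finset.setUC // inE adj_sym (edge_adj AE).
  by move=> /adj_edge[A AE] ->; exists A; rewrite ?inE AE ?inE ?eqxx.
move=> y z; rewrite !inE => vy vz /setP/(_ y); rewrite !inE eqxx orbT.
case: eqP vy => [->|_ _ /esym/eqP //]; by rewrite adj_irrefl.
Qed.

Lemma dg_le_max (F : {set edge G}) v : (dg ends F v <= max_degree G)%N.
Proof.
apply: (@leq_trans #|[set A : edge G | v \in val A]%SET|).
  by apply/subset_leq_card/fintype.subsetP => A; rewrite !inE => /andP[].
by rewrite card_incident; exact: (leq_bigmax (F := fun x : G => #|[set y | adj x y]%SET|)).
Qed.

Lemma max_degree_attained : (0 < max_degree G)%N ->
  exists v : G, #|[set A : edge G | v \in val A]%SET| = max_degree G.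
Proof.
move=> D0; apply: contrapT => none; move: D0; rewrite lt0n => /negP; apply.
suff : (max_degree G <= (max_degree G).-1)%N by lia.
apply/bigmax_leqP => v _.
have := leq_bigmax (F := fun x : G => #|[set y | adj x y]%SET|) v.
rewrite -[\max_(x : G) _]/(max_degree G) /= leq_eqVlt => /orP[/eqP E0|]; last by lia.
by case: none; exists v; rewrite card_incident.
Qed.

(** Triangles with a common edge that have the same vertices coincide, as the
    graph is simple; otherwise they form a kite. *)
Lemma no_kite_triangles (F : {set edge G}) : ~ has_kite G ->
  finset.trivIset (triangles ends F).
Proof.
move=> nokite; apply/finset.trivIsetP => X Y XT YT XY; apply: contraT => /pred0Pn[A /andP[AX AY]].
case: nokite.
have cycle Z : Z \in triangles ends F -> is_3cycle (support ends Z).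
  move=> ZT; have [_ _ sZ] := triangle_support (@edge_card G) ZT; split=> // x y xZ yZ xy.
  have [B _ BE] := triangle_edges (@edge_card G) val_inj ZT xZ yZ xy.
  exact: edge_adj BE.
have sub (Z : {set edge G}) : A \in Z -> val A \subset support ends Z.
  by move=> AZ; apply/fintype.subsetP => v; exact: mem_support.
exists (support ends X), (support ends Y), A; split; rewrite ?sub //; try exact: cycle.
apply: contra XY => /eqP sXY.
have cX : #|X| = #|Y|.
  by move: XT YT; rewrite !inE => /and3P[_ /eqP -> _] /and3P[_ /eqP -> _].
rewrite eq_sym eqEcard cX leqnn andbT; apply/fintype.subsetP => B BY.
have [x [y [xy BE]]] := ends_mem (@edge_card G) B.
have xS : x \in support ends X.
  by rewrite sXY; apply: (mem_support BY); rewrite BE !inE eqxx.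
have yS : y \in support ends X.
  by rewrite sXY; apply: (mem_support BY); rewrite BE !inE eqxx orbT.
have [B' B'X B'E] := triangle_edges (@edge_card G) val_inj XT xS yS xy.
by rewrite (_ : B = B') //; apply: val_inj; rewrite BE.
Qed.

Lemma clique_edges : (0 < max_degree G)%N ->
  (max_degree G <= list_edge_chromatic_number G)%N.
Proof.
move=> /max_degree_attained[v <-]; apply: clique_list_chromatic_number => A B.
by rewrite !inE => vA vB AB; rewrite /edge_conflict AB; apply/existsP; exists v; rewrite vA.
Qed.

Lemma clique_total : (0 < max_degree G)%N ->
  (max_degree G < list_total_chromatic_number G)%N.
Proof.
move=> /max_degree_attained[v vD].
pose K : {set G + edge G} := (inl v |: [set inr A | A in [set A : edge G | v \in val A]])%SET.
have <- : #|K| = (max_degree G).+1.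
  rewrite cardsU1 card_imset; last by move=> ? ? [].
  by rewrite vD (_ : inl v \notin _) //; apply/imsetP => -[].
apply: clique_list_chromatic_number => i j.
rewrite /K !inE => /orP[/eqP ->|/imsetP[A + ->]] /orP[/eqP ->|/imsetP[B + ->]];
  rewrite ?eqxx ?inE //= => vA vB AB.
by rewrite /edge_conflict (_ : A != B); [apply/existsP; exists v; rewrite vA|].
Qed.

End Degrees.

(** * From Euler's inequality to list colourings *)

Section Choosability.
Variables (R : realType) (G : sgraph) (a b : bool) (ba : b ==> a).
Hypothesis emb : embeddable R G (glued_square R a b).
Hypothesis nokite : ~ has_kite G.
Local Notation ends := (fun A : edge G => val A).
Local Notation D := (max_degree G).

(** An edge keeps m colours when the colour of one end is removed, and a
    vertex has l colours. The cases are those of large degree, of smaller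
    degree with one more colour for each edge, and of degree 6 on the
    projective plane with long lists at the vertices. *)
Definition admissible m l :=
  [\/ [/\ m = D, 9 <= D & 10 <= l]%N, [/\ m = D.+1, 7 <= D & 9 <= l]%N
    | [/\ m = 7, D = 6, 13 <= l & a && b]%N].

Lemma admissible_total_colorable (C : choiceType) (c0 : C) (Lv : G -> {fset C})
    (Le : edge G -> {fset C}) m l :
  admissible m l ->
  (forall (A : edge G) v x, v \in val A -> x \in Lv v -> (m <= #|` Le A `\ x|%fset)%N) ->
  (forall v, l <= #|` Lv v|)%N ->
  total_colorable ends Lv Le finset.setT.
Proof.
move=> ml Le_size Lv_size; apply: contrapT => bad.
have [l9 m7] : (9 <= l /\ 7 <= m)%N by case: ml => -[]; lia.
have [F /minsetP[/asboolP F_bad F_min] _] := @minset_exists _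
  (fun F : {set edge G} => `[< ~ total_colorable ends Lv Le F >]) finset.setT (introT (asboolP _) bad).
have {}F_min (F' : {set edge G}) : F' \proper F -> total_colorable ends Lv Le F'.
  move=> F'F; apply: contrapT => F'bad; move: (F'F).
  have -> : F' = F by apply: F_min; [exact/asboolP | exact: fintype.proper_sub].
  by rewrite fintype.properxx.
have F0 : F != finset.set0 := F_neq0 Lv_size c0 F_bad (leq_trans (isT : 0 < 9)%N l9).
(* On three vertices F has at most three edges, so its degree sums are at most
   6, against [min_degree_sum]. *)
have S4 : (4 <= #|support ends F|)%N.
  rewrite ltnNge; apply/negP => S3.
  have F3 : (#|F| <= 3)%N.
    rewrite -(card_imset (mem F) val_inj).
    apply: (@leq_trans #|[set B : {set G} | (B \subset support ends F) && (#|B| == 2%N)]%SET|).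
      apply/subset_leq_card/fintype.subsetP => _ /imsetP[A AF ->]; rewrite inE edge_card eqxx andbT.
      by apply/fintype.subsetP => v; exact: mem_support.
    by rewrite cards_draws; case: #|_| S3 => [|[|[|[|]]]].
  have d3 v : (dg ends F v <= 3)%N.
    by apply: leq_trans F3; apply/subset_leq_card/fintype.subsetP => A; rewrite inE => /andP[].
  have [A AF] := finset.set0Pn _ F0.
  have [x [y [xy AE]]] := ends_mem (@edge_card G) A.
  have xA : x \in val A by rewrite AE !inE eqxx.
  have yA : y \in val A by rewrite AE !inE eqxx orbT.
  have dx : (2 * dg ends F x < l)%N by have := d3 x; clear -l9; lia.
  have sum := min_degree_sum (@edge_card G) Le_size Lv_size F_bad F_min AF xA yA xy dx.
  have := leq_trans sum (leq_add (d3 x) (d3 y)); clear -m7; lia.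
have [e] := emb; have euler := embedded_euler ba e F0 S4.
have triv := no_kite_triangles F nokite.
have bound := dg_le_max F.
case: ml => [[mD D9 l10]|[mD D7 _]|[m7' D6 l13 ab]].
- exact: (discharge_tight (@edge_card G) val_inj Le_size Lv_size c0 F_bad F_min
    bound triv euler mD D9 l10).
- exact: (discharge_loose (@edge_card G) val_inj Le_size Lv_size c0 F_bad F_min
    bound triv euler mD D7 l9).
- apply: (discharge_six (@edge_card G) val_inj Le_size Lv_size c0 F_bad F_min
    bound triv euler m7' D6 l13).
  by rewrite ab.
Qed.

(** Edge colourings are total colourings in which the vertices use private
    colours. *)
Lemma admissible_edge_choosable k : admissible k 13 -> choosable (@edge_conflict G) k.
Proof.
move=> kD C L sizeL.
(* The vertices get lists of 13 private colours, so they do not interfere. *)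
pose Lv (v : G) : {fset (C + nat)%type} := [fset inr i | i in [fset j in iota 0 13]]%fset.
pose Le (A : edge G) : {fset (C + nat)%type} := [fset inl x | x in L A]%fset.
have [||cv [ce [_ ceL _ _ ce_inj]]] := admissible_total_colorable (inr 0%N) (Lv := Lv) (Le := Le) kD.
- move=> A v x _ /imfsetP[i _ ->]; rewrite mem_fsetD1.
    by rewrite card_imfset; [exact: sizeL | move=> ? ? []].
  by apply/imfsetP => -[].
- move=> v; rewrite card_imfset; last by move=> ? ? [].
  suff : (#|` [fset j in iota 0 13]%fset| = 13)%N by move=> /= ->.
  by rewrite card_fseq undup_id ?iota_uniq.
have [c cP] : exists c : edge G -> C, forall A, c A \in L A /\ ce A = inl (c A).
  apply: (@fin_all_exists _ (fun=> C) (fun A x => x \in L A /\ ce A = inl x)) => A.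
  by have /imfsetP[x xL ->] := ceL A (finset.in_setT A); exists x.
exists c; split=> [A|A B /andP[AB /existsP[v /andP[vA vB]]]]; first by have [] := cP A.
apply: contraNneq AB => cAB; apply/eqP; apply: (ce_inj A B _ _ v) => //.
by have [_ ->] := cP A; have [_ ->] := cP B; rewrite cAB.
Qed.

(** Of k + 1 colours in the list of an edge at least k differ from the colour
    of an end. *)
Lemma admissible_total_choosable k : (0 < D)%N -> admissible k k.+1 ->
  choosable (@total_conflict G) k.+1.
Proof.
move=> D0 kD C L sizeL.
have [v0 _] := max_degree_attained D0.
have [c0 _] : exists c, c \in L (inl v0).
  by apply/fset0Pn; rewrite -cardfs_gt0; apply: leq_trans (sizeL _).
have [||cv [ce [cvL ceL ce_cv cv_cv ce_inj]]] := admissible_total_colorable c0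
  (Lv := fun v => L (inl v)) (Le := fun A => L (inr A)) kD.
- move=> A v x _ _; have := sizeL (inr A); rewrite (cardfsD1 x).
  by case: (x \in L (inr A)) => //=; lia.
- by move=> v; exact: sizeL.
exists (fun i => match i with inl v => cv v | inr A => ce A end); split.
  by case=> [v|A]; [exact: cvL | exact: (ceL A (finset.in_setT A))].
case=> [x|A] [y|B] /=.
- move=> xy; have [A AE] := adj_edge xy.
  apply: (cv_cv A (finset.in_setT A)); rewrite ?AE ?inE ?eqxx ?orbT //.
  by apply: contraTneq xy => ->; rewrite adj_irrefl.
- by move=> xB; rewrite eq_sym; exact: ce_cv (finset.in_setT B) x xB.
- by move=> yA; exact: ce_cv (finset.in_setT A) y yA.
move=> /andP[AB /existsP[v /andP[vA vB]]]; apply: contraNneq AB => cAB.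
by apply/eqP; apply: (ce_inj A B _ _ v).
Qed.

Lemma large_degree : (9 <= D)%N ->
  list_edge_chromatic_number G = D /\ list_total_chromatic_number G = D.+1.
Proof.
move=> D9; have D0 : (0 < D)%N by lia.
split; apply/eqP; rewrite eqn_leq.
  rewrite clique_edges // andbT; apply/list_chromatic_number_le/admissible_edge_choosable.
  by constructor 1.
rewrite clique_total // andbT; apply/list_chromatic_number_le/admissible_total_choosable => //.
by constructor 1; split=> //; lia.
Qed.

Lemma medium_degree : (7 <= D)%N ->
  (list_edge_chromatic_number G <= D.+1)%N /\ (list_total_chromatic_number G <= D.+2)%N.
Proof.
move=> D7; split; apply/list_chromatic_number_le.
  by apply: admissible_edge_choosable; constructor 2.
by apply: admissible_total_choosable; [lia | constructor 2; split=> //; lia].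
Qed.

Lemma degree_six : a && b -> D = 6%N -> (list_edge_chromatic_number G <= D.+1)%N.
Proof.
move=> ab D6; apply/list_chromatic_number_le/admissible_edge_choosable.
by constructor 3; rewrite D6.
Qed.

End Choosability.

Theorem mainTheorem6 (R : realType) (G : sgraph) (no_kite : ~ has_kite G) :
  (embeddable R G (projective_plane R) ->
     [/\ (9 <= max_degree G)%N ->
           list_edge_chromatic_number G = max_degree G /\
           list_total_chromatic_number G = (max_degree G).+1,
         (6 <= max_degree G)%N ->
           (list_edge_chromatic_number G <= (max_degree G).+1)%N
       & (7 <= max_degree G)%N ->
           (list_total_chromatic_number G <= (max_degree G).+2)%N])
  /\
  (embeddable R G (torus R) \/ embeddable R G (klein_bottle R) ->
     ((9 <= max_degree G)%N ->
        list_edge_chromatic_number G = max_degree G /\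
        list_total_chromatic_number G = (max_degree G).+1)
     /\
     ((7 <= max_degree G)%N ->
        (list_edge_chromatic_number G <= (max_degree G).+1)%N /\
        (list_total_chromatic_number G <= (max_degree G).+2)%N)).
Proof.
split=> [emb|[]emb].
- have tt : true ==> true by []; split=> D.
  + exact: large_degree tt emb no_kite D.
  + move: D; rewrite leq_eqVlt => /orP[/eqP D6|D7].
      exact: degree_six tt emb no_kite isT (esym D6).
    by have [] := medium_degree tt emb no_kite D7.
  + by have [] := medium_degree tt emb no_kite D.
- have ff : false ==> false by [].
  split=> D; [exact: large_degree ff emb no_kite D|exact: medium_degree ff emb no_kite D].
- have ft : false ==> true by [].
  split=> D; [exact: large_degree ft emb no_kite D|exact: medium_degree ft emb no_kite D].
Qed.
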